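(* Let $R$ and $R'$ be semilocal rings, and put $\overline R=R/\mathrm{rad}\,R$, $\overline{R'}=R'/\mathrm{rad}\,R'$. Identify (by the Wedderburn–Artin theorem, via fixed ring isomorphisms) $\overline R=\prod_{i=1}^m R_i$ and $\overline{R'}=\prod_{j=1}^{m'}R'_j$, where $m,m'\ge1$, $R_i=\mathrm{End}_{K_i}(U_i)$ and $R'_j=\mathrm{End}_{K'_j}(U'_j)$ for left vector spaces $U_i$, $U'_j$ of finite dimension $\ge1$ over (not necessarily commutative) fields $K_i$, $K'_j$. Then a bijection $\varphi:\mathbb P(R)\to\mathbb P(R')$ is a $\triangle$-isomorphism if, and only if, it is a $\parallel$-isomorphism such that the induced bijection $\overline\varphi:\mathbb P(\overline R)\to\mathbb P(\overline{R'})$, $\overline p\mapsto\overline{p^\varphi}$, is of the following form: $m=m'$, and there are a permutation $\sigma$ of $\{1,\dots,m\}$ and $\triangle$-isomorphisms $\varphi_k:\mathbb P(R_k)\to\mathbb P(R'_{k^\sigma})$, $k\in\{1,\dots,m\}$, such that $(q^{\overline\varphi})_{k^\sigma}=(q_k)^{\varphi_k}$ for each $q\in\mathbb P(\overline R)$ and each $k\in\{1,\dots,m\}$. In this case, if $\dim U_i>1$ for all $i$, then $\overline\varphi=\widetilde\alpha\,\widetilde\gamma$ (first $\widetilde\alpha$, then $\widetilde\gamma$), where $\gamma\in\mathrm{GL}_2(\overline{R'})$ and $\alpha:\overline R\to\overline{R'}$ is a Jordan isomorphism such that $(x^\alpha)_{k^\sigma}=(x_k)^{\alpha_k}$ for each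 $x\in\overline R$ and each $k$, with each $\alpha_k:R_k\to R'_{k^\sigma}$ an isomorphism or an anti-isomorphism of rings.
   Context: Rings are associative with unit $1\ne0$ (preserved by homomorphisms and anti-homomorphisms). Fields need not be commutative. Mappings are written on the right as exponents, and products of mappings are read from left to right: $x^{fg}=(x^f)^g$. $\mathrm{rad}\,R$ is the Jacobson radical; $R$ is semilocal if $R/\mathrm{rad}\,R$ is artinian (hence semisimple, i.e. isomorphic to a finite direct product of matrix rings over fields). Projective line: $\mathbb P(R)$ is the set of all submodules $R(a,b)$ of the left module $R^2$ such that $(a,b)$ is the first row of a matrix in $\mathrm{GL}_2(R)$. Points $p,q\in\mathbb P(R)$ are distant, $p\,\triangle\,q$, if $p=R(a,b)$, $q=R(c,d)$ for some matrix $\begin{pmatrix}a&b\\c&d\end{pmatrix}\in\mathrm{GL}_2(R)$. Put $\triangle(p)=\{q\in\mathbb P(R)\mid q\,\triangle\,p\}$. Points $p,q$ are parallel, $p\parallel q$, if $\triangle(p)\subseteq\triangle(q)$ (this is known to be an equivalence relation, so $p\parallel q\Leftrightarrow\triangle(p)=\triangle(q)$). A $\triangle$-isomorphism (resp. $\parallel$-isomorphism) $\mathbb P(R)\to\mathbb P(R')$ is a bijection preserving $\triangle$ (resp. $\parallel$) in both directions. The canonical epimorphism $R\to\overline R$, $a\mapsto\overline a$, induces the surjection $\mathbb P(R)\to\mathbb P(\overline R)$, $p=R(a,b)\mapsto\overline p=\overline R(\overline a,\overline b)$; it is known that $p\parallel q\Leftrightarrow\overline p=\overline q$. Hence for a $\parallel$-isomorphism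 $\varphi$ the mapping $\overline\varphi:\overline p\mapsto\overline{p^\varphi}$ is a well-defined bijection. For a product ring $\prod_i R_i$, elements are written $x=(x_i)_i$, and $\mathbb P(\prod_i R_i)$ is identified with $\prod_i\mathbb P(R_i)$ by letting the point generated by $\big((a_i)_i,(b_i)_i\big)$ correspond to $\big(R_i(a_i,b_i)\big)_i$; $q_i$ denotes the $i$-th component of a point $q$. For $\gamma\in\mathrm{GL}_2(S)$, $\widetilde\gamma:\mathbb P(S)\to\mathbb P(S)$ is $S(a,b)\mapsto S\big((a,b)\gamma\big)$. A Jordan homomorphism $\alpha:S\to S'$ is an additive mapping with $1^\alpha=1$ and $(aba)^\alpha=a^\alpha b^\alpha a^\alpha$ for all $a,b$; a Jordan isomorphism is a bijective one. For $S$ semisimple (hence of stable rank 2) it is known that $\mathbb P(S)=\{S(ab-1,a)\mid a,b\in S\}$ and that a Jordan homomorphism $\alpha:S\to S'$ gives a well-defined mapping $\widetilde\alpha:\mathbb P(S)\to\mathbb P(S')$, $S(ab-1,a)\mapsto S'(a^\alpha b^\alpha-1,a^\alpha)$. *)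

(* Defs.v *)
From HB Require Import structures.
From mathcomp Require Import all_boot all_order all_fingroup all_algebra.
From mathcomp Require Import generic_quotient ring_quotient.
From mathcomp Require Import boolp classical_sets.

Set Implicit Arguments.
Unset Strict Implicit.
Unset Printing Implicit Defensive.

Import GRing.Theory.
Local Open Scope classical_set_scope.
Local Open Scope quotient_scope.
Local Open Scope ring_scope.

(* Everything is stated over possibly trivial rings (pzRingType), so that     *)
(* endomorphism rings and finite products are rings without side conditions;  *)
(* the requirement 1 != 0 is imposed by the hypotheses where it is needed.    *)

Section Radical.
Variable R : pzRingType.

Definition left_ideal (I : set R) : Prop :=
  [/\ I 0, forall x y, I x -> I y -> I (x + y) & forall a x, I x -> I (a * x)].

Definition maximal_left_ideal (M : set R) : Prop :=
  [/\ left_ideal M, M != setT &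
      forall J, left_ideal J -> M `<=` J -> J = M \/ J = setT].

Definition jacobson_radical : set R :=
  [set a | forall M, maximal_left_ideal M -> M a].

(* Descending chain condition on left ideals. *)
Definition artinian : Prop :=
  forall I : nat -> set R, (forall n, left_ideal (I n)) ->
    (forall n, I n.+1 `<=` I n) ->
    exists N : nat, forall n : nat, (N <= n)%N -> I n = I N.

Definition rad_pred : {pred R} := fun a => `[< jacobson_radical a >].

Lemma left_idealN I x : left_ideal I -> I x -> I (- x).
Proof. by case=> _ _ IM Ix; rewrite -mulN1r; apply: IM. Qed.

Lemma left_idealB I x y : left_ideal I -> I x -> I y -> I (x - y).
Proof. by move=> lI Ix Iy; case: (lI) => _ ID _; apply: ID => //; exact: left_idealN. Qed.

Lemma rad_zmod_closed : zmod_closed rad_pred.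
Proof.
split=> [|x y]; first by apply/asboolP => M [[]].
move=> /asboolP rx /asboolP ry; apply/asboolP => M mM.
by case: (mM) => lM _ _; apply: left_idealB => //; [apply: rx | apply: ry].
Qed.

HB.instance Definition _ := GRing.isZmodClosed.Build R rad_pred rad_zmod_closed.

Lemma rad_mull a x : x \in rad_pred -> a * x \in rad_pred.
Proof.
move=> /asboolP rx; apply/asboolP => M mM.
by case: (mM) => -[_ _ MM] _ _; apply: MM; apply: rx.
Qed.

Lemma left_ideal_colon M b :
  left_ideal M -> left_ideal [set x | M (x * b)].
Proof.
case=> M0 MD MM; split => [|x y /= Mx My|a x /= Mx]; first by rewrite /= mul0r.
- by rewrite mulrDl; apply: MD.
- by rewrite -mulrA; apply: MM.
Qed.

Lemma maximal_left_ideal_colon M b :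
  maximal_left_ideal M -> ~ M b -> maximal_left_ideal [set x | M (x * b)].
Proof.
move=> [lM MnT maxM] Mb; split; first exact: left_ideal_colon.
  by apply/eqP => /seteqP[_ /(_ 1 Logic.I)]; rewrite /= mul1r.
move=> J lJ MJ.
have lK : left_ideal [set z | exists2 x, J x & M (z - x * b)].
  case: (lJ) => J0 JD JM; case: (lM) => M0 MD MM; split => /=.
  - by exists 0 => //; rewrite mul0r subr0.
  - move=> x y [u Ju Mu] [v Jv Mv]; exists (u + v); first exact: JD.
    by rewrite mulrDl opprD addrACA; apply: MD.
  - move=> a x [u Ju Mu]; exists (a * u); first exact: JM.
    by rewrite -mulrA -mulrBr; apply: MM.
have MK : M `<=` [set z | exists2 x, J x & M (z - x * b)].
  by move=> z Mz /=; exists 0; [case: lJ | rewrite mul0r subr0].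
have [EK|EK] := maxM _ lK MK.
  left; apply/seteqP; split=> // x Jx /=; rewrite -EK /=.
  by exists x => //; rewrite subrr; case: lM.
right; apply/seteqP; split => // y _.
have [x Jx Mx] : [set z | exists2 x, J x & M (z - x * b)] (y * b) by rewrite EK.
have : J (y - x) by apply: MJ; rewrite /= mulrBl.
by case: (lJ) => _ JD _ /JD/(_ Jx); rewrite subrK.
Qed.

Lemma rad_mulr a x : x \in rad_pred -> x * a \in rad_pred.
Proof.
move=> /asboolP rx; apply/asboolP => M mM.
have [Ma|Ma] := pselect (M a).
  by case: (mM) => -[_ _ MM] _ _; apply: MM.
exact: rx (maximal_left_ideal_colon mM Ma).
Qed.

(* ring_quotient only puts a ring structure on quotients of commutative       *)
(* rings; the multiplication of R / rad R is added to its additive quotient.  *)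
Definition quot_rad : Type := Quotient.quot rad_pred.
HB.instance Definition _ := GRing.Zmodule.on quot_rad.

Definition bar_mul (x y : quot_rad) : quot_rad :=
  \pi_(Quotient.quot rad_pred) (repr x * repr y).

Definition to_quot_rad (a : R) : quot_rad := \pi_(Quotient.quot rad_pred) a.

Lemma to_quot_rad_surj (x : quot_rad) : exists a, to_quot_rad a = x.
Proof. by exists (repr x); rewrite /to_quot_rad reprK. Qed.

Lemma to_quot_rad_eq a b :
  to_quot_rad a = to_quot_rad b <-> jacobson_radical (a - b).
Proof.
split=> [e|h].
  apply/asboolP; rewrite -[`[< _ >]]/(a - b \in rad_pred) Quotient.idealrBE.
  exact/eqP.
by apply/eqP; rewrite -[_ == _]Quotient.idealrBE; apply/asboolP.
Qed.

Lemma bar_mulE a b : to_quot_rad (a * b) = bar_mul (to_quot_rad a) (to_quot_rad b).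
Proof.
apply/to_quot_rad_eq.
set a' := repr (to_quot_rad a); set b' := repr (to_quot_rad b).
have ra : a - a' \in rad_pred.
  by apply/asboolP/to_quot_rad_eq; rewrite [RHS]reprK.
have rb : b - b' \in rad_pred.
  by apply/asboolP/to_quot_rad_eq; rewrite [RHS]reprK.
have -> : a * b - a' * b' = (a - a') * b + a' * (b - b').
  by rewrite mulrBl mulrBr addrA subrK.
by apply/asboolP; apply: (@rpredD _ rad_pred); [apply: rad_mulr|apply: rad_mull].
Qed.

Lemma to_quot_rad_is_zmod_morphism : zmod_morphism to_quot_rad.
Proof. by move=> a b; rewrite /to_quot_rad; exact: raddfB. Qed.

HB.instance Definition _ := GRing.isZmodMorphism.Build R quot_rad to_quot_rad
  to_quot_rad_is_zmod_morphism.

Fact bar_mulA : associative bar_mul.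
Proof.
move=> x y z; have [a <-] := to_quot_rad_surj x.
have [b <-] := to_quot_rad_surj y; have [c <-] := to_quot_rad_surj z.
by rewrite -!bar_mulE mulrA.
Qed.

Fact bar_mul1r : left_id (to_quot_rad 1) bar_mul.
Proof.
by move=> x; have [a <-] := to_quot_rad_surj x; rewrite -bar_mulE mul1r.
Qed.

Fact bar_mulr1 : right_id (to_quot_rad 1) bar_mul.
Proof.
by move=> x; have [a <-] := to_quot_rad_surj x; rewrite -bar_mulE mulr1.
Qed.

Fact bar_mulrDl : left_distributive bar_mul +%R.
Proof.
move=> x y z; have [a <-] := to_quot_rad_surj x.
have [b <-] := to_quot_rad_surj y; have [c <-] := to_quot_rad_surj z.
by rewrite -raddfD -!bar_mulE mulrDl raddfD.
Qed.

Fact bar_mulrDr : right_distributive bar_mul +%R.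
Proof.
move=> x y z; have [a <-] := to_quot_rad_surj x.
have [b <-] := to_quot_rad_surj y; have [c <-] := to_quot_rad_surj z.
by rewrite -raddfD -!bar_mulE mulrDr raddfD.
Qed.

HB.instance Definition _ := GRing.Zmodule_isPzRing.Build quot_rad
  bar_mulA bar_mul1r bar_mulr1 bar_mulrDl bar_mulrDr.

Lemma to_quot_rad_is_monoid_morphism : monoid_morphism to_quot_rad.
Proof. by split=> // a b; exact: bar_mulE. Qed.

HB.instance Definition _ := GRing.isMonoidMorphism.Build R quot_rad to_quot_rad
  to_quot_rad_is_monoid_morphism.

End Radical.

Definition semilocal (R : pzRingType) : Prop := artinian (quot_rad R).

(* The ring End_K(U), with mappings written on the right: in f * g, the       *)
(* mapping f is applied first.                                                *)
Definition endring (K : nzRingType) (U : vectType K) : Type := 'End(U).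

Section EndRing.
Variables (K : nzRingType) (U : vectType K).

HB.instance Definition _ := GRing.Zmodule.on (endring U).

Definition end_mul (f g : endring U) : endring U := (g \o f)%VF.

Fact end_mulA : associative end_mul.
Proof. by move=> f g h; rewrite /end_mul comp_lfunA. Qed.
Fact end_mul1r : left_id (\1%VF : endring U) end_mul.
Proof. by move=> f; rewrite /end_mul comp_lfun1r. Qed.
Fact end_mulr1 : right_id (\1%VF : endring U) end_mul.
Proof. by move=> f; rewrite /end_mul comp_lfun1l. Qed.
Fact end_mulrDl : left_distributive end_mul +%R.
Proof. by move=> f g h; exact: comp_lfunDr. Qed.
Fact end_mulrDr : right_distributive end_mul +%R.
Proof. by move=> f g h; exact: comp_lfunDl. Qed.

HB.instance Definition _ := GRing.Zmodule_isPzRing.Build (endring U)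
  end_mulA end_mul1r end_mulr1 end_mulrDl end_mulrDr.

End EndRing.

Definition prod_ring (m : nat) (S : 'I_m -> pzRingType) : Type :=
  {dffun forall i : 'I_m, S i}.

Section ProdRing.
Variables (m : nat) (S : 'I_m -> pzRingType).
Local Notation P := (prod_ring S).

HB.instance Definition _ := Choice.on P.

Definition prod_coord (i : 'I_m) (x : P) : S i := x i.

Definition prod_of (f : forall i, S i) : P := finfun f.

Lemma prod_coordE i f : prod_coord i (prod_of f) = f i.
Proof. by rewrite /prod_coord ffunE. Qed.

Lemma prod_ringP (x y : P) : (forall i, prod_coord i x = prod_coord i y) -> x = y.
Proof. by move=> xy; apply/ffunP. Qed.

Definition prod_zero : P := prod_of (fun=> 0).
Definition prod_one : P := prod_of (fun=> 1).
Definition prod_opp (x : P) : P := prod_of (fun i => - prod_coord i x).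
Definition prod_add (x y : P) : P :=
  prod_of (fun i => prod_coord i x + prod_coord i y).
Definition prod_mul (x y : P) : P :=
  prod_of (fun i => prod_coord i x * prod_coord i y).

Fact prod_addA : associative prod_add.
Proof. by move=> x y z; apply: prod_ringP => i; rewrite !prod_coordE addrA. Qed.
Fact prod_addC : commutative prod_add.
Proof. by move=> x y; apply: prod_ringP => i; rewrite !prod_coordE addrC. Qed.
Fact prod_add0 : left_id prod_zero prod_add.
Proof. by move=> x; apply: prod_ringP => i; rewrite !prod_coordE add0r. Qed.
Fact prod_addN : left_inverse prod_zero prod_opp prod_add.
Proof. by move=> x; apply: prod_ringP => i; rewrite !prod_coordE addNr. Qed.

HB.instance Definition _ :=
  GRing.isZmodule.Build P prod_addA prod_addC prod_add0 prod_addN.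

Fact prod_mulA : associative prod_mul.
Proof. by move=> x y z; apply: prod_ringP => i; rewrite !prod_coordE mulrA. Qed.
Fact prod_mul1r : left_id prod_one prod_mul.
Proof. by move=> x; apply: prod_ringP => i; rewrite !prod_coordE mul1r. Qed.
Fact prod_mulr1 : right_id prod_one prod_mul.
Proof. by move=> x; apply: prod_ringP => i; rewrite !prod_coordE mulr1. Qed.
Fact prod_mulrDl : left_distributive prod_mul prod_add.
Proof. by move=> x y z; apply: prod_ringP => i; rewrite !prod_coordE mulrDl. Qed.
Fact prod_mulrDr : right_distributive prod_mul prod_add.
Proof. by move=> x y z; apply: prod_ringP => i; rewrite !prod_coordE mulrDr. Qed.

HB.instance Definition _ := GRing.Zmodule_isPzRing.Build P
  prod_mulA prod_mul1r prod_mulr1 prod_mulrDl prod_mulrDr.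

Variable i : 'I_m.

Lemma prod_coord_is_zmod_morphism : zmod_morphism (prod_coord i).
Proof. by move=> x y; rewrite !prod_coordE. Qed.

Lemma prod_coord_is_monoid_morphism : monoid_morphism (prod_coord i).
Proof. by split=> [|x y]; rewrite prod_coordE. Qed.

HB.instance Definition _ := GRing.isZmodMorphism.Build P (S i) (prod_coord i)
  prod_coord_is_zmod_morphism.
HB.instance Definition _ := GRing.isMonoidMorphism.Build P (S i) (prod_coord i)
  prod_coord_is_monoid_morphism.

End ProdRing.

(* unitmx is only available over commutative rings. *)
Definition invertible2 (R : pzRingType) (g : 'M[R]_2) : Prop :=
  exists h : 'M[R]_2, g *m h = 1%:M /\ h *m g = 1%:M.

Record GL2 (R : pzRingType) :=
  MkGL2 { GL2_val :> 'M[R]_2; GL2_valP : invertible2 GL2_val }.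

Definition row_span (R : pzRingType) (v : 'rV[R]_2) : set 'rV[R]_2 :=
  [set w | exists x : R, w = x *: v].

Definition is_point (R : pzRingType) (p : set 'rV[R]_2) : Prop :=
  exists g : GL2 R, p = row_span (row ord0 g).

Record proj_line (R : pzRingType) :=
  ProjPoint { point_set :> set 'rV[R]_2; point_setP : is_point point_set }.

Section ProjectiveLine.
Variable R : pzRingType.

Lemma proj_line_eqP (p q : proj_line R) : (p : set _) = q -> p = q.
Proof.
by case: p q => [p hp] [q hq] /= e; subst q; congr ProjPoint; exact: Prop_irrelevance.
Qed.

Definition distant (p q : proj_line R) : Prop :=
  exists g : GL2 R,
    (p : set _) = row_span (row ord0 g) /\ (q : set _) = row_span (row ord_max g).

Definition parallel (p q : proj_line R) : Prop :=
  forall r : proj_line R, distant r p -> distant r q.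

(* row2 a b is the row (a, b). *)
Definition row2 (a b : R) : 'rV[R]_2 :=
  \row_j (if j == ord0 then a else b).

Lemma GL2_mul_subproof (g h : GL2 R) : invertible2 (g *m h).
Proof.
case: g h => [g [g' [gg' g'g]]] [h [h' [hh' h'h]]] /=; exists (h' *m g'); split.
  by rewrite mulmxA -(mulmxA g) hh' mulmx1.
by rewrite mulmxA -(mulmxA h') g'g mulmx1.
Qed.

(* The point map p |-> p^(gamma~), sending R(a,b) to R((a,b) gamma). *)
Lemma GL2_map_subproof (g : GL2 R) (p : proj_line R) :
  is_point [set v *m g | v in (p : set 'rV[R]_2)].
Proof.
case: p => p ph /=; case: ph => h ->; exists (MkGL2 (GL2_mul_subproof h g)) => /=.
apply/seteqP; split=> w /=.
  by move=> [v [x ->] <-]; exists x; rewrite row_mul scalemxAl.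
by move=> [x ->]; exists (x *: row ord0 h); [exists x | rewrite row_mul scalemxAl].
Qed.

Definition GL2_map (g : GL2 R) (p : proj_line R) : proj_line R :=
  ProjPoint (GL2_map_subproof g p).

(* mx2 a b c d is the matrix with rows (a, b) and (c, d).                     *)
Definition mx2 (a b c d : R) : 'M[R]_2 :=
  \matrix_(i, j) if i == ord0 then (if j == ord0 then a else b)
                 else (if j == ord0 then c else d).

Lemma mx2M a b c d a' b' c' d' :
  mx2 a b c d *m mx2 a' b' c' d' =
  mx2 (a * a' + b * c') (a * b' + b * d') (c * a' + d * c') (c * b' + d * d').
Proof.
apply/matrixP => i j; rewrite !mxE big_ord_recl big_ord1 !mxE /=.
by case: (i == ord0); case: (j == ord0).
Qed.

Lemma mx2_1 : mx2 1 0 0 1 = 1%:M.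
Proof.
apply/matrixP => i j; rewrite !mxE -!val_eqE /=.
by case: i j => [[|[|?]] ?] [[|[|?]] ?].
Qed.

Lemma jordan_matrix_subproof (a b : R) : invertible2 (mx2 (a * b - 1) a b 1).
Proof.
exists (mx2 (-1) a b (1 - b * a)); rewrite !mx2M -mx2_1.
split; congr mx2.
- by rewrite mulrN1 opprB subrK.
- by rewrite mulrBl mulrBr mul1r mulr1 mulrA addrA subrK subrr.
- by rewrite mulrN1 mul1r addNr.
- by rewrite mul1r addrC subrK.
- by rewrite mulN1r opprB subrK.
- by rewrite mulN1r mulr1 addNr.
- by rewrite mulrBr mulrBl mul1r mulr1 mulrA addrA subrK subrr.
- by rewrite mulr1 addrC subrK.
Qed.

Lemma jordan_point_subproof (a b : R) : is_point (row_span (row2 (a * b - 1) a)).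
Proof.
exists (MkGL2 (jordan_matrix_subproof a b)) => /=; congr row_span.
by apply/rowP => j; rewrite !mxE.
Qed.

(* The point R(a b - 1, a). *)
Definition jordan_point (a b : R) : proj_line R :=
  ProjPoint (jordan_point_subproof a b).

End ProjectiveLine.

Section Isomorphisms.
Variables R S : pzRingType.

Definition distant_iso (f : proj_line R -> proj_line S) : Prop :=
  bijective f /\ forall p q, distant p q <-> distant (f p) (f q).

Definition parallel_iso (f : proj_line R -> proj_line S) : Prop :=
  bijective f /\ forall p q, parallel p q <-> parallel (f p) (f q).

Lemma proj_map_subproof (f : {rmorphism R -> S}) (p : proj_line R) :
  is_point [set w | exists c : S, exists2 v, (p : set 'rV[R]_2) v &
                                              w = c *: map_mx f v].
Proof.
case: p => p pg /=; case: pg => g ->.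
have inv : invertible2 (map_mx f g).
  case: g => g [h [gh hg]] /=; exists (map_mx f h).
  by rewrite -!map_mxM gh hg map_mx1.
exists (MkGL2 inv) => /=; apply/seteqP; split => w /=.
  move=> [c [v [x ->] ->]]; exists (c * f x).
  by rewrite map_mxZ map_row scalerA.
move=> [c ->]; exists c, (row ord0 g); last by rewrite map_row.
by exists 1; rewrite scale1r.
Qed.

(* The point map P(R) -> P(S) induced by a ring homomorphism f: the image of  *)
(* p is the submodule of S^2 generated by f(p), i.e. R(a,b) |-> S(f a, f b).  *)
Definition proj_map (f : {rmorphism R -> S}) (p : proj_line R) : proj_line S :=
  ProjPoint (proj_map_subproof f p).

Lemma proj_mapE (f : {rmorphism R -> S}) (p : proj_line R) (a b : R) :
  (p : set _) = row_span (row2 a b) ->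
  (proj_map f p : set _) = row_span (row2 (f a) (f b)).
Proof.
have fab : map_mx f (row2 a b) = row2 (f a) (f b).
  by apply/rowP => j; rewrite !mxE; case: ifP.
move=> /= ->; apply/seteqP; split => w /=.
  by move=> [c [v [x ->] ->]]; exists (c * f x); rewrite map_mxZ fab scalerA.
move=> [c ->]; exists c, (row2 a b); last by rewrite fab.
by exists 1; rewrite scale1r.
Qed.

Definition ring_iso (f : R -> S) : Prop :=
  [/\ bijective f, zmod_morphism f & monoid_morphism f].

Definition ring_antiiso (f : R -> S) : Prop :=
  [/\ bijective f, zmod_morphism f, f 1 = 1 &
      forall x y, f (x * y) = f y * f x].

Definition jordan_hom (f : R -> S) : Prop :=
  [/\ zmod_morphism f, f 1 = 1 &
      forall a b, f (a * b * a) = f a * f b * f a].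

Definition jordan_iso (f : R -> S) : Prop := jordan_hom f /\ bijective f.

(* F is the point map alpha~ of the Jordan homomorphism alpha. It is uniquely *)
(* determined when all points of P(R) are of the form R(ab - 1, a), as is the *)
(* case for R semisimple.                                                     *)
Definition jordan_induced (alpha : R -> S) (F : proj_line R -> proj_line S) :
    Prop :=
  forall a b, F (jordan_point a b) = jordan_point (alpha a) (alpha b).

End Isomorphisms.

(* The i-th component of a point under P(prod_i S_i) = prod_i P(S_i). *)
Definition component (m : nat) (S : 'I_m -> pzRingType) (i : 'I_m)
    (q : proj_line (prod_ring S)) : proj_line (S i) :=
  proj_map (prod_coord i) q.

(* p |-> \bar p, where R / rad R is identified with B along iota. *)
Definition bar_point (R B : pzRingType) (iota : {rmorphism quot_rad R -> B})
    (p : proj_line R) : proj_line B :=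
  proj_map iota (proj_map (@to_quot_rad R) p).

(* phibar is the bijection \bar p |-> \bar{p^phi}. It is unique because       *)
(* p |-> \bar p is onto.                                                      *)
Definition induced_bijection (R R' B B' : pzRingType)
    (iota : {rmorphism quot_rad R -> B}) (iota' : {rmorphism quot_rad R' -> B'})
    (phi : proj_line R -> proj_line R') (phibar : proj_line B -> proj_line B') :
    Prop :=
  bijective phibar /\
  forall p, phibar (bar_point iota p) = bar_point iota' (phi p).

(* As m = m', the permutation sigma of the indices is given as s : 'S_m, and  *)
(* cast_ord Em (s k) is k^sigma.                                              *)
Definition product_form (m m' : nat)
    (S : 'I_m -> pzRingType) (S' : 'I_m' -> pzRingType)
    (psi : proj_line (prod_ring S) -> proj_line (prod_ring S'))
    (Em : m = m') (s : 'S_m)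
    (psik : forall k : 'I_m,
       proj_line (S k) -> proj_line (S' (cast_ord Em (s k)))) : Prop :=
  (forall k, distant_iso (psik k)) /\
  forall q k, component (cast_ord Em (s k)) (psi q) = psik k (component k q).

(* Main.v *)
(** Decomposition. Over a ring of matrices over a division ring, any two points q, r
    have a common distant point that is not distant to a prescribed third point
    p. Hence, in a finite product of such rings, the sets of coordinates in which
    q and r differ from p are disjoint if and only if some point s satisfies
    Delta(p) & Delta(s) = Delta(q) & Delta(r). A distant isomorphism therefore
    induces, at every p, a bijection of coordinates, which does not depend on p.
    Units lift modulo the radical, so this applies to semilocal rings, where
    parallel points are those with the same image modulo the radical.

    One factor. After normalising by GL2, a distant isomorphism fixes R(1,0),
    R(0,1) and R(1,1), hence is given on the points R(a,1) by a bijection f of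
    matrix rings. Two such points differ by a matrix of rank one if and only if
    they are adjacent, where adjacency is definable from distance, and the
    equation a + d = b + c for an adjacency 4-cycle is definable from adjacency
    and the point R(1,0). So f is additive and preserves rank one. Such an f maps
    each one-sided ideal generated by a rank one matrix into one generated by a
    rank one matrix, either always on the same side or always on the opposite
    one, and as it preserves idempotents of rank one it is an isomorphism or an
    anti-isomorphism. The same holds for the map g given on the points R(1,a);
    f and g agree on units, hence everywhere. *)
Require Import Defs.
From HB Require Import structures.
From mathcomp Require Import all_boot all_order all_fingroup all_algebra.
From mathcomp Require Import boolp classical_sets.

Set Implicit Arguments.
Unset Strict Implicit.
Unset Printing Implicit Defensive.

Import GRing.Theory.
Local Open Scope ring_scope.

(** * Units, invertible 2x2 matrices and points *)

(** The fields may be noncommutative, finite, and of characteristic 2, so determinants, counting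
    arguments and division by 2 are all excluded. Their substitutes are the Schur complement and one
    criterion: for a column x and a row y, 1 - xy is invertible if and only if yx is not 1. Scalars
    are 1x1 matrices, acting on columns from the right and on rows from the left. Adjacency alone
    cannot see addition, which belongs to an affine chart; this is why the point R(1,0) enters the
    definition of [parallelogram]. The points witnessing a parallelogram are not distant from
    R(1,0), hence lie outside the chart; they have the normal form R(xy, 1 - xy1) with y1 x = 1, and
    most computations concern this form. The bound on the dimension cannot be dropped: over a
    division ring two points are distant as soon as they differ, so every bijection of the line is a
    distant isomorphism and carries no algebra. The bound is used in the form that every row and
    every column has an independent companion. *)

Definition invertible (R : pzRingType) (u : R) : Prop :=
  exists v, u * v = 1 /\ v * u = 1.

Section Invertible.
Variable R : pzRingType.
Implicit Types (u v a b c d t : R) (M N : 'M[R]_2).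

Lemma invertible1 : invertible (1 : R).
Proof. by exists 1; rewrite !mulr1. Qed.

Lemma invertibleM u v : invertible u -> invertible v -> invertible (u * v).
Proof.
move=> [u' [uu' u'u]] [v' [vv' v'v]]; exists (v' * u'); split.
  by rewrite mulrA -(mulrA u) vv' mulr1.
by rewrite mulrA -(mulrA v') u'u mulr1.
Qed.

Lemma invertibleN u : invertible (- u) <-> invertible u.
Proof.
have N w : invertible w -> invertible (- w).
  by move=> [v [wv vw]]; exists (- v); rewrite !mulrNN.
by split=> [/N|/N //]; rewrite opprK.
Qed.

Lemma invertible_sides u v w : u * v = 1 -> w * u = 1 -> invertible u.
Proof.
move=> uv wu; exists v; split=> //.
by rewrite -[v]mul1r -wu -(mulrA w) uv mulr1.
Qed.

Lemma invertible2M M N : invertible2 M -> invertible2 N -> invertible2 (M *m N).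
Proof.
move=> [M' [MM' M'M]] [N' [NN' N'N]]; exists (N' *m M'); split.
  by rewrite mulmxA -(mulmxA M) NN' mulmx1.
by rewrite mulmxA -(mulmxA N') M'M mulmx1.
Qed.

Lemma invertible2_mull M N : invertible2 M ->
  (invertible2 (M *m N) <-> invertible2 N).
Proof.
move=> iM; split=> [iMN|]; last exact: invertible2M.
case: (iM) => M' [MM' M'M]; rewrite -[N]mul1mx -M'M -mulmxA.
by apply: invertible2M => //; exists M.
Qed.

Lemma invertible2_mulr M N : invertible2 N ->
  (invertible2 (M *m N) <-> invertible2 M).
Proof.
move=> iN; split=> [iMN|iM]; last exact: invertible2M.
case: (iN) => N' [NN' N'N]; rewrite -[M]mulmx1 -NN' mulmxA.
by apply: invertible2M => //; exists N.
Qed.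

Lemma mx2_eta M : M = mx2 (M ord0 ord0) (M ord0 ord_max)
                          (M ord_max ord0) (M ord_max ord_max).
Proof.
apply/matrixP => i j; rewrite !mxE.
have Hi (k : 'I_2) : k = if k == ord0 then ord0 else ord_max.
  by apply/val_inj; case: k => [[|[|?]] ?].
by rewrite {1}(Hi i) {1}(Hi j); case: (i == ord0); case: (j == ord0).
Qed.

Lemma mx2_inj a b c d a' b' c' d' : mx2 a b c d = mx2 a' b' c' d' ->
  [/\ a = a', b = b', c = c' & d = d'].
Proof.
move=> /matrixP E; move: (E ord0 ord0) (E ord0 ord_max) (E ord_max ord0)
  (E ord_max ord_max); by rewrite !mxE.
Qed.

Lemma mx2_shearP a b c d t : mx2 a b c d *m mx2 1 0 t 1 = mx2 (a + b * t) b (c + d * t) d.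
Proof. by rewrite mx2M !mulr1 !mulr0 !add0r. Qed.

Lemma invertible2_shear t : invertible2 (mx2 1 0 t 1).
Proof.
exists (mx2 1 0 (- t) 1); rewrite !mx2_shearP -mx2_1.
by rewrite !mul0r !mul1r addr0 subrr addNr.
Qed.

Lemma invertible2_diag u v : invertible2 (mx2 u 0 0 v) <-> invertible u /\ invertible v.
Proof.
split=> [[h]|[[u' [uu' u'u]] [v' [vv' v'v]]]]; last first.
  exists (mx2 u' 0 0 v'); rewrite !mx2M !mulr0 !mul0r !addr0 !add0r uu' u'u vv' v'v.
  by rewrite mx2_1.
rewrite (mx2_eta h) !mx2M -mx2_1 => -[/mx2_inj[+ _ _ +] /mx2_inj[+ _ _ +]].
rewrite !mulr0 !mul0r !addr0 !add0r => e1 e2 e3 e4.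
by split; [exists (h ord0 ord0)|exists (h ord_max ord_max)].
Qed.

Lemma invertible2_swap : invertible2 (mx2 0 1 1 0 : 'M[R]_2).
Proof.
by exists (mx2 0 1 1 0); rewrite !mx2M !mulr0 !mulr1 !addr0 !add0r mx2_1.
Qed.

Lemma mx2_swapr a b c d : mx2 a b c d *m mx2 0 1 1 0 = mx2 b a d c.
Proof. by rewrite mx2M !mulr0 !mulr1 !addr0 !add0r. Qed.

Lemma mx2_swapl a b c d : mx2 0 1 1 0 *m mx2 a b c d = mx2 c d a b.
Proof. by rewrite mx2M !mul0r !mul1r !addr0 !add0r. Qed.

Lemma invertible2_swapr a b c d : invertible2 (mx2 a b c d) <-> invertible2 (mx2 b a d c).
Proof. rewrite -(mx2_swapr a); symmetry; apply: invertible2_mulr invertible2_swap. Qed.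

Lemma invertible2_swapl a b c d : invertible2 (mx2 a b c d) <-> invertible2 (mx2 c d a b).
Proof. rewrite -(mx2_swapl a); symmetry; apply: invertible2_mull invertible2_swap. Qed.

(** Eliminating with the corner 1 leaves its Schur complement a - bt, in this order of the
    factors. *)
Lemma invertible2_c1 a b t : invertible2 (mx2 a b t 1) <-> invertible (a - b * t).
Proof.
have <- : mx2 (a - b * t) b 0 1 *m mx2 1 0 t 1 = mx2 a b t 1.
  by rewrite mx2_shearP subrK mul1r add0r.
rewrite (invertible2_mulr _ (invertible2_shear t)).
have <- : mx2 1 b 0 1 *m mx2 (a - b * t) 0 0 1 = mx2 (a - b * t) b 0 1.
  by rewrite mx2M !mulr0 !mul0r !mulr1 !mul1r !addr0 !add0r.
rewrite invertible2_mull.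
  rewrite invertible2_diag; split=> [[]//|]; split=> //; exact: invertible1.
by rewrite invertible2_swapr invertible2_swapl; apply: invertible2_shear.
Qed.

Lemma invertible2_c2 a b t : invertible2 (mx2 a b 1 t) <-> invertible (a * t - b).
Proof.
by rewrite invertible2_swapr invertible2_c1 -invertibleN opprB.
Qed.

End Invertible.

(** Completability to an invertible matrix, which in general is stronger than having a right inverse
    column. *)
Definition unimodular (R : pzRingType) (a b : R) : Prop :=
  exists c d, invertible2 (mx2 a b c d).

(** If uv = 1 does not imply vu = 1 in R, a point also has generators that are not first rows of
    invertible matrices. Excluding them makes any two representatives differ by a unit factor
    ([rep_scale]). *)
Definition rep (R : pzRingType) (p : proj_line R) (a b : R) : Prop :=
  unimodular a b /\ (p : set 'rV[R]_2) = row_span (row2 a b).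

Section Points.
Variable R : pzRingType.
Implicit Types (a b c d u t : R) (p q r : proj_line R).

Lemma row0_mx2 a b c d : row ord0 (mx2 a b c d) = row2 a b.
Proof. by apply/rowP => j; rewrite !mxE. Qed.

Lemma row1_mx2 a b c d : row ord_max (mx2 a b c d) = row2 c d.
Proof. by apply/rowP => j; rewrite !mxE. Qed.

Lemma row2_inj a b c d : row2 a b = row2 c d -> a = c /\ b = d.
Proof. by move=> /rowP E; move: (E ord0) (E ord_max); rewrite !mxE. Qed.

Lemma scale_row2 u a b : u *: row2 a b = row2 (u * a) (u * b).
Proof. by apply/rowP => j; rewrite !mxE; case: ifP. Qed.

Lemma rep_exists p : exists a b, rep p a b.
Proof.
case: p => p [g pE]; case: (mx2_eta g) => gE.
exists (g ord0 ord0), (g ord0 ord_max); split=> /=.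
  by exists (g ord_max ord0), (g ord_max ord_max); rewrite -gE; case: (g).
by rewrite pE {1}gE row0_mx2.
Qed.

Lemma point_exists a b : unimodular a b -> exists p, rep p a b.
Proof.
move=> ab; case: (ab) => c [d i].
have h : is_point (row_span (row2 a b)).
  by exists (MkGL2 i); rewrite row0_mx2.
by exists (ProjPoint h).
Qed.

Lemma rep_inj p q a b : rep p a b -> rep q a b -> p = q.
Proof. by move=> [_ pE] [_ qE]; apply: proj_line_eqP; rewrite pE qE. Qed.

Lemma unimodular_inj a b u v : unimodular a b ->
  u * a = v * a -> u * b = v * b -> u = v.
Proof.
move=> [c [d [h [+ _]]]]; rewrite (mx2_eta h) mx2M -mx2_1 => /mx2_inj[e _ _ _].
move=> ua ub; rewrite -[u]mulr1 -[v]mulr1 -e !mulrDr !mulrA.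
by rewrite ua ub.
Qed.

Lemma rep_scale p a b c d : rep p a b -> rep p c d ->
  exists2 u, invertible u & c = u * a /\ d = u * b.
Proof.
move=> [uab pE] [ucd]; rewrite pE => E.
have mem (x y : R) : row_span (row2 x y) (row2 x y).
  by exists 1; rewrite scale1r.
have [u eu] : row_span (row2 a b) (row2 c d) by rewrite E.
have [v ev] : row_span (row2 c d) (row2 a b) by rewrite -E.
move: eu ev; rewrite !scale_row2 => /row2_inj[ec ed] /row2_inj[ea eb].
exists u => //; exists v; split.
  by apply: (unimodular_inj ucd); rewrite -mulrA mul1r -?ea -?eb.
by apply: (unimodular_inj uab); rewrite -mulrA mul1r -?ec -?ed.
Qed.

Lemma mx2_scale u v a b c d :
  mx2 (u * a) (u * b) (v * c) (v * d) = mx2 u 0 0 v *m mx2 a b c d.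
Proof. by rewrite mx2M !mul0r !addr0 !add0r. Qed.

Lemma rep_unit p a b u : rep p a b -> invertible u -> rep p (u * a) (u * b).
Proof.
move=> [[c [d i]] pE] iu; split.
  exists c, d; rewrite -[c]mul1r -[d]mul1r mx2_scale; apply: invertible2M i.
  by apply/invertible2_diag; split=> //; apply: invertible1.
rewrite pE; case: iu => v [uv vu]; apply/seteqP; split=> w [x ->].
  by exists (x * v); rewrite !scale_row2 !mulrA -(mulrA x v) vu mulr1.
by exists (x * u); rewrite !scale_row2 !mulrA.
Qed.

(** Any other pair of representatives differs from the given one by an invertible diagonal factor on
    the left, so distance can be tested on one pair. *)
Lemma distantE p q a b c d : rep p a b -> rep q c d ->
  (distant p q <-> invertible2 (mx2 a b c d)).
Proof.
move=> pab qcd; split=> [[g [pE qE]]|i]; last first.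
  case: pab qcd => _ pE [_ qE].
  by exists (MkGL2 i); rewrite row0_mx2 row1_mx2.
have iG := GL2_valP g; rewrite (mx2_eta g) in iG.
have rp : rep p (g ord0 ord0) (g ord0 ord_max).
  split; first by exists (g ord_max ord0), (g ord_max ord_max).
  by rewrite pE {1}(mx2_eta g) row0_mx2.
have rq : rep q (g ord_max ord0) (g ord_max ord_max).
  split; last by rewrite qE {1}(mx2_eta g) row1_mx2.
  exists (g ord0 ord0), (g ord0 ord_max).
  by rewrite invertible2_swapl.
have [u iu [-> ->]] := rep_scale rp pab; have [v iv [-> ->]] := rep_scale rq qcd.
rewrite mx2_scale; apply: invertible2M => //.
exact/invertible2_diag.
Qed.

Lemma distant_sym p q : distant p q -> distant q p.
Proof.
have [a [b pab]] := rep_exists p; have [c [d qcd]] := rep_exists q.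
by move=> /(distantE pab qcd); rewrite invertible2_swapl => /(distantE qcd pab).
Qed.

Lemma distant_rep p q : distant p q -> exists a b c d,
  [/\ rep p a b, rep q c d & invertible2 (mx2 a b c d)].
Proof.
have [a [b pab]] := rep_exists p; have [c [d qcd]] := rep_exists q.
by move=> /(distantE pab qcd) i; exists a, b, c, d.
Qed.

Lemma rep_GL2_map (g : GL2 R) p a b x y z w : (g : 'M[R]_2) = mx2 x y z w ->
  rep p a b -> rep (GL2_map g p) (a * x + b * z) (a * y + b * w).
Proof.
move=> gE [[c [d i]] pE].
have E : row2 a b *m g = row2 (a * x + b * z) (a * y + b * w).
  rewrite -(row0_mx2 a b 0 0) -row_mul gE mx2M.
  by rewrite row0_mx2.
split.
  exists (c * x + d * z), (c * y + d * w); rewrite -mx2M -gE.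
  exact: invertible2M i (GL2_valP g).
rewrite /= pE; apply/seteqP; split=> v /=.
  by move=> [w' [t ->] <-]; exists t; rewrite -E scalemxAl.
by move=> [t ->]; exists (t *: row2 a b); [exists t|rewrite -E scalemxAl].
Qed.

Lemma GL2_map_cancel (g h : GL2 R) : (g : 'M[R]_2) *m h = 1%:M ->
  cancel (GL2_map g) (GL2_map h).
Proof.
move=> gh p; apply: proj_line_eqP => /=; apply/seteqP; split=> v /=.
  by move=> [w [w' pw <-] <-]; rewrite -mulmxA gh mulmx1.
by move=> pv; exists (v *m g); [exists v|rewrite -mulmxA gh mulmx1].
Qed.

Lemma GL2_inv (g : GL2 R) : exists h : GL2 R,
  (g : 'M[R]_2) *m h = 1%:M /\ (h : 'M[R]_2) *m g = 1%:M.
Proof.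
case: g => g [h [gh hg]] /=.
have ih : invertible2 h by exists g.
by exists (MkGL2 ih).
Qed.

Lemma GL2_map_bij (g : GL2 R) : bijective (GL2_map g).
Proof.
by have [h [gh hg]] := GL2_inv g; exists (GL2_map h); apply: GL2_map_cancel.
Qed.

Lemma distant_GL2 (g : GL2 R) p q : distant (GL2_map g p) (GL2_map g q) <-> distant p q.
Proof.
have [a [b pab]] := rep_exists p; have [c [d qcd]] := rep_exists q.
rewrite (distantE (rep_GL2_map (mx2_eta g) pab) (rep_GL2_map (mx2_eta g) qcd)).
rewrite (distantE pab qcd) -mx2M -mx2_eta invertible2_mulr //.
by case: (g).
Qed.

Lemma GL2_map_distant_iso (g : GL2 R) : distant_iso (GL2_map g).
Proof.
by split=> [|p q]; [exact: GL2_map_bij|symmetry; exact: distant_GL2].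
Qed.

Lemma unimodular_inf b : unimodular (1 : R) b.
Proof.
exists 0, 1; rewrite invertible2_c1 mulr0 subr0; exact: invertible1.
Qed.

Lemma unimodular_aff a : unimodular a (1 : R).
Proof.
exists 1, 0; by apply/invertible2_swapl; rewrite invertible2_c1 mul0r subr0; exact: invertible1.
Qed.

(** The two affine charts: [aff a] is R(a,1) and runs through the points distant from R(1,0);
    [coaff b] is R(1,b) and runs through those distant from R(0,1). *)
Definition aff a : proj_line R := projT1 (cid (point_exists (unimodular_aff a))).
Definition coaff b : proj_line R := projT1 (cid (point_exists (unimodular_inf b))).
Definition inf : proj_line R := coaff 0.

Lemma rep_aff a : rep (aff a) a 1. Proof. by rewrite /aff; case: cid. Qed.
Lemma rep_coaff b : rep (coaff b) 1 b. Proof. by rewrite /coaff; case: cid. Qed.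
Lemma rep_inf : rep inf 1 0. Proof. exact: rep_coaff. Qed.

Lemma rep_affE p a b : rep p a b -> invertible b -> exists2 c, p = aff c & a = b * c.
Proof.
move=> rp ib; case: (ib) => b' [bb' b'b]; exists (b' * a); last by rewrite mulrA bb' mul1r.
apply: (rep_inj (a := b' * a) (b := 1)); last exact: rep_aff.
by rewrite -b'b; apply: rep_unit => //; exists b.
Qed.

Lemma aff_inj : injective aff.
Proof.
move=> a b E; have ra := rep_aff a; rewrite E in ra.
have [u _ [->]] := rep_scale (rep_aff b) ra.
by rewrite mulr1 => <-; rewrite mul1r.
Qed.

Lemma coaff_inj : injective coaff.
Proof.
move=> a b E; have ra := rep_coaff a; rewrite E in ra.
have [u _ []] := rep_scale (rep_coaff b) ra.
by rewrite mulr1 => <- ->; rewrite mul1r.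
Qed.

Lemma distant_aff p a b t : rep p a b -> (distant p (aff t) <-> invertible (a - b * t)).
Proof. by move=> rp; rewrite (distantE rp (rep_aff t)) invertible2_c1. Qed.

Lemma distant_coaff p a b t : rep p a b -> (distant p (coaff t) <-> invertible (a * t - b)).
Proof. by move=> rp; rewrite (distantE rp (rep_coaff t)) invertible2_c2. Qed.

Lemma distant_inf p a b : rep p a b -> (distant p inf <-> invertible b).
Proof. by move=> rp; rewrite (distant_coaff _ rp) mulr0 sub0r invertibleN. Qed.

Lemma distant_infP p : distant p inf <-> exists a, p = aff a.
Proof.
have [a [b pab]] := rep_exists p; rewrite (distant_inf pab); split.
  by move=> ib; have [c -> _] := rep_affE pab ib; exists c.
move=> [c pc]; rewrite pc in pab.
have [u iu [_ ->]] := rep_scale (rep_aff c) pab.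
by rewrite mulr1.
Qed.

Lemma distant_zeroP p : distant p (aff 0) <-> exists b, p = coaff b.
Proof.
have [a [b pab]] := rep_exists p; rewrite (distant_aff _ pab) mulr0 subr0; split.
  move=> ia; case: (ia) => a' [aa' a'a]; exists (a' * b).
  apply: (rep_inj (a := 1) (b := a' * b)); last exact: rep_coaff.
  by rewrite -a'a; apply: rep_unit => //; exists a.
move=> [c pc]; rewrite pc in pab.
have [u iu [-> _]] := rep_scale (rep_coaff c) pab.
by rewrite mulr1.
Qed.

Lemma jordan_rep a b : rep (jordan_point a b) (a * b - 1) a.
Proof.
by split=> //; exists b, 1; exact: jordan_matrix_subproof.
Qed.

End Points.

Lemma rep_proj_map (R S : pzRingType) (f : {rmorphism R -> S}) p a b :
  rep p a b -> rep (proj_map f p) (f a) (f b).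
Proof.
move=> [[c [d [h [e1 e2]]]] pE]; split; last exact: proj_mapE.
exists (f c), (f d); have mapE (x y z w : R) : mx2 (f x) (f y) (f z) (f w) = map_mx f (mx2 x y z w).
  by apply/matrixP => i j; rewrite !mxE; case: ifP; case: ifP.
by exists (map_mx f h); rewrite mapE -!map_mxM e1 e2 map_mx1.
Qed.

(** * Local homomorphisms, the Jacobson radical and products *)

Section LocalMorphism.
Variables (R S : pzRingType) (f : {rmorphism R -> S}).
Hypothesis f_surj : forall y, exists x, f x = y.
Hypothesis f_local : forall x, invertible (f x) -> invertible x.

Lemma invertible_rmorph x : invertible x -> invertible (f x).
Proof. by move=> [y [xy yx]]; exists (f y); rewrite -!rmorphM xy yx rmorph1. Qed.

Lemma map_mx2 a b c d : map_mx f (mx2 a b c d) = mx2 (f a) (f b) (f c) (f d).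
Proof. by apply/matrixP => i j; rewrite !mxE; case: ifP; case: ifP. Qed.

(** A matrix over the identity has a unit in its lower right corner, and the Schur complement is a
    unit too ([loc1]). For a lift N of the inverse of the image of M, both MN and NM lie over the
    identity, which gives M a right and a left inverse. *)
Lemma invertible2_local (M : 'M[R]_2) : invertible2 (map_mx f M) <-> invertible2 M.
Proof.
split=> [[h [h1 h2]]|[h [h1 h2]]]; last first.
  by exists (map_mx f h); rewrite -!map_mxM h1 h2 map_mx1.
have loc1 (N : 'M[R]_2) : map_mx f N = 1%:M -> invertible2 N.
  rewrite (mx2_eta N) map_mx2 -mx2_1.
  move: (N ord0 ord0) (N ord0 ord_max) (N ord_max ord0) (N ord_max ord_max) => p q r s /mx2_inj[fp fq fr fs].
  have [s' [ss' s's]] : invertible s.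
    by apply: f_local; rewrite fs; apply: invertible1.
  have <- : mx2 1 0 0 s *m mx2 p q (s' * r) 1 = mx2 p q r s.
    by rewrite mx2M !mul1r !mul0r !addr0 !add0r mulr1 mulrA ss' mul1r.
  apply: invertible2M.
    by apply/invertible2_diag; split; [exact: invertible1|exists s'].
  apply/invertible2_c1/f_local.
  by rewrite rmorphB !rmorphM fp fr !mulr0 subr0; apply: invertible1.
have [N NE] : exists N, map_mx f N = h.
  have [a ha] := f_surj (h ord0 ord0); have [b hb] := f_surj (h ord0 ord_max).
  have [c hc] := f_surj (h ord_max ord0); have [d hd] := f_surj (h ord_max ord_max).
  by exists (mx2 a b c d); rewrite map_mx2 ha hb hc hd -mx2_eta.
have [P [P1 P2]] : invertible2 (M *m N) by apply: loc1; rewrite map_mxM NE.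
have [Q [Q1 Q2]] : invertible2 (N *m M) by apply: loc1; rewrite map_mxM NE.
exists (N *m P); split; first by rewrite mulmxA.
have QN : Q *m N = N *m P.
  by rewrite -[LHS]mulmx1 -P1 !mulmxA -(mulmxA Q) Q2 mul1mx.
by rewrite -QN -mulmxA.
Qed.

Lemma unimodular_local a b : unimodular (f a) (f b) -> unimodular a b.
Proof.
move=> [c' [d' i]]; have [c hc] := f_surj c'; have [d hd] := f_surj d'.
by exists c, d; apply/invertible2_local; rewrite map_mx2 hc hd.
Qed.

Lemma distant_proj_map p q : distant (proj_map f p) (proj_map f q) <-> distant p q.
Proof.
have [a [b pab]] := rep_exists p; have [c [d qcd]] := rep_exists q.
rewrite (distantE (rep_proj_map f pab) (rep_proj_map f qcd)) (distantE pab qcd).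
by rewrite -invertible2_local map_mx2.
Qed.

Lemma proj_map_surj q : exists p, proj_map f p = q.
Proof.
have [a' [b' qab]] := rep_exists q.
have [a ha] := f_surj a'; have [b hb] := f_surj b'.
have [p rp] : exists p, rep p a b.
  by apply/point_exists/unimodular_local; rewrite ha hb; case: qab.
exists p; apply: (rep_inj (a := a') (b := b')) => //.
by rewrite -ha -hb; apply: rep_proj_map.
Qed.

Lemma proj_map_inj : injective f -> injective (proj_map f).
Proof.
move=> finj p q E.
have [a [b pab]] := rep_exists p; have [c [d qcd]] := rep_exists q.
have := rep_proj_map f pab; rewrite E => qab.
have [u iu []] := rep_scale qab (rep_proj_map f qcd).
have [x hx] := f_surj u; rewrite -hx -!rmorphM => /finj ec /finj ed.
apply: (rep_inj (a := c) (b := d)) => //; rewrite ec ed; apply: rep_unit => //.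
by apply: f_local; rewrite hx.
Qed.

Lemma proj_map_distant_iso : injective f -> distant_iso (proj_map f).
Proof.
move=> finj; split=> [|p q]; last by symmetry; apply: distant_proj_map.
have [g gE] := choice proj_map_surj.
by exists g => [p|//]; apply: (proj_map_inj finj); rewrite gE.
Qed.

End LocalMorphism.

Lemma bij_surj (T T' : Type) (f : T -> T') : bijective f -> forall y, exists x, f x = y.
Proof. by move=> [g fg gf] y; exists (g y). Qed.

Lemma bij_of_inj_surj (T T' : Type) (f : T -> T') :
  injective f -> (forall y, exists x, f x = y) -> bijective f.
Proof. by move=> fi /choice[g gE]; exists g => [x|//]; apply: fi; rewrite gE. Qed.

Lemma bij_local (R S : pzRingType) (f : {rmorphism R -> S}) : bijective f ->
  forall x, invertible (f x) -> invertible x.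
Proof.
move=> fb x [y' [e1 e2]]; have [y hy] := bij_surj fb y'.
by exists y; split; apply: (bij_inj fb); rewrite rmorphM rmorph1 hy.
Qed.

Lemma distant_iso_inv (R S : pzRingType) (f : proj_line R -> proj_line S) g :
  cancel f g -> cancel g f -> distant_iso f -> distant_iso g.
Proof.
move=> fg gf [fb fd]; split=> [|p q]; first by exists f.
by rewrite fd !gf.
Qed.

Lemma distant_iso_comp (R S T : pzRingType) (f : proj_line R -> proj_line S)
    (g : proj_line S -> proj_line T) :
  distant_iso f -> distant_iso g -> distant_iso (g \o f).
Proof.
move=> [fb fd] [gb gd]; split=> [|p q]; first exact: bij_comp.
by rewrite fd gd.
Qed.

Section Jacobson.
Variable R : pzRingType.

Lemma left_ideal_maximal (I : set R) : left_ideal I -> ~ I 1 ->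
  exists2 M, maximal_left_ideal M & (I `<=` M)%classic.
Proof.
move=> lI nI1.
pose P (A : set R) := A = set0 \/ [/\ left_ideal A, (I `<=` A)%classic & ~ A 1].
have [|A [PA maxA]] := @Zorn_bigcup R P.
  move=> F FP Ftot.
  have [[A0 [FA0 A0n]]|none] := pselect (exists A, F A /\ A <> set0); last first.
    left; apply/seteqP; split=> // x [A FA Ax].
    have [E|E] := pselect (A = set0); first by rewrite E in Ax.
    by case: none; exists A.
  have good A : F A -> A <> set0 -> [/\ left_ideal A, (I `<=` A)%classic & ~ A 1].
    by move=> /FP[].
  have ne (A : set R) x : A x -> A <> set0 by move=> Ax E; rewrite E in Ax.
  right; split.
  - split.
    + by exists A0 => //; have [[]] := good _ FA0 A0n.
    + move=> x y [A FA Ax] [B FB By].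
      have [[_ AD _] _ _] := good _ FA (ne _ _ Ax).
      have [[_ BD _] _ _] := good _ FB (ne _ _ By).
      have [AB|BA] := Ftot _ _ FA FB.
        by exists B => //; apply: BD => //; apply: AB.
      by exists A => //; apply: AD => //; apply: BA.
    + move=> a x [A FA Ax]; have [[_ _ AM] _ _] := good _ FA (ne _ _ Ax).
      by exists A => //; apply: AM.
  - by move=> x Ix; exists A0 => //; have [_ IA _] := good _ FA0 A0n; apply: IA.
  - by move=> [A FA A1]; have [_ _ nA1] := good _ FA (ne _ _ A1).
have IP : P I by right; split.
case: PA => [A0|[lA IA nA1]].
  case: (maxA I) => //; split=> [x|/(_ 0)]; first by rewrite A0.
  by rewrite A0; apply; case: lI.
exists A => //; split=> // [|J lJ AJ]; first by apply/eqP => E; apply: nA1; rewrite E.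
have [J1|nJ1] := pselect (J 1).
  right; apply/seteqP; split=> // x _; case: lJ => _ _ JM.
  by rewrite -[x]mulr1; apply: JM.
left; apply/seteqP; split=> //; apply: contrapT => nJA.
case: (maxA J); first by split.
by right; split=> // x /IA /AJ.
Qed.

Lemma jacobson_left_inv (j : R) : jacobson_radical j -> exists u, u * (1 - j) = 1.
Proof.
move=> Jj; apply: contrapT => no.
pose I : set R := [set x | exists u, x = u * (1 - j)]%classic.
have lI : left_ideal I.
  split; first by exists 0; rewrite mul0r.
    by move=> _ _ [u ->] [v ->]; exists (u + v); rewrite mulrDl.
  by move=> a _ [u ->]; exists (a * u); rewrite mulrA.
have [|M mM IM] := left_ideal_maximal lI; first by move=> [u e]; apply: no; exists u.
case: (mM) => lM /eqP MT _; apply: MT; apply/seteqP; split=> // x _.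
have Mj : M j by apply: Jj.
have M1 : M (1 - j) by apply: IM; exists 1; rewrite mul1r.
case: lM => _ MD MM; rewrite -[x]mulr1; apply: MM.
by rewrite -[1](subrK j); apply: MD.
Qed.

(** The left inverse u of 1 - j equals 1 + uj, and uj is again in the radical; so u has a left
    inverse as well, which must be 1 - j. *)
Lemma jacobson_invertible (j : R) : jacobson_radical j -> invertible (1 - j).
Proof.
move=> Jj; have [u uj] := jacobson_left_inv Jj.
have uE : u = 1 - (- (u * j)).
  by rewrite opprK -[LHS](subrK (u * j)) -{1}[u]mulr1 -mulrBr uj.
have [v] : exists v, v * (1 - (- (u * j))) = 1.
  apply: jacobson_left_inv => M mM; have Mj : M j by apply: Jj.
  case: mM => lM _ _; rewrite -mulNr; case: lM => _ _; exact.
rewrite -uE => vu; exists u; split=> //.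
by have -> : 1 - j = v by rewrite -[LHS]mul1r -{1}vu -mulrA uj mulr1.
Qed.

Lemma to_quot_rad_local (x : R) : invertible (to_quot_rad x) -> invertible x.
Proof.
move=> [y' [e1 e2]]; have [y hy] := to_quot_rad_surj y'.
have key (z : R) : to_quot_rad z = 1 -> invertible z.
  move=> ez; have -> : z = 1 - (1 - z) by rewrite opprB addrC subrK.
  by apply: jacobson_invertible; apply/to_quot_rad_eq; rewrite rmorph1.
have [u [xyu uxy]] : invertible (x * y) by apply: key; rewrite rmorphM /= hy.
have [v [yxv vyx]] : invertible (y * x) by apply: key; rewrite rmorphM /= hy.
by apply: (invertible_sides (v := y * u) (w := v * y)); [rewrite mulrA|rewrite -mulrA].
Qed.

End Jacobson.

(** * Coordinatewise description of the line over a product *)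

Section Products.
Variables (m : nat) (S : 'I_m -> pzRingType).
Local Notation P := (prod_ring S).

Lemma prod_choice (Q : forall i, S i -> Prop) : (forall i, exists x, Q i x) ->
  exists x : P, forall i, Q i (prod_coord i x).
Proof.
move=> H; exists (prod_of (fun i => projT1 (cid (H i)))) => i.
by rewrite prod_coordE; exact: projT2 (cid (H i)).
Qed.

Lemma invertible_prod_ring (x : P) :
  invertible x <-> forall i, invertible (prod_coord i x).
Proof.
split=> [ix i|ix]; first exact: invertible_rmorph.
have [y hy] := prod_choice ix; exists y.
by split; apply: prod_ringP => i; rewrite rmorphM rmorph1; case: (hy i).
Qed.

Lemma mx2_prodP (M N : 'M[P]_2) :
  (forall i, map_mx (prod_coord i) M = map_mx (prod_coord i) N) -> M = N.
Proof.
move=> E; apply/matrixP => k l; apply: prod_ringP => i.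
by have /matrixP/(_ k l) := E i; rewrite !mxE.
Qed.

Lemma mx2_prod_choice (Q : forall i, 'M[S i]_2 -> Prop) : (forall i, exists M, Q i M) ->
  exists M : 'M[P]_2, forall i, Q i (map_mx (prod_coord i) M).
Proof.
move=> H; pose F i := projT1 (cid (H i)).
exists (\matrix_(k, l) prod_of (fun i => F i k l)) => i.
have -> : map_mx (prod_coord i) (\matrix_(k, l) prod_of (fun i => F i k l)) = F i.
  by apply/matrixP => k l; rewrite !mxE prod_coordE.
exact: projT2 (cid (H i)).
Qed.

Lemma invertible2_prod (M : 'M[P]_2) :
  invertible2 M <-> forall i, invertible2 (map_mx (prod_coord i) M).
Proof.
split=> [[N [e1 e2]] i|].
  by exists (map_mx (prod_coord i) N); rewrite -!map_mxM e1 e2 map_mx1.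
move=> /mx2_prod_choice[N hN]; exists N.
by split; apply: mx2_prodP => i; rewrite map_mxM map_mx1; case: (hN i).
Qed.

Lemma distant_prod (p q : proj_line P) :
  distant p q <-> forall i, distant (component i p) (component i q).
Proof.
have [a [b pab]] := rep_exists p; have [c [d qcd]] := rep_exists q.
rewrite (distantE pab qcd) invertible2_prod; split=> H i; have := H i;
  by rewrite map_mx2 (distantE (rep_proj_map _ pab) (rep_proj_map _ qcd)).
Qed.

Lemma component_inj (p q : proj_line P) :
  (forall i, component i p = component i q) -> p = q.
Proof.
have [a [b pab]] := rep_exists p; have [c [d qcd]] := rep_exists q.
move=> E.
have [i|u hu] := @prod_choice (fun i u => invertible u /\
   (prod_coord i c = u * prod_coord i a /\ prod_coord i d = u * prod_coord i b)).
  have := rep_proj_map (prod_coord i) pab; rewrite -/(component i p) E => h.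
  by have [u iu e] := rep_scale h (rep_proj_map (prod_coord i) qcd); exists u.
apply: (rep_inj (a := c) (b := d)) => //.
have -> : c = u * a by apply: prod_ringP => i; rewrite rmorphM; case: (hu i) => _ [].
have -> : d = u * b by apply: prod_ringP => i; rewrite rmorphM; case: (hu i) => _ [].
by apply: rep_unit => //; apply/invertible_prod_ring => i; case: (hu i).
Qed.

(** The choice is made among invertible matrices, because these assemble into one invertible matrix
    over the product, whose first row spans the desired point. *)
Lemma component_choice (Q : forall i, proj_line (S i) -> Prop) :
  (forall i, exists p, Q i p) -> exists p : proj_line P, forall i, Q i (component i p).
Proof.
move=> H.
have [i|M hM] := @mx2_prod_choice (fun i M => invertible2 M /\
    forall p, rep p (M ord0 ord0) (M ord0 ord_max) -> Q i p).
  have [p Qp] := H i; have [a [b rp]] := rep_exists p; case: (rp) => -[c [d iM]] _.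
  exists (mx2 a b c d); split=> // q; rewrite !mxE /= => rq.
  by rewrite -(rep_inj rp rq).
have iM : invertible2 M by apply/invertible2_prod => i; case: (hM i).
have [p rp] : exists p, rep p (M ord0 ord0) (M ord0 ord_max).
  apply: point_exists; exists (M ord_max ord0), (M ord_max ord_max).
  by rewrite -mx2_eta.
exists p => i; have [_] := hM i; apply.
by rewrite !mxE; apply: rep_proj_map.
Qed.

End Products.

Lemma proj_map_GL2 (R S : pzRingType) (f : {rmorphism R -> S}) (g : GL2 R) (h : GL2 S) p :
  map_mx f g = h -> proj_map f (GL2_map g p) = GL2_map h (proj_map f p).
Proof.
have [a [b pab]] := rep_exists p => E.
have hE : (h : 'M[S]_2) = mx2 (f (g ord0 ord0)) (f (g ord0 ord_max))
                         (f (g ord_max ord0)) (f (g ord_max ord_max)).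
  by rewrite -E {1}(mx2_eta g) map_mx2.
have := rep_proj_map f (rep_GL2_map (mx2_eta g) pab).
by rewrite !rmorphD !rmorphM => /rep_inj; apply; apply: rep_GL2_map hE (rep_proj_map f pab).
Qed.

Lemma proj_map_jordan (R S : pzRingType) (f : {rmorphism R -> S}) a b :
  proj_map f (jordan_point a b) = jordan_point (f a) (f b).
Proof.
apply: (rep_inj (rep_proj_map f (jordan_rep a b))).
by rewrite rmorphB rmorphM rmorph1; apply: jordan_rep.
Qed.

(** * Distant isomorphisms of products *)

Definition separating (R : pzRingType) : Prop := forall p q r : proj_line R,
  p <> q -> p <> r -> exists s, [/\ distant s q, distant s r & ~ distant s p].

(** R(0,1), R(1,1) and R(1,0) are three different points, so one of them avoids both q and r. *)
Lemma third_point (R : pzRingType) : (1 : R) <> 0 ->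
  forall q r : proj_line R, exists p, p <> q /\ p <> r.
Proof.
move=> n10 q r.
have n1 : aff (0 : R) <> aff 1 by move=> /aff_inj/esym.
have n0i a : aff (a : R) <> inf R.
  move=> E; have := rep_aff a; rewrite E => h.
  have [u _ [_ e]] := rep_scale (rep_inf R) h.
  by apply: n10; rewrite e mulr0.
have [E0|N0] := pselect (aff 0 = q); last first.
  have [E0'|N0'] := pselect (aff 0 = r); last by exists (aff 0).
  have [E1|N1] := pselect (aff 1 = q); last first.
    by exists (aff 1); split=> // E; apply: n1; rewrite E.
  by exists (inf R); rewrite -E0' -E1; split=> /esym; apply: n0i.
have [E1|N1] := pselect (aff 1 = r); last first.
  by exists (aff 1); split=> // E; apply: n1; rewrite E.
by exists (inf R); rewrite -E0 -E1; split=> /esym; apply: n0i.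
Qed.

Section ProductPoints.
Variables (m : nat) (S : 'I_m -> pzRingType).
Hypothesis nontrivial : forall i, (1 : S i) <> 0.
Hypothesis sepS : forall i, separating (S i).
Local Notation X := (proj_line (prod_ring S)).
Local Notation c := component.
Implicit Types (p q r s t : X).

Lemma common_distant i (x y : proj_line (S i)) : exists z, distant z x /\ distant z y.
Proof.
have [z [zx zy]] := third_point (@nontrivial i) x y.
by have [s []] := sepS zx zy; exists s.
Qed.

Lemma component_surj i (x : proj_line (S i)) : exists p : X, c i p = x.
Proof.
(* The condition is vacuous at every index other than i; the transport along e makes it meaningful
   at i. *)
have [k|p hp] := @component_choice _ S
    (fun k y => forall e : k = i, ecast k (proj_line (S k)) e y = x).
  have [e|ne] := pselect (k = i); last by exists (inf (S k)).
  by subst k; exists x => e; rewrite eq_axiomK.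
by exists p; apply: (hp i (erefl i)).
Qed.

Lemma component_mix (A : 'I_m -> bool) p q : exists r : X,
  forall k, c k r = if A k then c k q else c k p.
Proof.
apply: (@component_choice _ S (fun k y => y = if A k then c k q else c k p)).
by move=> k; exists (if A k then c k q else c k p).
Qed.

Definition differ_only (p q : X) (i : 'I_m) : Prop :=
  forall k, c k q = c k p <-> k <> i.

Lemma differ_only_sym p q i : differ_only p q i -> differ_only q p i.
Proof. by move=> H k; split=> [/esym/H|/H/esym]. Qed.

Lemma differ_only_exists p i : exists q, differ_only p q i.
Proof.
have [x [xp _]] := third_point (@nontrivial i) (c i p) (c i p).
have [z zE] := component_surj x.
have [q qE] := component_mix (pred1 i) p z.
exists q => k; rewrite qE /=; case: eqP => [->|//]; rewrite zE.
by split.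
Qed.

Lemma not_differ_only_same p i : ~ differ_only p p i.
Proof. by move=> H; have [] := H i => /(_ erefl). Qed.

Definition disjoint_differences (p q r : X) : Prop :=
  forall i, c i q = c i p \/ c i r = c i p.

(* Distance is componentwise, so the s obtained by merging q and r has
   Delta(p) & Delta(s) = Delta(q) & Delta(r); this expresses disjointness in terms
   of distance alone. *)
Lemma disjoint_differencesP p q r : disjoint_differences p q r <->
  exists s, forall t, distant t p /\ distant t s <-> distant t q /\ distant t r.
Proof.
split=> [H|[s hs] i]; last first.
  apply: contrapT => /not_orP[nq nr].
  (* If q and r both differed from p at i, separation at i would yield a point t distant from q and
     r but not from p. *)
  have [k|t ht] := @component_choice _ S (fun k y => [/\ distant y (c k q),
      distant y (c k r) & k = i -> ~ distant y (c k p)]).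
    have [e|ne] := pselect (k = i).
      subst k; have [s' [sq sr sp]] := sepS (nesym nq) (nesym nr).
      by exists s'.
    by have [s' []] := common_distant (c k q) (c k r); exists s'.
  have /hs[tp _] : distant t q /\ distant t r.
    by split; apply/distant_prod => k; case: (ht k).
  by have [_ _ /(_ erefl)] := ht i; apply; move/distant_prod: tp.
have [s hs] := component_mix (fun k => `[< c k q = c k p >]) q r.
exists s => t; rewrite !distant_prod.
split=> [[tp ts]|[tq tr]]; split=> i; have := hs i; have := H i.
- by move=> h e; have := ts i; rewrite e; case: asboolP => // ->.
- move=> h e; have := ts i; rewrite e; case: asboolP => // nq _.
  by case: h => // ->.
- by case=> [<-|<-].
- by move=> _ ->; case: ifP.
Qed.

(** This turns agreement at one coordinate into a relation that distant isomorphisms preserve. *)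
Lemma differ_only_disjoint p q r i : differ_only p q i ->
  (disjoint_differences p q r <-> c i r = c i p).
Proof.
move=> H; split=> [/(_ i)[/H//|//]|e k].
have [->|ne] := pselect (k = i); first by right.
by left; apply/H.
Qed.

End ProductPoints.

Section Decomposition.
Variables (m m' : nat) (S : 'I_m -> pzRingType) (S' : 'I_m' -> pzRingType).
Hypothesis nontrivial : forall i, (1 : S i) <> 0.
Hypothesis nontrivial' : forall i, (1 : S' i) <> 0.
Hypothesis sepS : forall i, separating (S i).
Hypothesis sepS' : forall i, separating (S' i).
Variable f : proj_line (prod_ring S) -> proj_line (prod_ring S').
Hypothesis f_iso : distant_iso f.
Local Notation c := component.

Lemma disjoint_differences_iso p q r :
  disjoint_differences p q r <-> disjoint_differences (f p) (f q) (f r).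
Proof.
case: f_iso => -[g fg gf] fd.
rewrite !disjoint_differencesP //; split=> -[s hs].
  exists (f s) => t; rewrite -[t]gf -!fd; exact: hs.
by exists (g s) => t; rewrite !fd gf; apply: hs.
Qed.

(** Suppose f q differs from f p at both j and k. Pull back points that differ from f p at j only
    and at k only. Each preimage must differ from p at i, since otherwise its differences would be
    disjoint from those of q; yet the two preimages have disjoint differences. *)
Lemma differ_only_iso p q i : differ_only p q i -> exists j, differ_only (f p) (f q) j.
Proof.
move=> pq; case: (f_iso) => fb _.
have [j hj] : exists j, c j (f q) <> c j (f p).
  apply: contrapT => /forallNP H; apply: (@not_differ_only_same _ _ p i).
  suff E : q = p by rewrite E in pq.
  by apply: (bij_inj fb); apply: component_inj => j; apply: contrapT.
exists j => k; split=> [+ e|]; first by rewrite e.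
move=> kj; apply: contrapT => hk.
have [r' r'j] := differ_only_exists nontrivial' (f p) j.
have [s' s'k] := differ_only_exists nontrivial' (f p) k.
have [r rE] := bij_surj fb r'; have [s sE] := bij_surj fb s'; subst r' s'.
have H x l : differ_only (f p) (f x) l -> c l (f q) <> c l (f p) -> c i x <> c i p.
  move=> xl lq /(differ_only_disjoint _ pq)/disjoint_differences_iso D.
  by have [//|/xl] := D l.
have [] : c i r = c i p \/ c i s = c i p; last 2 first.
- exact: H r'j hj.
- exact: H s'k hk.
suff : disjoint_differences p r s by apply.
apply/disjoint_differences_iso/(differ_only_disjoint _ r'j).
by apply/s'k => e; apply: kj.
Qed.

Lemma component_star p q i j : differ_only p q i -> differ_only (f p) (f q) j ->
  forall r, c i r = c i p <-> c j (f r) = c j (f p).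
Proof.
move=> pq fpq r.
by rewrite -(differ_only_disjoint r pq) disjoint_differences_iso (differ_only_disjoint _ fpq).
Qed.

Lemma component_matching i : exists j, forall p q,
  c i q = c i p <-> c j (f q) = c j (f p).
Proof.
have p0 := inf (prod_ring S).
have star p : exists j, forall q, c i q = c i p <-> c j (f q) = c j (f p).
  have [q pq] := differ_only_exists nontrivial p i.
  have [j fpq] := differ_only_iso pq.
  by exists j; apply: component_star fpq.
have uniq p j k : (forall q, c i q = c i p <-> c j (f q) = c j (f p)) ->
    (forall q, c i q = c i p <-> c k (f q) = c k (f p)) -> j = k.
  move=> hj hk; apply: contrapT => jk.
  have [q' fpq] := differ_only_exists nontrivial' (f p) j.
  have [q qE] := bij_surj (proj1 f_iso) q'; subst q'.
  have : c k (f q) = c k (f p) by apply/fpq => e; apply: jk.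
  by move=> /hk/hj/fpq.
have move_p p p' j : (forall q, c i q = c i p <-> c j (f q) = c j (f p)) ->
    c i p' = c i p -> forall q, c i q = c i p' <-> c j (f q) = c j (f p').
  by move=> h e q; rewrite e ((h p').1 e).
have [j hj] := star p0; exists j => p.
have [e|ne] := pselect (c i p = c i p0); first exact: move_p hj e.
(* To pass from p0 to p, only the i-th coordinate is changed at first. The points p0 and q differ at
   i alone, so one index k serves at both of them; from q to p the i-th coordinate stays fixed. *)
have [q qE] := component_mix (pred1 i) p0 p.
have pq : differ_only p0 q i.
  by move=> k; rewrite qE /=; case: eqP => [->|//]; split.
have [k fpq] := differ_only_iso pq.
have hk := component_star pq fpq.
have hk' := component_star (differ_only_sym pq) (differ_only_sym fpq).
rewrite (uniq _ _ _ hj hk); apply: move_p hk' _.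
by rewrite qE /= eqxx.
Qed.

End Decomposition.

Section DecompositionTheorem.
Variables (m m' : nat) (S : 'I_m -> pzRingType) (S' : 'I_m' -> pzRingType).
Hypothesis nontrivial : forall i, (1 : S i) <> 0.
Hypothesis nontrivial' : forall i, (1 : S' i) <> 0.
Hypothesis sepS : forall i, separating (S i).
Hypothesis sepS' : forall i, separating (S' i).
Local Notation c := component.

Lemma matching_inj (f : proj_line (prod_ring S) -> proj_line (prod_ring S'))
    (tau : 'I_m -> 'I_m') :
  (forall i p q, c i q = c i p <-> c (tau i) (f q) = c (tau i) (f p)) ->
  injective tau.
Proof.
move=> H i k e; apply: contrapT => ik.
have [q pq] := differ_only_exists nontrivial (inf _) i.
have : c k q = c k (inf _) by apply/pq => e'; apply: ik.
by move=> /H; rewrite -e => /H/pq.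
Qed.

Lemma distant_iso_product_form (f : proj_line (prod_ring S) -> proj_line (prod_ring S')) :
  distant_iso f -> exists (Em : m = m') (s : 'S_m)
    (fk : forall k : 'I_m, proj_line (S k) -> proj_line (S' (cast_ord Em (s k)))),
    product_form f fk.
Proof.
move=> f_iso; case: (f_iso) => -[g fg gf] fd.
have g_iso := distant_iso_inv fg gf f_iso.
have /choice[tau htau] := component_matching nontrivial nontrivial' sepS sepS' f_iso.
have /choice[tau' htau'] := component_matching nontrivial' nontrivial sepS' sepS g_iso.
have tau_inj := matching_inj htau.
have tau'_inj : injective tau'.
  move=> i k e; apply: contrapT => ik.
  have [q pq] := differ_only_exists nontrivial' (inf _) i.
  have : c k q = c k (inf _) by apply/pq => e'; apply: ik.
  by move=> /htau'; rewrite -e => /htau'/pq.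
have Em : m = m'.
  apply/eqP; rewrite eqn_leq; apply/andP; split.
    by have := leq_card _ tau_inj; rewrite !card_ord.
  by have := leq_card _ tau'_inj; rewrite !card_ord.
have si : injective (fun k => cast_ord (esym Em) (tau k)).
  by move=> i k /cast_ord_inj/tau_inj.
pose s : 'S_m := perm si.
have sE k : cast_ord Em (s k) = tau k by rewrite permE cast_ordKV.
have match_s k p q : c k q = c k p <->
    c (cast_ord Em (s k)) (f q) = c (cast_ord Em (s k)) (f p).
  by rewrite sE.
move: s match_s {sE} => s match_s.
(* Any lift of x will do: by [match_s] the value depends on the k-th component only. *)
pose fk k (x : proj_line (S k)) := c (cast_ord Em (s k)) (f (projT1 (cid (component_surj x)))).
have fkE q k : c (cast_ord Em (s k)) (f q) = fk k (c k q).
  by apply/match_s; case: cid.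
exists Em, s, fk; split=> // k; split.
  apply: bij_of_inj_surj => [x y|y].
    rewrite -(projT2 (cid (component_surj x))) -(projT2 (cid (component_surj y))).
    by rewrite -!fkE => /match_s.
  have [q qE] := component_surj y; exists (c k (g q)).
  by rewrite -fkE gf.
(* Distance in a product needs all coordinates, so a distant pair in one factor is lifted to a
   distant pair by taking a distant point at every other index. *)
have common (mm : nat) (T : 'I_mm -> pzRingType) (nt : forall i, (1 : T i) <> 0)
    (sepT : forall i, separating (T i)) i (x y : proj_line (T i)) : distant x y ->
    exists p q : proj_line (prod_ring T), [/\ c i p = x, c i q = y & distant p q].
  move=> xy; have [p pE] := component_surj x; have [q qE] := component_surj y.
  have [l|r hr] := @component_choice _ T (fun k z => distant (c k p) z /\ (k = i -> z = c k q)).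
    have [e|ne] := pselect (l = i).
      by exists (c l q); split=> //; rewrite e pE qE.
    have [z [zp _]] := common_distant nt sepT (c l p) (c l p).
    by exists z; split=> //; apply: distant_sym.
  exists p, r; split=> //; first by rewrite (hr i).2.
  by apply/distant_prod => l; case: (hr l).
move=> x y; split=> [/(common _ _ nontrivial sepS)[p [q [<- <-]]]|].
  by move=> /fd/distant_prod/(_ (cast_ord Em (s k))); rewrite !fkE.
move=> /(common _ _ nontrivial' sepS')[p [q [pE qE]]].
rewrite -[p]gf -[q]gf -fd => /distant_prod/(_ k).
have back z r : c (cast_ord Em (s k)) r = fk k z -> c k (g r) = z.
  have [q0 <-] := component_surj z; rewrite -fkE -{1}[r]gf.
  by move=> /match_s.
by rewrite (back _ _ pE) (back _ _ qE).
Qed.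

End DecompositionTheorem.

(** * Matrices over a division ring *)

Section DivisionRing.
Variable K : unitRingType.
Hypothesis fieldK : GRing.field_axiom K.

Lemma mx11_inv (l : 'M[K]_1) : l <> 0 -> exists l', l *m l' = 1%:M /\ l' *m l = 1%:M.
Proof.
move=> l0; have lE : l = (l ord0 ord0)%:M by rewrite [LHS]mx11_scalar.
have ul : l ord0 ord0 \is a GRing.unit.
  by apply/fieldK/eqP => e; apply: l0; rewrite lE e raddf0.
exists ((l ord0 ord0)^-1)%:M; rewrite lE mxE eqxx mulr1n -!scalar_mxM.
by rewrite mulrV // mulVr.
Qed.

Lemma mx11_neq0 : (1%:M : 'M[K]_1) <> 0.
Proof. by move=> /matrixP/(_ ord0 ord0); rewrite !mxE => /eqP; rewrite oner_eq0. Qed.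

Lemma mx_neq0_row m n (A : 'M[K]_(m, n)) : A <> 0 -> exists v : 'rV_m, v *m A <> 0.
Proof.
move=> A0; apply: contrapT => /forallNP H; apply: A0; apply/row_matrixP => i.
by rewrite rowE row0; apply: contrapT => /H.
Qed.

Lemma mx_neq0_col m n (A : 'M[K]_(m, n)) : A <> 0 -> exists k : 'cV_n, A *m k <> 0.
Proof.
move=> A0; apply: contrapT => /forallNP H; apply: A0; apply/matrixP => i j.
have /contrapT : ~ (A *m delta_mx j (ord0 : 'I_1) <> 0) by apply: H.
by rewrite -colE => /matrixP/(_ i ord0); rewrite !mxE.
Qed.

Lemma row_dual n (y : 'rV[K]_n) : y <> 0 -> exists k, y *m k = 1%:M.
Proof.
move=> /mx_neq0_col[k /mx11_inv[l [yk _]]]; exists (k *m l).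
by rewrite mulmxA.
Qed.

Lemma col_dual n (x : 'cV[K]_n) : x <> 0 -> exists v, v *m x = 1%:M.
Proof.
move=> /mx_neq0_row[k /mx11_inv[l [_ yk]]]; exists (l *m k).
by rewrite -mulmxA.
Qed.

(* A vector space is not the union of two proper subspaces. *)
Lemma mx_neq0_row2 m n p (A : 'M[K]_(m, n)) (B : 'M[K]_(m, p)) : A <> 0 -> B <> 0 ->
  exists v : 'rV_m, v *m A <> 0 /\ v *m B <> 0.
Proof.
move=> /mx_neq0_row[v vA] /mx_neq0_row[w wB].
have [vB|vB] := pselect (v *m B = 0); last by exists v.
have [wA|wA] := pselect (w *m A = 0); last by exists w.
by exists (v + w); rewrite !mulmxDl vB wA addr0 add0r.
Qed.

Lemma mx_neq0_col2 m n p (A : 'M[K]_(n, m)) (B : 'M[K]_(p, m)) : A <> 0 -> B <> 0 ->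
  exists k : 'cV_m, A *m k <> 0 /\ B *m k <> 0.
Proof.
move=> /mx_neq0_col[v vA] /mx_neq0_col[w wB].
have [vB|vB] := pselect (B *m v = 0); last by exists v.
have [wA|wA] := pselect (A *m w = 0); last by exists w.
by exists (v + w); rewrite !mulmxDr vB wA addr0 add0r.
Qed.

(** With y1 k0 = 1, the row y2 - (y2 k0) y1 is nonzero and kills k0; a column dual to it is
    corrected by a multiple of k0 so that y1 kills it. *)
Lemma row_dual2 n (y1 y2 : 'rV[K]_n) : (forall l, y2 <> l *m y1) ->
  exists k, y1 *m k = 0 /\ y2 *m k = 1%:M.
Proof.
move=> H; have [y10|y1n] := pselect (y1 = 0).
  have [|k yk] := @row_dual _ y2; first by have := H 0; rewrite mul0mx.
  by exists k; rewrite y10 mul0mx.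
have [k0 yk0] := row_dual y1n.
have [|k' yk'] := @row_dual _ (y2 - (y2 *m k0) *m y1).
  by move=> /subr0_eq /H.
exists (k' - k0 *m (y1 *m k')); split.
  by rewrite mulmxBr [y1 *m (k0 *m _)]mulmxA yk0 mul1mx subrr.
by rewrite mulmxBr -yk' mulmxBl !mulmxA.
Qed.

Lemma col_dual2 n (x1 x2 : 'cV[K]_n) : (forall l, x2 <> x1 *m l) ->
  exists v, v *m x1 = 0 /\ v *m x2 = 1%:M.
Proof.
move=> H; have [y10|y1n] := pselect (x1 = 0).
  have [|k yk] := @col_dual _ x2; first by have := H 0; rewrite mulmx0.
  by exists k; rewrite y10 mulmx0.
have [k0 yk0] := col_dual y1n.
have [|k' yk'] := @col_dual _ (x2 - x1 *m (k0 *m x2)).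
  by move=> /subr0_eq /H.
exists (k' - (k' *m x1) *m k0); split.
  by rewrite mulmxBl -(mulmxA (k' *m x1)) yk0 mulmx1 subrr.
by rewrite mulmxBl -yk' mulmxBr -!mulmxA.
Qed.

Lemma col_scale_sym n (x z : 'cV[K]_n) l : z <> 0 -> z = x *m l -> exists l', x = z *m l'.
Proof.
move=> z0 zE; have [|l' [ll' _]] := @mx11_inv l.
  by move=> l0; apply: z0; rewrite zE l0 mulmx0.
by exists l'; rewrite zE -mulmxA ll' mulmx1.
Qed.

Lemma row_scale_sym n (y w : 'rV[K]_n) l : w <> 0 -> w = l *m y -> exists l', y = l' *m w.
Proof.
move=> z0 zE; have [|l' [_ ll']] := @mx11_inv l.
  by move=> l0; apply: z0; rewrite zE l0 mul0mx.
by exists l'; rewrite zE mulmxA ll' mul1mx.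
Qed.

Lemma outer_neq0 n (x : 'cV[K]_n) (y : 'rV[K]_n) : x <> 0 -> y <> 0 -> x *m y <> 0.
Proof.
move=> x0 /row_dual[k yk] xy; apply: x0.
by rewrite -[x]mulmx1 -yk mulmxA xy mul0mx.
Qed.

Lemma outer_eq n (x z : 'cV[K]_n) (y w : 'rV[K]_n) : x <> 0 -> y <> 0 ->
  x *m y = z *m w -> (exists l, z = x *m l) /\ (exists l, w = l *m y).
Proof.
move=> x0 y0 E; have [k yk] := row_dual y0; have [v vx] := col_dual x0.
split.
  apply: (@col_scale_sym _ _ _ (w *m k)) => //.
  by rewrite mulmxA -E -mulmxA yk mulmx1.
apply: (@row_scale_sym _ _ _ (v *m z)) => //.
by rewrite -mulmxA -E mulmxA vx mul1mx.
Qed.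

(** With independent columns and independent rows the difference would have rank two. Formally, a
    row killing x but not z shows that t is proportional to w, and a column killing y but not w
    shows that s is proportional to z; then xy is a multiple of the shape z(..)w, which makes z
    proportional to x. *)
Lemma outer_sub n (x z s : 'cV[K]_n) (y w t : 'rV[K]_n) : x <> 0 -> y <> 0 ->
  x *m y - z *m w = s *m t -> (exists l, z = x *m l) \/ (exists l, w = l *m y).
Proof.
move=> x0 y0 E; apply: contrapT => /not_orP[/forallNP zx /forallNP wy].
have [v [vx vz]] := col_dual2 zx; have [k [yk wk]] := row_dual2 wy.
have Ew : w = - (v *m s) *m t.
  by rewrite mulNmx -mulmxA -E mulmxBr !mulmxA vx vz mul0mx mul1mx sub0r opprK.
have Ez : z = - s *m (t *m k).
  by rewrite mulNmx mulmxA -E mulmxBl -!mulmxA yk wk mulmx0 mulmx1 sub0r opprK.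
have [l' [ll l'l]] : exists l', (t *m k) *m l' = 1%:M /\ l' *m (t *m k) = 1%:M.
  apply: mx11_inv => e; apply: (zx 0).
  by rewrite mulmx0 Ez e mulmx0.
have Es : s = z *m (- l').
  by rewrite Ez mulNmx mulmxN mulNmx opprK -!mulmxA [t *m (k *m _)]mulmxA ll mulmx1.
have [r' [_ rr]] : exists r', - (v *m s) *m r' = 1%:M /\ r' *m - (v *m s) = 1%:M.
  apply: mx11_inv => e; apply: (wy 0); by rewrite mul0mx Ew e mul0mx.
have Et : t = r' *m w by rewrite Ew mulmxA rr mul1mx.
have xyE : x *m y = z *m ((1%:M - l' *m r') *m w).
  rewrite -[LHS](subrK (z *m w)) E Es Et !mulmxBl mul1mx !mulmxBr.
  by rewrite mulmxN mulNmx -!mulmxA addrC.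
by have [[l] /zx] := outer_eq x0 y0 xyE.
Qed.

Section Matrices.
Variable n : nat.
Local Notation R := 'M[K]_n.
Implicit Types (a b c d e t u : R) (x z k : 'cV[K]_n) (y w v : 'rV[K]_n).

Lemma mx_mulE a b : a * b = a *m b. Proof. by []. Qed.
Lemma mx_oneE : 1 = 1%:M :> R. Proof. by []. Qed.

Lemma not_invertible_row v a : v <> 0 -> v *m a = 0 -> ~ invertible a.
Proof.
move=> v0 va [b [ab _]]; apply: v0.
by rewrite -[v]mulmx1 -mx_oneE -ab mx_mulE mulmxA va mul0mx.
Qed.

(** The inverse is the Sherman-Morrison one, 1 + x l y with l the inverse of 1 - yx; if yx = 1, the
    row y kills 1 - xy. *)
Lemma invertible_outer x y : invertible (1 - x *m y) <-> y *m x <> 1%:M.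
Proof.
split=> [i yx|yx].
  have y0 : y <> 0 by move=> y0; apply: mx11_neq0; rewrite -yx y0 mul0mx.
  apply: not_invertible_row y0 _ i.
  by rewrite mulmxBr mulmxA yx mul1mx mulmx1 subrr.
have [|l [l1 l2]] := @mx11_inv (1%:M - y *m x); first by move=> /subr0_eq/esym.
exists (1 + x *m l *m y); split.
  rewrite mulrDr mulr1 mulrBl mul1r mx_mulE.
  have -> : x *m y *m (x *m l *m y) = x *m (l - 1%:M) *m y.
    have -> : l - 1%:M = y *m x *m l by rewrite -l1 mulmxBl mul1mx opprB addrC subrK.
    by rewrite !mulmxA.
  by rewrite mulmxBr mulmx1 mulmxBl opprB [X in _ + X]addrC subrK subrK.
rewrite mulrDl mul1r mulrBr mulr1 mx_mulE.
have -> : x *m l *m y *m (x *m y) = x *m (l - 1%:M) *m y.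
  have -> : l - 1%:M = l *m (y *m x) by rewrite -l2 mulmxBr mulmx1 opprB addrC subrK.
  by rewrite !mulmxA.
by rewrite mulmxBr mulmx1 mulmxBl opprB [X in _ + X]addrC subrK subrK.
Qed.

End Matrices.

(** One formula for the inverse serves the upper and the lower triangular case, since one of its
    off-diagonal blocks vanishes. *)
Lemma invertible_block m n (a : 'M[K]_m) (b : 'M[K]_(m, n)) (c : 'M[K]_(n, m)) (d : 'M[K]_n) :
  b = 0 \/ c = 0 -> invertible a -> invertible d ->
  invertible (block_mx a b c d : 'M[K]_(m + n)).
Proof.
move=> bc [a' [aa' a'a]] [d' [dd' d'd]].
exists (block_mx a' (- (a' *m b *m d')) (- (d' *m c *m a')) d').
rewrite !mx_mulE in aa' a'a dd' d'd *; rewrite !mulmx_block mx_oneE.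
rewrite (scalar_mx_block m n 1) -!mx_oneE.
case: bc => ->; rewrite ?(mulmx0, mul0mx, oppr0, addr0, add0r) aa' a'a dd' d'd;
rewrite !(mulmxN, mulNmx) !mulmxA ?aa' ?dd' -?mulmxA ?a'a ?d'd ?mul1mx ?mulmx1 !addrN ?addNr.
all: by rewrite ?addNr.
Qed.

(** Gaussian elimination: move a nonzero entry to the upper left corner, clear its row and column,
    and treat the Schur complement by induction. This is the source of unit-regularity. *)
Lemma mx_equiv_idempotent n (A : 'M[K]_n) : exists P Q : 'M[K]_n,
  [/\ invertible P, invertible Q & P *m A *m Q *m (P *m A *m Q) = P *m A *m Q].
Proof.
elim: n A => [|n IH] A.
  by exists 1, 1; split; [exact: invertible1..|rewrite [LHS]flatmx0 [RHS]flatmx0].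
have [->|A0] := pselect (A = 0).
  by exists 1, 1; split; [exact: invertible1..|rewrite mulmx0 !mul0mx].
have step (B : 'M[K]_(1 + n)) : B ord0 ord0 <> 0 -> exists P Q : 'M[K]_(1 + n),
    [/\ invertible P, invertible Q & P *m B *m Q *m (P *m B *m Q) = P *m B *m Q].
  move=> B0; rewrite -(submxK B).
  have : ulsubmx B <> 0.
    move=> /matrixP/(_ ord0 ord0); rewrite !mxE lshift0 => e; exact: B0.
  move: (ulsubmx B) (ursubmx B) (dlsubmx B) (drsubmx B) => a b c d.
  move=> /mx11_inv[a' [aa' a'a]].
  have [P [Q [iP iQ PQ]]] := IH (d - c *m a' *m b).
  exists (block_mx 1%:M 0 0 P *m block_mx a' 0 (- (c *m a')) 1%:M).
  exists (block_mx 1%:M (- (a' *m b)) 0 1%:M *m block_mx 1%:M 0 0 Q).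
  have i1 k : invertible (1%:M : 'M[K]_k) by exact: invertible1.
  have ia' : invertible a' by exists a.
  split.
  - by apply: (@invertibleM 'M[K]_(1 + n)); apply: invertible_block => //; left.
  - by apply: (@invertibleM 'M[K]_(1 + n)); apply: invertible_block => //; right.
  have -> : block_mx 1%:M 0 0 P *m block_mx a' 0 (- (c *m a')) 1%:M *m block_mx a b c d *m
     (block_mx 1%:M (- (a' *m b)) 0 1%:M *m block_mx 1%:M 0 0 Q) =
     block_mx 1%:M 0 0 (P *m (d - c *m a' *m b) *m Q).
    rewrite -!mulmxA [block_mx a b c d *m _]mulmxA [block_mx a' _ _ _ *m _]mulmxA.
    rewrite [block_mx a' _ _ _ *m _]mulmxA.
    rewrite !mulmx_block !(mulmx0, mul0mx, mulmx1, mul1mx, addr0, add0r).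
    rewrite a'a mulNmx -[c *m a' *m a]mulmxA a'a mulmx1 addNr !mul0mx !add0r.
    rewrite mul1mx addNr !mul0mx !mulmx0 mulNmx [_ + d]addrC.
    by rewrite !mulmxA.
  by rewrite mulmx_block !(mulmx0, mul0mx, mulmx1, addr0, add0r) PQ.
have [i [j Aij]] : exists i j, A i j <> 0.
  apply: contrapT => H; apply: A0; apply/matrixP => i j; rewrite mxE.
  by apply: contrapT => e; apply: H; exists i, j.
have [|P [Q [iP iQ PQ]]] := step (xrow ord0 i (xcol ord0 j A)).
  by rewrite !mxE !tpermL.
have it k l : invertible (tperm_mx k l : 'M[K]_n.+1).
  by exists (tperm_mx k l); rewrite mx_mulE -perm_mxM tperm2 perm_mx1.
move: PQ; rewrite xrowE xcolE => PQ.
exists (P *m tperm_mx ord0 i), (tperm_mx ord0 j *m Q); split.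
- exact: invertibleM.
- exact: invertibleM.
by move: PQ; rewrite !mulmxA.
Qed.

End DivisionRing.

(** * Unit-regularity and stable range *)

(** Equivalent to the usual form a = a v a with v a unit, by taking e = va and u the inverse of
    v. *)
Definition unit_regular (R : pzRingType) : Prop :=
  forall a : R, exists u e, [/\ invertible u, e * e = e & a = u * e].

Section UnitRegular.
Variable R : pzRingType.
Hypothesis regR : unit_regular R.
Implicit Types a b t : R.

(** From u e b = 1 one gets e b = u^-1, so e fixes the unit u^-1 from the left and therefore equals
    1. *)
Lemma right_inverse_invertible a b : a * b = 1 -> invertible a.
Proof.
have [u [e [iu ee ->]]] := regR a => ueb; case: (iu) => u' [uu' u'u].
suff -> : e = 1 by rewrite mulr1.
have eb : e * b = u'.
  by rewrite -[LHS]mul1r -u'u -mulrA [u * _]mulrA ueb mulr1.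
by rewrite -[e]mulr1 -u'u mulrA -eb mulrA ee eb u'u.
Qed.

Lemma stable_range a b : unimodular a b -> exists t, invertible (a - b * t).
Proof.
move=> [c [d [h [+ _]]]]; rewrite (mx2_eta h) mx2M -mx2_1 => /mx2_inj[+ _ _ _].
move: (h ord0 ord0) (h ord_max ord0) => x y.
have [u [e [iu ee ->]]] := regR a => E; case: (iu) => u' [uu' u'u].
have [f fE] : exists f, f = 1 - e by exists (1 - e).
(* Conjugating ax + by = 1 by u and multiplying by f = 1 - e from the left gives fg = f. Hence for t
   = - y u f the element a - bt = u(e + g) equals u(1 + eg), and eg has square zero because fe =
   0. *)
pose g := u' * b * (y * u) * f.
have fe : f * e = 0 by rewrite fE mulrBl mul1r ee subrr.
have ff : f * f = f by rewrite {2}fE mulrBr mulr1 fe subr0.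
have Eg : e * (x * u) + u' * b * (y * u) = 1.
  rewrite -u'u -[u in RHS]mul1r -E mulrDl mulrDr !mulrA u'u mul1r.
  by [].
have fg : f * g = f.
  have fb : f * (u' * b * (y * u)) = f.
    by rewrite -[RHS]mulr1 -Eg mulrDr [f * (e * _)]mulrA fe mul0r add0r.
  by rewrite /g [LHS]mulrA fb ff.
have gE : e + g = 1 + e * g.
  have fe1 : f + e = 1 by rewrite fE subrK.
  by rewrite -[g in LHS]mul1r -fe1 mulrDl fg addrA [e + f]addrC.
have eg0 : e * g * (e * g) = 0.
  by rewrite {1}/g -!mulrA [f * (e * g)]mulrA fe mul0r !mulr0.
exists (- (y * u * f)).
have -> : u * e - b * - (y * u * f) = u * (1 + e * g).
  by rewrite mulrN opprK -gE mulrDr /g !mulrA uu' mul1r.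
apply: invertibleM => //; exists (1 - e * g).
split; first by rewrite mulrDl mul1r mulrBr mulr1 eg0 subr0 subrK.
by rewrite mulrBl mul1r mulrDr mulr1 eg0 addr0 addrK.
Qed.

Lemma unimodular0r b : unimodular 0 b -> invertible b.
Proof.
move=> [c [d [h [+ _]]]]; rewrite (mx2_eta h) mx2M -mx2_1 => /mx2_inj[+ _ _ _].
by rewrite mul0r add0r; apply: right_inverse_invertible.
Qed.

Lemma unimodular_swap a b : unimodular a b -> unimodular b a.
Proof. by move=> [c [d i]]; exists d, c; apply/invertible2_swapr. Qed.

Lemma rep_zero p b : rep p 0 b -> p = aff 0.
Proof.
move=> rp; have [c -> e] := rep_affE rp (unimodular0r rp.1).
congr aff.
have [b' [_ b'b]] := unimodular0r rp.1.
by rewrite -[c]mul1r -b'b -mulrA -e mulr0.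
Qed.

Lemma rep_inf0 p a : rep p a 0 -> p = inf R.
Proof.
move=> rp; have /unimodular0r [a' [aa' a'a]] := unimodular_swap rp.1.
apply: (rep_inj (a := 1) (b := 0)); last exact: rep_inf.
by rewrite -a'a -(mulr0 a'); apply: rep_unit => //; exists a.
Qed.

End UnitRegular.

Lemma GL2_mapM (R : pzRingType) (g h : GL2 R) p :
  GL2_map (MkGL2 (GL2_mul_subproof g h)) p = GL2_map h (GL2_map g p).
Proof.
apply: proj_line_eqP; apply/seteqP; split=> v /=.
  move=> [w pw <-]; exists (w *m g); last by rewrite mulmxA.
  by exists w.
by move=> [w [w' pw' <-] <-]; exists w' => //; rewrite mulmxA.
Qed.

Lemma GL2_to_inf (R : pzRingType) (q : proj_line R) : exists g, GL2_map g q = inf R.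
Proof.
have [a [b rq]] := rep_exists q; case: (rq) => -[c [d i]] _.
have [h [h1 h2]] := GL2_inv (MkGL2 i); exists h.
apply: (rep_inj (rep_GL2_map (mx2_eta h) rq)); move: h1 => /=.
by rewrite {1}(mx2_eta h) mx2M -mx2_1 => /mx2_inj[-> -> _ _]; apply: rep_inf.
Qed.

(** * Separation of points over a matrix ring *)

Section MatrixLine.
Variable K : unitRingType.
Hypothesis fieldK : GRing.field_axiom K.
Variable n : nat.
Local Notation R := 'M[K]_n.
Local Notation PR := (proj_line R).
Implicit Types (a b c d e t u : R) (x z k : 'cV[K]_n) (y w v : 'rV[K]_n) (p q r s : PR).

Lemma mx_unit_regular : unit_regular R.
Proof.
move=> a; have [P [Q [[P' [PP' P'P]] [Q' [QQ' Q'Q]] H]]] := mx_equiv_idempotent fieldK a.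
rewrite -!mx_mulE in H; have [w wE] : exists w : R, w = P * a * Q by exists (P * a * Q).
rewrite -wE in H; exists (P' * Q'), (Q * w * Q'); split.
- by apply: invertibleM; [exists P|exists Q].
- by rewrite -!mulrA [Q' * (Q * _)]mulrA Q'Q mul1r [w * (w * _)]mulrA H.
by rewrite wE !mulrA -(mulrA P') Q'Q mulr1 P'P mul1r -mulrA QQ' mulr1.
Qed.

(** After moving q to R(1,0) and r to R(1,c), every point R(t,1) is distant from q. It remains to
    find t with 1 - tc invertible and a - bt singular, where p = R(a,b); a rank one t suffices. *)
Lemma separating_mx : separating R.
Proof.
move=> p q r.
have [g gq] := GL2_to_inf q.
have [c [h [hq hr]]] : exists c, exists h : GL2 R, GL2_map h q = inf R /\ GL2_map h r = coaff c.
  have [a [b rr]] := rep_exists (GL2_map g r).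
  have [t it] := stable_range mx_unit_regular rr.1.
  pose gt := MkGL2 (invertible2_shear (- t)).
  have gtE : (gt : 'M_2) = mx2 1 0 (- t) 1 by [].
  have := rep_GL2_map gtE rr; rewrite !mulr1 !mulr0 add0r mulrN => rr'.
  have /distant_zeroP[c hc] : distant (GL2_map gt (GL2_map g r)) (aff 0).
    by apply/(distant_aff _ rr'); rewrite mulr0 subr0.
  exists c, (MkGL2 (GL2_mul_subproof g gt)).
  rewrite !GL2_mapM gq; split=> //.
  apply: (rep_inj (rep_GL2_map gtE (rep_inf R))).
  by rewrite !mul0r !addr0 mulr0 mulr1; apply: rep_inf.
move=> pq pr.
have hinj := bij_inj (GL2_map_bij h).
have [a [b rp]] := rep_exists (GL2_map h p).
have b0' : b <> 0.
  move=> e; rewrite e in rp; apply: pq; apply: hinj; rewrite hq.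
  exact: rep_inf0 mx_unit_regular _ _ rp.
have bac : b - a *m c <> 0.
  move=> /subr0_eq e; rewrite e in rp; apply: pr; apply: hinj; rewrite hr.
  have : unimodular a (0 : R).
    case: rp.1 => x [y i]; exists x, (y - x * c).
    have -> : mx2 a 0 x (y - x * c) = mx2 a (a * c) x y *m mx2 1 (- c) 0 1.
      rewrite mx2M !mulr1 !mulr0 !addr0 !mulrN addNr.
      by rewrite [- (x * c) + y]addrC.
    apply: invertible2M => //; apply/invertible2_swapl/invertible2_swapr.
    exact: invertible2_shear.
  move=> /unimodular_swap/(unimodular0r mx_unit_regular) ia.
  apply: (rep_inj rp); rewrite -[a in rep _ a _]mulr1.
  exact: rep_unit (rep_coaff c) ia.
(* For t = k' v a with v b k' = 1 the row v kills a - bt, while 1 - tc is invertible exactly when v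
   a c k' is not 1, that is, when v(b - ac)k' is nonzero. So v and k must avoid two kernels at
   once. *)
have [v [vb vbac]] := mx_neq0_row2 b0' bac.
have [k [bk ck]] := mx_neq0_col2 vb vbac.
have [l [kl lk]] := mx11_inv fieldK bk.
pose k' := k *m l.
have zk : v *m b *m k' = 1%:M by rewrite mulmxA.
pose t : R := k' *m (v *m a).
have [s sE] := bij_surj (GL2_map_bij h) (aff t).
exists s; split; rewrite -(distant_GL2 h) sE ?hq ?hr.
- by apply/distant_infP; exists t.
- apply/(distant_coaff _ (rep_aff t)); apply/invertibleN; rewrite opprB.
  rewrite mx_mulE -mulmxA; apply/(invertible_outer fieldK) => e; apply: ck.
  rewrite mulmxBr mulmxA mulmxBl; apply/eqP; rewrite subr_eq0; apply/eqP.
  have kE : k = k' *m (v *m b *m k) by rewrite /k' -mulmxA lk mulmx1.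
  by rewrite [in RHS]kE [RHS]mulmxA e mul1mx.
move=> /distant_sym/(distant_aff _ rp); apply: (@not_invertible_row _ _ v).
  by move=> v0; apply: vb; rewrite v0 mul0mx.
by rewrite mulmxBr mx_mulE mulmxA -/t mulmxA zk mul1mx subrr.
Qed.

End MatrixLine.

(** * Adjacency of points over a matrix ring *)

(* In the Grassmannian model, where points over a matrix ring are n-dimensional
   subspaces of a 2n-dimensional space, this says that [p] and [r] meet in
   codimension 1; [q] is a third point of the pencil spanned by them. *)
Definition adjacent (R : pzRingType) (p r : proj_line R) : Prop :=
  p <> r /\ exists q, q <> r /\
    forall s, distant s r -> distant s p \/ distant s q.

Definition linked (R : pzRingType) (i a b c d u : proj_line R) : Prop :=
  ~ distant u i /\ [/\ adjacent u a, adjacent u b, adjacent u c & adjacent u d].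

(* Let [i] be infinity. The common neighbours of the opposite vertices [a] and [d]
   form a product of two projective lines P x P, and those nondistant from [i] its
   diagonal. For [b] = (l,l') the points [u] = (l,l) and [v] = (l',l') force
   [c] = (l',l), which is the vertex with [a + d = b + c]. *)
Definition parallelogram (R : pzRingType) (i a b c d : proj_line R) : Prop :=
  [/\ ~ adjacent b c /\ b <> c, ~ adjacent d a /\ d <> a,
      adjacent b a /\ adjacent c a, adjacent d b /\ adjacent d c &
      exists u v, [/\ u <> v, linked i a b c d u & linked i a b c d v]].

Section Preservation.
Variables (R S : pzRingType) (f : proj_line R -> proj_line S).
Hypothesis f_iso : distant_iso f.

Lemma distant_iso_neq p q : p <> q <-> f p <> f q.
Proof.
split=> [ne /(bij_inj (proj1 f_iso))//|ne e]; by rewrite e in ne.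
Qed.

Lemma adjacent_iso p r : adjacent p r <-> adjacent (f p) (f r).
Proof.
case: (f_iso) => -[g fg gf] fd.
split=> -[/distant_iso_neq ne [q [qr H]]]; split=> //.
  exists (f q); split; first exact/distant_iso_neq.
  by move=> s; rewrite -[s]gf -!fd; apply: H.
exists (g q); split; first by apply/distant_iso_neq; rewrite gf.
by move=> s; rewrite !fd gf; apply: H.
Qed.

Lemma linked_iso i a b c d u :
  linked i a b c d u -> linked (f i) (f a) (f b) (f c) (f d) (f u).
Proof.
move=> [ui [/adjacent_iso ua /adjacent_iso ub /adjacent_iso uc /adjacent_iso ud]].
by split=> //; rewrite -(proj2 f_iso).
Qed.

Lemma parallelogram_iso i a b c d :
  parallelogram i a b c d -> parallelogram (f i) (f a) (f b) (f c) (f d).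
Proof.
move=> [[bc /distant_iso_neq bc'] [da /distant_iso_neq da']].
move=> [/adjacent_iso ba /adjacent_iso ca] [/adjacent_iso db /adjacent_iso dc].
move=> [u [v [/distant_iso_neq uv /linked_iso lu /linked_iso lv]]].
split=> //; try by split=> // /adjacent_iso.
by exists (f u), (f v).
Qed.

End Preservation.

(** Rank at most one: zero is included, in contrast to [rank1]. *)
Definition outer (K : unitRingType) n (a : 'M[K]_n) : Prop :=
  exists (x : 'cV_n) (y : 'rV_n), a = x *m y.

Definition rank1 (K : unitRingType) n (a : 'M[K]_n) : Prop :=
  exists (x : 'cV_n) (y : 'rV_n), [/\ x <> 0, y <> 0 & a = x *m y].

Section Adjacency.
Variable K : unitRingType.
Hypothesis fieldK : GRing.field_axiom K.
Variable n : nat.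
Local Notation R := 'M[K]_n.
Local Notation PR := (proj_line R).
Implicit Types (a b c d e t u : R) (x z k s : 'cV[K]_n) (y w v : 'rV[K]_n) (p q r : PR).
Local Notation zero := (aff (0 : R)).

Lemma rank1_outer a : rank1 a -> outer a.
Proof. by move=> [x [y [_ _ ->]]]; exists x, y. Qed.

Lemma outer_rank1 a : outer a -> a <> 0 -> rank1 a.
Proof.
move=> [x [y ->]] xy; exists x, y; split=> // e; apply: xy.
  by rewrite e mul0mx.
by rewrite e mulmx0.
Qed.

Lemma rep_zero_eq0 a b : rep zero a b -> a = 0.
Proof. by move=> /(rep_scale (rep_aff 0))[u _ [->]]; rewrite mulr0. Qed.

(** As a subspace, R(xy, 1 - xy1) contains (y,0), so it is not distant from R(1,0); it meets R(0,1)
    in the rows (0,v) with vx = 0, a hyperplane. *)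
Lemma dual_point_unimodular x y y1 : y <> 0 -> y1 *m x = 1%:M ->
  unimodular (x *m y : R) (1 - x *m y1).
Proof.
(* With second row (1, k y1) the Schur complement is, up to sign, 1 - (x + x) y1. It is invertible
   because 1 + 1 differs from 1 in every characteristic. *)
move=> /(row_dual fieldK)[k yk] y1x; exists 1, (k *m y1); apply/invertible2_c2.
rewrite mx_mulE -mulmxA [y *m _]mulmxA yk mul1mx opprB addrA.
rewrite -invertibleN opprB -mulmxDr; apply/(invertible_outer fieldK).
by rewrite mulmxDl y1x => /(canRL (addrK _)); rewrite subrr => /mx11_neq0.
Qed.

(* The points [R(0,1)], [R(xy,1)] and [R(xy,1-xy1)] lie on a pencil of
   subspaces, so a complement of the first fails to be a complement of at most
   one of the other two. *)
Lemma pencil_cover x y y1 p r : y1 *m x = 1%:M ->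
  rep p (x *m y : R) (1 - x *m y1) -> distant r zero ->
  distant r (aff (x *m y : R)) \/ distant r p.
Proof.
move=> y1x rp /distant_zeroP[t ->].
have [yt|nyt] := pselect (y *m t *m x = 1%:M); last first.
  left; apply: distant_sym; apply/(distant_coaff _ (rep_aff _))/invertibleN.
  by rewrite opprB mx_mulE -mulmxA; apply/(invertible_outer fieldK).
right; apply: distant_sym; apply/(distant_coaff _ rp)/invertibleN.
rewrite mx_mulE opprB -addrA -opprD -mulmxA -mulmxDr.
apply/(invertible_outer fieldK); rewrite mulmxDl y1x yt.
by move=> /(canRL (addrK _)); rewrite subrr => /mx11_neq0.
Qed.

(** Stable range makes some b - xyt a unit; scaling by its inverse turns the second coordinate into
    a rank one perturbation of 1. *)
Lemma rep_outer_normal p x y b : rep p (x *m y : R) b ->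
  exists u y2, invertible u /\ rep p (u *m x *m y) (1 - u *m x *m y2).
Proof.
move=> rp; have regR := @mx_unit_regular _ fieldK n.
have [t [g' [gg' g'g]]] := stable_range regR (unimodular_swap rp.1).
exists g', (- (y *m t)); split; first by exists (b - x *m y * t).
have ig : invertible g' by exists (b - x *m y * t).
have := rep_unit rp ig.
have -> : g' * b = 1 - g' *m x *m - (y *m t).
  by rewrite mulmxN opprK -g'g mulrBr !mx_mulE -!mulmxA subrK.
by rewrite mx_mulE mulmxA.
Qed.

Lemma invertible_col_neq0 u x : invertible u -> x <> 0 -> u *m x <> 0.
Proof.
move=> [u' [_ u'u]] x0 e; apply: x0.
by rewrite -[x]mul1mx -mx_oneE -u'u mx_mulE -mulmxA e mulmx0.
Qed.

Lemma adjacent_zero p a b : rep p a b -> (adjacent p zero <-> rank1 a).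
Proof.
have regR := @mx_unit_regular _ fieldK n.
move=> rp; split=> [[pr [q [qr H]]]|[x [y [x0 y0 aE]]]].
  have [c [d rq]] := rep_exists q.
  have a0 : a <> 0 by move=> e; apply: pr; rewrite e in rp; apply: rep_zero rp.
  have c0 : c <> 0 by move=> e; apply: qr; rewrite e in rq; apply: rep_zero rq.
  have dep v w : v *m a <> 0 -> w *m c <> 0 -> exists l, w *m c = l *m (v *m a).
    move=> va wc; apply: contrapT => /forallNP ind.
    have [k2 [vk2 wk2]] := row_dual2 fieldK ind.
    have [|k1 [wk1 vk1]] := @row_dual2 _ fieldK _ (w *m c) (v *m a).
      move=> l /(row_scale_sym fieldK va)[l']; exact: ind.
    (* Were va and wc independent, this t would satisfy v a t = v b and w c t = w d. Then R(1,t)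
       would be distant from R(0,1) but from neither p nor q. So all rows of a are multiples of a
       single row. *)
    pose t := k1 *m (v *m b) + k2 *m (w *m d).
    have : distant (coaff t) zero by apply/distant_zeroP; exists t.
    have kill (u : 'rV_n) (a' b' : R) (r : PR) : rep r a' b' -> u *m a' <> 0 ->
        u *m a' *m t = u *m b' -> ~ distant (coaff t) r.
      move=> rr ua ut /distant_sym/(distant_coaff _ rr).
      apply: (@not_invertible_row _ _ u) => [u0|]; first by apply: ua; rewrite u0 mul0mx.
      by rewrite mulmxBr mulmxA ut subrr.
    move=> /H[]; [apply: kill rp va _|apply: kill rq wc _];
      by rewrite mulmxDr !mulmxA ?vk1 ?vk2 ?wk1 ?wk2 !mul0mx mul1mx ?addr0 ?add0r.
  have [w wc] := mx_neq0_row c0; pose y := w *m c.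
  have /choice[l lE] : forall i, exists l : 'M_1, row i a = l *m y.
    move=> i; have [e|ne] := pselect (row i a = 0).
      by exists 0; rewrite e mul0mx.
    rewrite rowE in ne *; have [l yE] := dep _ _ ne wc.
    exact: (row_scale_sym fieldK wc yE).
  have aE : a = (\col_i l i ord0 ord0) *m y.
    apply/row_matrixP => i; rewrite lE row_mul; congr (_ *m _).
    by apply/matrixP => j k; rewrite !mxE !ord1.
  by apply: outer_rank1 a0; exists (\col_i l i ord0 ord0), y.
have pr : p <> zero.
  move=> e; rewrite e in rp; apply: (outer_neq0 fieldK x0 y0).
  by rewrite -aE; apply: rep_zero_eq0 rp.
split=> //; rewrite aE in rp; have [u [y2 [iu ]]] := rep_outer_normal rp.
have := invertible_col_neq0 iu x0; move: (u *m x) => {rp a aE iu}x' x'0 rp.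
have xy0 := outer_neq0 fieldK x'0 y0.
have neq_zero q a c : rep q a c -> a <> 0 -> q <> zero.
  by move=> rq a0 e; apply: a0; rewrite e in rq; apply: rep_zero_eq0 rq.
(* The covering pencil contains an affine point and one that is not distant from R(1,0). Whichever
   kind p is, the other kind provides q. *)
have [y2x|ny2x] := pselect (y2 *m x' = 1%:M).
  exists (aff (x' *m y)); split; first exact: neq_zero (rep_aff _) xy0.
  by move=> r /(pencil_cover y2x rp)[]; [right|left].
have /(invertible_outer fieldK) ih := ny2x.
case: (ih) => h' [hh' h'h].
have ih' : invertible h' by exists (1 - x' *m y2).
have := rep_unit rp ih'; rewrite h'h mx_mulE mulmxA => rp'.
have h'x := invertible_col_neq0 ih' x'0.
have [y1 y1x] := col_dual fieldK h'x.
have [q rq] := point_exists (dual_point_unimodular y0 y1x).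
exists q; split; first exact: neq_zero rq (outer_neq0 fieldK h'x y0).
move=> r /(pencil_cover y1x rq); rewrite -(rep_inj rp' (rep_aff _)).
by case; [left|right].
Qed.

Definition shift a : GL2 R := MkGL2 (invertible2_shear (- a)).

Lemma rep_shift a p c d : rep p c d -> rep (GL2_map (shift a) p) (c - d * a) d.
Proof.
move=> rp; have := rep_GL2_map (erefl (shift a : 'M_2)) rp.
by rewrite !mulr1 mulr0 add0r mulrN.
Qed.

Lemma shift_aff a b : GL2_map (shift a) (aff b) = aff (b - a).
Proof.
apply: (rep_inj (rep_shift a (rep_aff b))); rewrite mul1r; exact: rep_aff.
Qed.

Lemma shift_inf a : GL2_map (shift a) (inf R) = inf R.
Proof.
apply: (rep_inj (rep_shift a (rep_inf R))); rewrite mul0r subr0; exact: rep_inf.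
Qed.

Lemma adjacent_aff p c d b : rep p c d -> (adjacent p (aff b) <-> rank1 (c - d * b)).
Proof.
move=> rp; rewrite (adjacent_iso (GL2_map_distant_iso (shift b))) shift_aff subrr.
exact: adjacent_zero (rep_shift b rp).
Qed.

Lemma adjacent_aff_aff a b : adjacent (aff a) (aff b) <-> rank1 (a - b).
Proof. by rewrite (adjacent_aff _ (rep_aff a)) mul1r. Qed.

End Adjacency.

(** * Parallelograms in the affine chart *)

Section Parallelogram.
Variable K : unitRingType.
Hypothesis fieldK : GRing.field_axiom K.
Variable n : nat.
Local Notation R := 'M[K]_n.
Local Notation PR := (proj_line R).
Implicit Types (a b c d e t u : R) (x z k s : 'cV[K]_n) (y w v : 'rV[K]_n) (p q r : PR).
Local Notation zero := (aff (0 : R)).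

Lemma adjacent_nondistant_form p : ~ distant p (inf R) -> adjacent p zero ->
  exists x y y1, [/\ y <> 0, y1 *m x = 1%:M & rep p (x *m y) (1 - x *m y1)].
Proof.
have [a [b rp]] := rep_exists p => np /(adjacent_zero fieldK rp)[x [y [x0 y0 aE]]].
rewrite aE in rp; have [u [y2 [_ rp']]] := rep_outer_normal fieldK rp.
exists (u *m x), y, y2; split=> //; apply: contrapT => ne; apply: np.
by apply/(distant_inf rp')/(invertible_outer fieldK).
Qed.

(** R(xy, 1 - xy1) depends only on x and y up to scalars: replacing y1 by another row that takes the
    value 1 on x only changes the generator by a unit. *)
Lemma dual_point_eq p q x y y1 y2 l l' : y1 *m x = 1%:M -> y <> 0 ->
  rep p (x *m y : R) (1 - x *m y1) ->
  y2 *m (x *m l) = 1%:M -> l' *m y <> 0 ->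
  rep q (x *m l *m (l' *m y) : R) (1 - x *m l *m y2) -> p = q.
Proof.
move=> y1x y0 rp y2x ly0 rq.
have y3x : l *m y2 *m x = 1%:M.
  have [l1 [ll l1l]] : exists l1, l *m l1 = 1%:M /\ l1 *m l = 1%:M.
    apply: (mx11_inv fieldK) => l0; apply: (@mx11_neq0 K).
    by rewrite -y2x l0 !mulmx0.
  rewrite -mulmxA; have -> : y2 *m x = l1 by rewrite -[LHS]mulmx1 -ll mulmxA -(mulmxA y2) y2x mul1mx.
  by [].
have [g [lg gl]] : exists g, (l *m l') *m g = 1%:M /\ g *m (l *m l') = 1%:M.
  apply: (mx11_inv fieldK) => ll0.
  have : l <> 0 by move=> l0; apply: (@mx11_neq0 K); rewrite -y2x l0 !mulmx0.
  move=> /(mx11_inv fieldK)[l1 [_ l1l]]; apply: ly0.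
  by rewrite -[l']mul1mx -l1l -(mulmxA l1) ll0 mulmx0 mul0mx.
move: (l *m y2) y3x (l *m l') lg gl (mulmxA (x *m l) l' y) (mulmxA x l y2) (mulmxA x l l').
move=> y3 y3x h hg gh E1 E2 E3; rewrite E1 -E3 -E2 in rq.
(* This u sends x to xh and 1 - xy1 to 1 - xy3. Its inverse arises by exchanging y1 with y3 and
   inverting h. *)
pose u : R := (1 - x *m y3) + x *m h *m y1.
have key (ya yb : 'rV_n) (m m' : 'M_1) : ya *m x = 1%:M -> yb *m x = 1%:M ->
    m *m m' = 1%:M ->
    ((1 - x *m yb) + x *m m *m ya : R) * ((1 - x *m ya) + x *m m' *m yb) = 1.
  move=> yax ybx mm.
  have za : ya *m (1 - x *m ya) = 0 by rewrite mulmxBr mulmxA yax mul1mx mulmx1 subrr.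
  have zx : (1 - x *m yb) *m x = 0 by rewrite mulmxBl -mulmxA ybx mul1mx mulmx1 subrr.
  have ab : (1 - x *m yb) * (1 - x *m ya) = 1 - x *m yb.
    by rewrite mulrBr mulr1 mx_mulE mulmxA zx mul0mx subr0.
  move: (1 - x *m ya) (1 - x *m yb) za zx ab (subrK (x *m yb) 1) => A B za zx ab <-.
  rewrite mulrDl !mulrDr ab !mx_mulE -(mulmxA (x *m m)) za mulmx0 add0r.
  rewrite !mulmxA zx !mul0mx addr0 -(mulmxA _ ya x) yax mulmx1 -(mulmxA x m) mm mulmx1.
  by [].
have iu : invertible u.
  by exists ((1 - x *m y1) + x *m g *m y3); split; apply: key.
apply: (rep_inj (rep_unit rp iu)).
have -> : u * (x *m y) = x *m h *m y.
  rewrite /u mx_mulE mulmxDl mulmxBl mul1mx !mulmxA -(mulmxA x y3) y3x mulmx1 subrr add0r.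
  by rewrite -(mulmxA _ y1) y1x mulmx1.
have -> : u * (1 - x *m y1) = 1 - x *m y3.
  rewrite /u mulrBr mulr1 mx_mulE mulmxDl mulmxBl mul1mx !mulmxA -(mulmxA x y3) y3x mulmx1.
  by rewrite subrr add0r -(mulmxA _ y1 x) y1x mulmx1 addrK.
exact: rq.
Qed.

(* Geometrically, [b] and [c] lie in the star and in the top through [0] that meet
   in the pencil of [p]. The neighbours of [b] and [c] nondistant from infinity
   only determine [d] up to the term [x *m l *m y]; a second such neighbour is
   needed to get rid of it. *)
Definition split_by (p : PR) (x : 'cV[K]_n) (y : 'rV[K]_n) (b c d : R) : Prop :=
  exists y1 w z l, [/\ y1 *m x = 1%:M, y <> 0, rep p (x *m y) (1 - x *m y1) &
    [/\ b = x *m w, c = z *m y & d = b + c + x *m l *m y]].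

Lemma nondistant_neighbour_shape p x y y1 z w : y <> 0 -> y1 *m x = 1%:M ->
  rep p (x *m y : R) (1 - x *m y1) -> adjacent p (aff (z *m w : R)) ->
  (exists l, z = x *m l) \/ (exists l, w = l *m y).
Proof.
move=> y0 y1x rp /(adjacent_aff fieldK _ rp)[s [t [_ _ E]]].
have x0 : x <> 0 by move=> x0; apply: (@mx11_neq0 K); rewrite -y1x x0 mulmx0.
have : x *m y - ((1 - x *m y1) *m z) *m w = s *m t by rewrite -E mx_mulE !mulmxA.
move=> /(outer_sub fieldK x0 y0)[[l zE]|]; last by right.
left; exists (y1 *m z).
(* The projection 1 - xy1 has its image in the kernel of y1, so a projected column proportional to x
   must vanish, and z = x (y1 z). *)
have : y1 *m ((1 - x *m y1) *m z) = 0.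
  by rewrite mulmxA mulmxBr mulmxA y1x mul1mx mulmx1 subrr mul0mx.
rewrite zE mulmxA y1x mul1mx => l0; move: zE; rewrite l0 mulmx0.
by rewrite mulmxBl mul1mx -mulmxA => /subr0_eq.
Qed.

Lemma nondistant_neighbour_form p x y y1 d : y <> 0 -> y1 *m x = 1%:M ->
  rep p (x *m y : R) (1 - x *m y1) -> adjacent p (aff d) ->
  exists w z, d = x *m w + z *m y.
Proof.
move=> y0 y1x rp /(adjacent_aff fieldK _ rp)[s [t [_ _ E]]].
(* Since y1 kills 1 - xy1, multiplying the adjacency equation by y1 isolates y and shows that t is
   proportional to it. *)
have yE : y = (y1 *m s) *m t.
  rewrite -mulmxA -E mx_mulE mulmxBr !mulmxA y1x mul1mx mulmxBr mulmxA y1x mul1mx mulmx1.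
  by rewrite subrr mul0mx subr0.
have [l tE] := row_scale_sym fieldK y0 yE.
exists (y1 *m d), (x - s *m l); rewrite mulmxBl -mulmxA -tE -E mx_mulE.
by rewrite opprB [x *m y + _]addrC subrK mulmxBl mul1mx mulmxA addrC subrK.
Qed.

(** Two applications of [outer_sub]: the rank one condition on d - xw adjusts w' to w up to a
    multiple of y, the one on d - zy adjusts z' to z up to a multiple of x. Every other outcome
    would make d itself an outer product. *)
Lemma split_form x y w z d : x <> 0 -> y <> 0 -> w <> 0 ->
  ~ outer d -> rank1 (d - x *m w) -> rank1 (d - z *m y) ->
  (exists w' z', d = x *m w' + z' *m y) ->
  exists l, d = x *m w + z *m y + x *m l *m y.
Proof.
move=> x0 y0 w0 nd db dc [w' [z' dE]].
have [m w'E] : exists m, w' = w + m *m y.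
  have [e|ne] := pselect (w' - w = 0).
    by exists 0; rewrite mul0mx addr0; apply: subr0_eq.
  have [s [t]] := rank1_outer db.
  have -> : d - x *m w = x *m (w' - w) - (- z') *m y.
    by rewrite dE mulmxBr mulNmx opprK addrAC.
  move=> /(outer_sub fieldK x0 ne)[[l z'E]|[l yE]].
    case: nd; exists x, (w' - l *m y).
    by rewrite dE mulmxBr -[z']opprK z'E mulmxA mulNmx.
  have [l' E] := row_scale_sym fieldK y0 yE.
  by exists l'; rewrite -E addrC subrK.
have [z'' dE'] : exists z'', d = x *m w + z'' *m y.
  by exists (x *m m + z'); rewrite dE w'E mulmxDr mulmxDl !mulmxA addrA.
have [s [t]] := rank1_outer dc.
have -> : d - z *m y = x *m w - (- (z'' - z)) *m y.
  by rewrite dE' mulNmx opprK mulmxBl addrA.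
move=> /(outer_sub fieldK x0 w0)[[l E]|[l yE]].
  exists (- l); rewrite mulmxN -E opprK mulmxBl.
  by rewrite addrACA subrr addr0 dE'.
have [l' wE] := row_scale_sym fieldK y0 yE.
case: nd; exists (x *m l' + z''), y.
by rewrite dE' wE mulmxDl mulmxA.
Qed.

(** Each of b and c has column proportional to x or row proportional to y. They cannot be of the
    same kind, since b - c would then be an outer product. *)
Lemma linked_split p b c d : linked (inf R) zero (aff b) (aff c) (aff d) p ->
  rank1 b -> rank1 c -> ~ outer d -> ~ outer (b - c) ->
  rank1 (d - b) -> rank1 (d - c) ->
  exists x y, split_by p x y b c d \/ split_by p x y c b d.
Proof.
move=> [np [p0 pb pc pd]] [z [w [z0 w0 bE]]] [z' [w' [z'0 w'0 cE]]] nd nbc db dc.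
have [x [y [y1 [y0 y1x rp]]]] := adjacent_nondistant_form np p0.
have x0 : x <> 0 by move=> x0; apply: (@mx11_neq0 K); rewrite -y1x x0 mulmx0.
exists x, y; have dE := nondistant_neighbour_form y0 y1x rp pd.
rewrite bE in pb; rewrite cE in pc.
have [[l zE]|[l wE]] := nondistant_neighbour_shape y0 y1x rp pb;
have [[l' z'E]|[l' w'E]] := nondistant_neighbour_shape y0 y1x rp pc.
- case: nbc; exists x, (l *m w - l' *m w').
  by rewrite bE cE zE z'E mulmxBr !mulmxA.
- have bE' : b = x *m (l *m w) by rewrite bE zE mulmxA.
  have cE' : c = (z' *m l') *m y by rewrite cE w'E mulmxA.
  left; rewrite bE' in db; rewrite cE' in dc.
  have [|m mE] := split_form x0 y0 _ nd db dc dE.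
    by move=> lw; apply: (outer_neq0 fieldK z0 w0); rewrite -bE bE' lw mulmx0.
  by exists y1, (l *m w), (z' *m l'), m; split=> //; rewrite bE' cE'.
- have bE' : b = (z *m l) *m y by rewrite bE wE mulmxA.
  have cE' : c = x *m (l' *m w') by rewrite cE z'E mulmxA.
  right; rewrite bE' in db; rewrite cE' in dc.
  have [|m mE] := split_form x0 y0 _ nd dc db dE.
    by move=> lw; apply: (outer_neq0 fieldK z'0 w'0); rewrite -cE cE' lw mulmx0.
  by exists y1, (l' *m w'), (z *m l), m; split=> //; rewrite bE' cE'.
- case: nbc; exists (z *m l - z' *m l'), y.
  by rewrite bE cE wE w'E mulmxBl !mulmxA.
Qed.

(** If b and c played the same roles for p and q, then x, y would be proportional to x', y', and p =
    q. If the roles are exchanged, the correction term x l y also has the form z(..)w; were it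
    nonzero, z would be proportional to x and b - c an outer product. *)
Lemma split_sum p q x y x' y' b c d : rank1 b -> rank1 c -> ~ outer (b - c) ->
  p <> q -> split_by p x y b c d -> split_by q x' y' b c d \/ split_by q x' y' c b d ->
  d = b + c.
Proof.
move=> [bx [by_ [bx0 by0 bE]]] [cx [cy [cx0 cy0 cE]]] nbc pq.
move=> [y1 [w [z [l [y1x y0 rp [bw cz dE]]]]]].
have b0 : b <> 0 by rewrite bE; exact: outer_neq0.
have c0 : c <> 0 by rewrite cE; exact: outer_neq0.
have nz (x1 : 'cV_n) (w1 : 'rV_n) : x1 *m w1 <> 0 -> x1 <> 0 /\ w1 <> 0.
  by move=> h; split=> e; apply: h; rewrite e ?mul0mx ?mulmx0.
have [x0 w0] : x <> 0 /\ w <> 0 by apply: nz; rewrite -bw.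
have [z0 _] : z <> 0 /\ y <> 0 by apply: nz; rewrite -cz.
case=> [[y1' [w' [z' [l' [y1x' y'0 rq [bw' cz' dE']]]]]]|].
  case: pq; have [[m x'E] _] := outer_eq fieldK x0 w0 (etrans (esym bw) bw').
  have [_ [m' y'E]] := outer_eq fieldK z0 y0 (etrans (esym cz) cz').
  rewrite x'E y'E in rq; apply: (dual_point_eq y1x y0 rp _ _ rq); first by rewrite -x'E.
  by rewrite -y'E.
move=> [y1' [w' [z' [l' [y1x' y'0 rq [cw' bz' dE']]]]]].
have [[m x'E] _] := outer_eq fieldK z0 y0 (etrans (esym cz) cw').
have [_ [m' y'E]] := outer_eq fieldK x0 w0 (etrans (esym bw) bz').
have E : x *m (l *m y) = z *m ((m *m l' *m m') *m w).
  have := dE'; rewrite dE x'E y'E [c + b]addrC => /addrI.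
  by rewrite !mulmxA.
have [e|ne] := pselect (l *m y = 0); first by rewrite dE -mulmxA e mulmx0 addr0.
have [[k zE] _] := outer_eq fieldK x0 ne E.
case: nbc; exists x, (w - k *m y).
by rewrite mulmxBr mulmxA -zE -bw -cz.
Qed.

Lemma parallelogram_zero b c d :
  parallelogram (inf R) zero (aff b) (aff c) (aff d) -> d = b + c.
Proof.
move=> [[nbc bc] [nd d0] [b0 c0] [db dc] [p [q [pq lp lq]]]].
have nouter (e1 e2 : R) : ~ adjacent (aff e1) (aff e2) -> aff e1 <> aff e2 -> ~ outer (e1 - e2).
  move=> na ne oe; apply: na; apply/(adjacent_aff_aff fieldK)/outer_rank1 => //.
  by move=> /subr0_eq e; apply: ne; rewrite e.
have {}nbc := nouter _ _ nbc bc; have {}nd := nouter _ _ nd d0.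
rewrite subr0 in nd.
move: b0 c0 db dc; rewrite !(adjacent_aff_aff fieldK) !subr0 => b0 c0 db dc.
have ncb : ~ outer (c - b).
  move=> [s [t e]]; apply: nbc; exists (- s), t.
  by rewrite mulNmx -e opprB.
have [x [y sp]] := linked_split lp b0 c0 nd nbc db dc.
have [x' [y' sq]] := linked_split lq b0 c0 nd nbc db dc.
case: sp => sp; first exact: split_sum nbc pq sp sq.
rewrite addrC; apply: (split_sum (x' := x') (y' := y') c0 b0 ncb pq sp).
by case: sq; [right|left].
Qed.

Lemma parallelogram_sum a b c d :
  parallelogram (inf R) (aff a) (aff b) (aff c) (aff d) -> a + d = b + c.
Proof.
move=> /(parallelogram_iso (GL2_map_distant_iso (shift a))).
rewrite shift_inf !shift_aff subrr => /parallelogram_zero /(canRL (subrK _)) ->.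
by rewrite -[X in _ + X]addrA subrK addrA [_ + (b - _)]addrC subrK.
Qed.

(** The point R(xy, 1 - xy1) works because 1 - xy1 kills xw, so xw disappears from all adjacency
    conditions; xy - (1 - xy1)zy is nonzero because y1 maps it to y. *)
Lemma linked_outer x y z w : y <> 0 -> x <> 0 -> w <> 0 -> (forall l, z <> x *m l) ->
  exists u : PR, [/\ linked (inf R) zero (aff (x *m w)) (aff (z *m y)) (aff (x *m w + z *m y)) u &
    exists b, rep u (x *m y) b].
Proof.
move=> y0 x0 w0 zx; have [y1 y1x] := col_dual fieldK x0.
have [u ru] := point_exists (dual_point_unimodular fieldK y0 y1x).
exists u; split; last by exists (1 - x *m y1).
have y10 : y1 <> 0 by move=> e; apply: (@mx11_neq0 K); rewrite -y1x e mul0mx.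
have kx : (1 - x *m y1) *m (x *m w) = 0.
  by rewrite mulmxA mulmxBl mul1mx -(mulmxA x) y1x mulmx1 subrr mul0mx.
split; first by move=> /(distant_inf ru)/(invertible_outer fieldK).
have xz : rank1 (x *m y - (1 - x *m y1) * (z *m y)).
  rewrite mx_mulE mulmxA -mulmxBl.
  exists (x - (1 - x *m y1) *m z), y; split=> //.
  move=> /(congr1 (mulmx y1)); rewrite mulmx0 mulmxBr y1x mulmxA mulmxBr mulmxA y1x.
  by rewrite mul1mx mulmx1 subrr mul0mx subr0 => /mx11_neq0.
split; apply/(adjacent_aff fieldK _ ru).
- by rewrite mulr0 subr0; exists x, y.
- by rewrite mx_mulE kx subr0; exists x, y.
- by [].
- by rewrite mulrDr mx_mulE kx add0r.
Qed.

Lemma parallelogram_outer a x y z w : x <> 0 -> y <> 0 ->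
  (forall l, z <> x *m l) -> (forall l, w <> l *m y) ->
  parallelogram (inf R) (aff a) (aff (a + x *m w)) (aff (a + z *m y))
    (aff (a + (x *m w + z *m y))).
Proof.
move=> x0 y0 zx wy.
have z0 : z <> 0 by have := zx 0; rewrite mulmx0.
have w0 : w <> 0 by have := wy 0; rewrite mul0mx.
have xw : x *m w <> 0 by exact: outer_neq0.
have zy : z *m y <> 0 by exact: outer_neq0.
have nsub (s : 'cV_n) (t : 'rV_n) (e : 'cV_n) : (forall l, e <> x *m l) ->
    x *m w - e *m y = s *m t -> False.
  by move=> ex /(outer_sub fieldK x0 w0)[[l]|[l] /(row_scale_sym fieldK y0)[l']] => [/ex|/wy].
have zx' l : - z <> x *m l by move=> /(canRL opprK); rewrite -mulmxN => /zx.
suff : parallelogram (inf R) zero (aff (x *m w)) (aff (z *m y)) (aff (x *m w + z *m y)).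
  move=> /(parallelogram_iso (GL2_map_distant_iso (shift (- a)))).
  by rewrite shift_inf !shift_aff !opprK add0r ![_ + a]addrC.
have nb : ~ outer (x *m w - z *m y).
  by move=> [s [t]]; apply: nsub.
have nd : ~ outer (x *m w + z *m y).
  by move=> [s [t e]]; apply: (nsub s t (- z)) => //; rewrite mulNmx opprK.
have nouter (e1 e2 : R) : ~ outer (e1 - e2) -> ~ adjacent (aff e1) (aff e2) /\ aff e1 <> aff e2.
  move=> no; split; first by move=> /(adjacent_aff_aff fieldK)/rank1_outer.
  by move=> /aff_inj e; apply: no; exists 0, 0; rewrite e subrr mul0mx.
split.
- exact: nouter.
- by apply: nouter; rewrite subr0.
- by split; apply/(adjacent_aff_aff fieldK); rewrite subr0; [exists x, w|exists z, y].
- split; apply/(adjacent_aff_aff fieldK).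
    by rewrite addrAC subrr add0r; exists z, y.
  by rewrite addrK; exists x, w.
(* The two linked points are those built from (x,y) and from (z,w). They differ because y and w are
   not proportional. *)
have [u [lu [b ru]]] := linked_outer y0 x0 w0 zx.
have [|v [lv [b' rv]]] := linked_outer w0 z0 y0 (z := x).
  by move=> l /(col_scale_sym fieldK x0)[l' /zx].
exists u, v; split=> //.
  move=> uv; rewrite uv in ru; have [h ih [e _]] := rep_scale ru rv.
  have [_ [l yE]] : (exists l, h *m x = z *m l) /\ (exists l, y = l *m w).
    by apply: (outer_eq fieldK z0 w0); rewrite e mx_mulE mulmxA.
  by have [l' /wy] := row_scale_sym fieldK y0 yE.
move: lv; rewrite [z *m y + _]addrC => -[? [? ? ? ?]]; by split.
Qed.

End Parallelogram.

(** * Additivity of the chart map *)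

Section OuterProducts.
Variable K : unitRingType.
Hypothesis fieldK : GRing.field_axiom K.
Variable n : nat.
Local Notation R := 'M[K]_n.
Implicit Types (a b c d : R) (x z : 'cV[K]_n) (y w v : 'rV[K]_n).

Lemma outer_ind (P : R -> Prop) : P 0 -> (forall a b, P a -> P b -> P (a + b)) ->
  (forall x y, P (x *m y)) -> forall a, P a.
Proof.
move=> P0 PD Pxy a.
have -> : a = \sum_j col j a *m delta_mx (ord0 : 'I_1) j.
  apply/matrixP => i j; rewrite summxE (bigD1 j) //= big1 ?addr0.
    by rewrite !mxE big_ord1 !mxE !eqxx mulr1.
  by move=> k kj; rewrite !mxE big_ord1 !mxE eqxx eq_sym (negbTE kj) mulr0.
by elim/big_ind: _.
Qed.

Hypothesis n_gt1 : (1 < n)%N.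

(** With n > 1 there are two basis rows, which cannot both be multiples of y. *)
Lemma row_independent y : exists w, forall l, w <> l *m y.
Proof.
apply: contrapT => /forallNP H.
have {}H w : exists l, w = l *m y.
  by apply: contrapT => /forallNP h; apply: (H w).
pose i0 := Ordinal (ltnW n_gt1); pose i1 := Ordinal n_gt1.
have [l0 e0] := H (delta_mx ord0 i0); have [l1 e1] := H (delta_mx ord0 i1).
have [|l yE] := row_scale_sym fieldK _ e0.
  by move=> /matrixP/(_ ord0 i0); rewrite !mxE !eqxx => /eqP; rewrite oner_eq0.
move: e1; rewrite yE mulmxA => /matrixP/(_ ord0 i1).
by rewrite !mxE !big_ord1 !mxE !eqxx mulr0 => /eqP; rewrite oner_eq0.
Qed.

Lemma col_independent x : exists z, forall l, z <> x *m l.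
Proof.
apply: contrapT => /forallNP H.
have {}H z : exists l, z = x *m l.
  by apply: contrapT => /forallNP h; apply: (H z).
pose i0 := Ordinal (ltnW n_gt1); pose i1 := Ordinal n_gt1.
have [l0 e0] := H (delta_mx i0 ord0); have [l1 e1] := H (delta_mx i1 ord0).
have [|l xE] := col_scale_sym fieldK _ e0.
  by move=> /matrixP/(_ i0 ord0); rewrite !mxE !eqxx => /eqP; rewrite oner_eq0.
move: e1; rewrite xE -mulmxA => /matrixP/(_ i1 ord0).
by rewrite !mxE !big_ord1 !mxE !eqxx mul0r => /eqP; rewrite oner_eq0.
Qed.

Section Multiplicative.
Variables (S : pzRingType) (f : R -> S).
Hypothesis fD : forall a b, f (a + b) = f a + f b.
Hypothesis f_idem : forall x y, y *m x = 1%:M -> f (x *m y) * f (x *m y) = f (x *m y).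
Hypothesis f_right : forall x y r, exists s, f (x *m y * r) = f (x *m y) * s.
Hypothesis f_orth : forall x z v, v *m x = 1%:M -> v *m z = 0 ->
  f (x *m v) * f (z *m v) = 0.

Lemma additive0 : f 0 = 0.
Proof. by apply: (addrI (f 0)); rewrite -fD !addr0. Qed.

Lemma additiveN a : f (- a) = - f a.
Proof. by apply/eqP; rewrite -addr_eq0 -fD addNr additive0. Qed.

(** Peirce decomposition for e = uv: the part (1 - e)r is a sum of terms ((1 - e)x v)(u y), which
    f(e) annihilates by [f_orth]; on e r the factor f(e) acts as the identity. *)
Lemma mul_idempotent u v r : v *m u = 1%:M -> f (u *m v * r) = f (u *m v) * f r.
Proof.
move=> vu.
have kill s : f (u *m v) * f ((1 - u *m v) * s) = 0.
  elim/outer_ind: s => [|a b Ha Hb|x y]; first by rewrite mulr0 additive0 mulr0.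
    by rewrite mulrDr fD mulrDr Ha Hb addr0.
  have -> : (1 - u *m v) * (x *m y) = ((1 - u *m v) *m x) *m v * (u *m y).
    by rewrite !mx_mulE !mulmxA -(mulmxA _ v u) vu mulmx1.
  have [s ->] := f_right ((1 - u *m v) *m x) v (u *m y).
  rewrite mulrA f_orth ?mul0r // mulmxA mulmxBr mulmxA vu mul1mx mulmx1.
  by rewrite subrr mul0mx.
have [s sE] := f_right u v r.
have -> : f r = f (u *m v * r) + f ((1 - u *m v) * r).
  by rewrite -fD -mulrDl addrC subrK mul1r.
by rewrite mulrDr kill addr0 sE mulrA f_idem.
Qed.

(** The elements c with f(cd) = f(c)f(d) for all d form a subring. It contains the rank one
    idempotents, hence every xy with yx = 0, as the difference of x(y + v) and xv. The target is an
    arbitrary ring so that the opposite ring can be used as well. *)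
Lemma additive_multiplicative a b : f (a * b) = f a * f b.
Proof.
pose M c := forall d, f (c * d) = f c * f d.
have M0 : M 0 by move=> d; rewrite mul0r additive0 mul0r.
have MD c c' : M c -> M c' -> M (c + c').
  by move=> hc hc' d; rewrite mulrDl !fD hc hc' mulrDl.
have MN c : M c -> M (- c) by move=> hc d; rewrite mulNr !additiveN hc mulNr.
have MM c c' : M c -> M c' -> M (c * c').
  by move=> hc hc' d; rewrite -mulrA !hc hc' mulrA.
have Mnil x y : y *m x = 0 -> M (x *m y).
  have [->|x0] := pselect (x = 0); first by rewrite mul0mx.
  move=> yx; have [v vx] := col_dual fieldK x0.
  have -> : x *m y = x *m (y + v) - x *m v by rewrite mulmxDr addrK.
  apply: MD; last by apply: MN => d; apply: mul_idempotent.
  by move=> d; apply: mul_idempotent; rewrite mulmxDl yx add0r.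
suff : forall c, M c by apply.
apply: outer_ind => // x y.
have [/Mnil//|/(mx11_inv fieldK)[l [yxl lyx]]] := pselect (y *m x = 0).
(* If yx is nonzero, xy is the product of the square-zero elements xw and zy, where wx = 0, yz = 0
   and wz = 1. *)
have [w0 w0y] := row_independent y.
pose w := w0 - w0 *m x *m l *m y.
have wx : w *m x = 0 by rewrite mulmxBl -(mulmxA (w0 *m x *m l)) -(mulmxA (w0 *m x)) lyx mulmx1 subrr.
have wy l' : w <> l' *m y.
  move=> e; apply: (w0y (l' + w0 *m x *m l)).
  by rewrite mulmxDl -e subrK.
have [z [yz wz]] := row_dual2 fieldK wy.
have -> : x *m y = (x *m w) * (z *m y).
  by rewrite mx_mulE mulmxA -(mulmxA x) wz mulmx1.
by apply: MM; apply: Mnil.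
Qed.

End Multiplicative.

(* For n > 1 the units generate the additive group of a matrix ring. *)
Lemma additive_eq_on_units (S : zmodType) (f g : R -> S) :
  (forall a b, f (a + b) = f a + f b) -> (forall a b, g (a + b) = g a + g b) ->
  (forall u, invertible u -> f u = g u) -> f =1 g.
Proof.
move=> fD gD fg.
have sub a b : f a = g a -> f (a + b) = g (a + b) -> f b = g b.
  by move=> e; rewrite fD gD e => /addrI.
have small x y : y *m x <> - 1%:M -> f (x *m y) = g (x *m y).
  move=> yx; apply: (sub 1); first by apply: fg; apply: invertible1.
  apply: fg; have -> : 1 + x *m y = 1 - (- x) *m y by rewrite mulNmx opprK.
  apply/(invertible_outer fieldK); rewrite mulmxN => /(canRL opprK); exact: yx.
have zero (h : R -> S) : (forall a b, h (a + b) = h a + h b) -> h 0 = 0.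
  by move=> hD; apply: (addrI (h 0)); rewrite -hD !addr0.
apply: outer_ind => [|a b Ha Hb|x y]; first by rewrite !zero.
  by rewrite fD gD Ha Hb.
have [yx|/small//] := pselect (y *m x = - 1%:M).
(* Now 1 + xy is singular, so 1 is replaced by another unit u = 1 + zw, with wz = 0, wx = 1 and yz =
   1. Then u + xy = u(1 + (x - z)y), and the second factor is invertible because 1 + 1 differs from
   1. *)
have [k kx] := col_independent x.
pose z0 := k + x *m (y *m k).
have yz0 : y *m z0 = 0 by rewrite mulmxDr !mulmxA yx mulNmx mul1mx mulNmx addrN.
have z0x l : z0 <> x *m l.
  move=> e; apply: (kx (l - y *m k)).
  by rewrite mulmxBr -e addrK.
have [w [wxz wx]] : exists w, w *m (x - z0) = 0 /\ w *m x = 1%:M.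
  apply: (col_dual2 fieldK) => l e.
  have l1 : l = 1%:M.
    have := congr1 (mulmx y) e; rewrite mulmxA mulmxBr yz0 subr0 yx mulNmx mul1mx.
    by move=> /oppr_inj.
  move: e; rewrite l1 mulmx1 => e; apply: (z0x 0); rewrite mulmx0.
  by rewrite -(subKr x z0) -e subrr.
pose z := z0 - x.
have wz : w *m z = 0 by rewrite /z -opprB mulmxN wxz oppr0.
have yz : y *m z = 1%:M by rewrite /z mulmxBr yz0 yx sub0r opprK.
pose u : R := 1 + z *m w.
have iu : invertible u.
  have -> : u = 1 - (- z) *m w by rewrite mulNmx opprK.
  apply/(invertible_outer fieldK); rewrite mulmxN wz oppr0 => /esym; exact: mx11_neq0.
apply: (sub u); first exact: fg.
apply: fg.
have -> : u + x *m y = u * (1 - (- (x - z)) *m y).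
  rewrite mulNmx opprK mulrDr mulr1 mx_mulE mulmxDl mul1mx; congr (_ + _).
  rewrite mulmxA -(mulmxA z) mulmxBr wz wx subr0 mulmx1 -mulmxDl.
  by rewrite subrK.
apply: invertibleM => //; apply/(invertible_outer fieldK).
rewrite mulmxN mulmxBr yx yz opprB opprK => /(canRL (addrK _)).
by rewrite subrr => /mx11_neq0.
Qed.

End OuterProducts.

Section Charts.
Variables (R S : pzRingType) (phi : proj_line R -> proj_line S).
Hypothesis phi_iso : distant_iso phi.
Hypothesis phi_inf : phi (inf R) = inf S.

Lemma chart_map : exists f : R -> S, forall a, phi (aff a) = aff (f a).
Proof.
suff /choice[f fE] : forall a, exists b, phi (aff a) = aff b by exists f.
move=> a; apply/distant_infP; rewrite -phi_inf -(proj2 phi_iso).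
by apply/distant_infP; exists a.
Qed.

Lemma chart_bij (f : R -> S) : (forall a, phi (aff a) = aff (f a)) -> bijective f.
Proof.
move=> fE; case: (phi_iso) => phi_bij phiD; apply: bij_of_inj_surj => [a b e|b].
  by apply/aff_inj/(bij_inj phi_bij); rewrite !fE e.
have [p pE] := bij_surj phi_bij (aff b).
have /distant_infP[a aE] : distant p (inf R).
  by rewrite phiD phi_inf pE; apply/distant_infP; exists b.
by exists a; apply/aff_inj; rewrite -fE -aE.
Qed.

Lemma chart_invertible (f : R -> S) : (forall a, phi (aff a) = aff (f a)) ->
  forall a b, invertible (a - b) <-> invertible (f a - f b).
Proof.
move=> fE a b.
have <- : distant (aff a) (aff b) <-> invertible (a - b).
  by rewrite (distant_aff _ (rep_aff a)) mul1r.
by rewrite (proj2 phi_iso) !fE (distant_aff _ (rep_aff _)) mul1r.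
Qed.

End Charts.

Section MatrixCharts.
Variables (K K' : unitRingType).
Hypotheses (fieldK : GRing.field_axiom K) (fieldK' : GRing.field_axiom K').
Variables (n n' : nat).
Hypothesis n_gt1 : (1 < n)%N.
Local Notation R := 'M[K]_n.
Local Notation S := 'M[K']_n'.
Implicit Types (a b c d : R) (x z : 'cV[K]_n) (y w v : 'rV[K]_n).

(* It suffices to treat sums of two outer products, and those in general position
   are diagonals of parallelograms. *)
Lemma chart_additive (phi : proj_line R -> proj_line S) (f : R -> S) :
  distant_iso phi -> phi (inf R) = inf S -> (forall a, phi (aff a) = aff (f a)) ->
  f 0 = 0 -> forall a b, f (a + b) = f a + f b.
Proof.
move=> phi_iso phi_inf fE f0.
(* The mixed second difference of f in the directions b and c vanishes at every base point a.
   Quantifying over a makes this condition additive in b and in c. *)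
pose T (b c : R) := forall a, f a + f (a + (b + c)) = f (a + b) + f (a + c).
have Tsym b c : T b c -> T c b.
  by move=> h a; rewrite [c + b]addrC h addrC.
have T0 b : T b 0 by move=> a; rewrite !addr0 addrC.
have TD b c1 c2 : T b c1 -> T b c2 -> T b (c1 + c2).
  move=> h1 h2 a; apply: (addrI (f (a + c1))); rewrite addrCA.
  have -> : a + (b + (c1 + c2)) = a + c1 + (b + c2) by rewrite -[a + c1 + _]addrA [c1 + (b + c2)]addrCA.
  have e : a + c1 + b = a + (b + c1) by rewrite -addrA [c1 + b]addrC.
  by rewrite h2 e addrA h1 -addrA addrCA [a + (c1 + c2)]addrA.
have gen x y z w : x <> 0 -> y <> 0 -> (forall l, z <> x *m l) -> (forall l, w <> l *m y) ->
    T (x *m w) (z *m y).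
  move=> x0 y0 zx wy a.
  have := parallelogram_outer fieldK a x0 y0 zx wy.
  move=> /(parallelogram_iso phi_iso).
  by rewrite phi_inf !fE => /(parallelogram_sum fieldK').
have gen1 x y z w : x <> 0 -> y <> 0 -> (forall l, w <> l *m y) -> T (x *m w) (z *m y).
  move=> x0 y0 wy; have [zx|/existsNP[l /contrapT zE]] := pselect (forall l, z <> x *m l).
    exact: gen.
  (* A column proportional to x is split into two columns that are not, and additivity of [T]
     applies; below, rows proportional to y are split likewise. *)
  have [z0 z0x] := col_independent fieldK n_gt1 x.
  have -> : z *m y = (z + z0) *m y + (- z0) *m y by rewrite -mulmxDl addrK.
  apply: TD; apply: gen => // l'.
    by rewrite zE => /(canRL (addKr _)); rewrite addrC -mulmxBr => /z0x.
  by move=> /(canRL opprK); rewrite -mulmxN => /z0x.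
have gen2 x y z w : T (x *m w) (z *m y).
  have [->|x0] := pselect (x = 0); first by rewrite mul0mx; apply: Tsym.
  have [->|y0] := pselect (y = 0); first by rewrite mulmx0.
  have [wy|/existsNP[l /contrapT wE]] := pselect (forall l, w <> l *m y).
    exact: gen1.
  have [w0 w0y] := row_independent fieldK n_gt1 y.
  have -> : x *m w = x *m (w + w0) + x *m (- w0) by rewrite -mulmxDr addrK.
  apply/Tsym/TD; apply/Tsym/gen1 => // l'.
    by rewrite wE => /(canRL (addKr _)); rewrite addrC -mulmxBl => /w0y.
  by move=> /(canRL opprK); rewrite -mulNmx => /w0y.
have Tall b c : T b c.
  elim/outer_ind: c => [//|c c' Hc Hc'|x y]; first exact: TD.
  elim/outer_ind: b => [|b b' Hb Hb'|z w]; first exact/Tsym.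
    by apply/Tsym/TD; apply: Tsym.
  exact: gen2.
by move=> a b; have := Tall a b 0; rewrite f0 !add0r.
Qed.


End MatrixCharts.

(** * Additive bijections preserving rank one *)

Definition in_right_ideal (R : pzRingType) (a b : R) : Prop := exists r, b = a * r.
Definition in_left_ideal (R : pzRingType) (a b : R) : Prop := exists r, b = r * a.

Section OuterIdeals.
Variable K : unitRingType.
Hypothesis fieldK : GRing.field_axiom K.
Variable n : nat.
Local Notation R := 'M[K]_n.
Implicit Types (a b c d : R) (x z : 'cV[K]_n) (y w v : 'rV[K]_n).

Lemma in_right_ideal_outer x y b : in_right_ideal (x *m y : R) b -> exists w, b = x *m w.
Proof. by move=> [r ->]; exists (y *m r); rewrite mx_mulE mulmxA. Qed.

Lemma in_left_ideal_outer x y b : in_left_ideal (x *m y : R) b -> exists z, b = z *m y.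
Proof. by move=> [r ->]; exists (r *m x); rewrite mx_mulE mulmxA. Qed.

Lemma outer_in_right_ideal x y w : y <> 0 -> in_right_ideal (x *m y : R) (x *m w).
Proof.
move=> /(row_dual fieldK)[k yk]; exists (k *m w).
by rewrite mx_mulE mulmxA -(mulmxA x) yk mulmx1.
Qed.

Lemma outer_in_left_ideal x y z : x <> 0 -> in_left_ideal (x *m y : R) (z *m y).
Proof.
move=> /(col_dual fieldK)[v vx]; exists (z *m v).
by rewrite mx_mulE mulmxA -(mulmxA z) vx mulmx1.
Qed.

(** By [outer_sub], the union of the two one-sided ideals of a rank one element can be described by
    rank alone, and is therefore respected by f. *)
Lemma in_ideal_sub_outer a b : rank1 a ->
  in_right_ideal a b \/ in_left_ideal a b <-> outer b /\ outer (a - b).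
Proof.
move=> [x [y [x0 y0 ->]]]; split=> [[]|].
- move=> /in_right_ideal_outer[w ->]; split; first by exists x, w.
  by exists x, (y - w); rewrite mulmxBr.
- move=> /in_left_ideal_outer[z ->]; split; first by exists z, y.
  by exists (x - z), y; rewrite mulmxBl.
move=> [[z [w ->]] [s [t /(outer_sub fieldK x0 y0)]]].
case=> -[l ->]; [left|right].
  by rewrite -mulmxA; apply: outer_in_right_ideal.
by rewrite mulmxA; apply: outer_in_left_ideal.
Qed.

Lemma in_right_ideal_sym a b : rank1 a -> rank1 b -> in_right_ideal a b -> in_right_ideal b a.
Proof.
move=> [x [y [x0 y0 ->]]] [z [w [z0 w0 ->]]] /in_right_ideal_outer[w' e].
have [[l ->] _] := outer_eq fieldK z0 w0 e.
by rewrite -mulmxA; apply: outer_in_right_ideal.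
Qed.

Lemma in_left_ideal_sym a b : rank1 a -> rank1 b -> in_left_ideal a b -> in_left_ideal b a.
Proof.
move=> [x [y [x0 y0 ->]]] [z [w [z0 w0 ->]]] /in_left_ideal_outer[w' e].
have [_ [l ->]] := outer_eq fieldK z0 w0 e.
by rewrite mulmxA; apply: outer_in_left_ideal.
Qed.

End OuterIdeals.

(** A group is not the union of two proper subgroups, applied to the preimages of P and Q. *)
Lemma additive_union (R S : zmodType) (f : R -> S) (P Q : S -> Prop) :
  (forall a b, f (a + b) = f a + f b) ->
  (forall s t, P s -> P t -> P (s - t)) -> (forall s t, Q s -> Q t -> Q (s - t)) ->
  (forall a, P (f a) \/ Q (f a)) -> (forall a, P (f a)) \/ (forall a, Q (f a)).
Proof.
move=> fD PB QB PQ; apply: contrapT => /not_orP[/existsNP[a nPa] /existsNP[b nQb]].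
have Qa : Q (f a) by case: (PQ a).
have Pb : P (f b) by case: (PQ b).
case: (PQ (a + b)); rewrite fD => h.
  by apply: nPa; rewrite -[f a](addrK (f b)); apply: PB.
by apply: nQb; rewrite -[f b](addrK (f a)) addrC [f b + _]addrC addrC; apply: QB.
Qed.

Section RankOnePreserver.
Variables (K K' : unitRingType).
Hypotheses (fieldK : GRing.field_axiom K) (fieldK' : GRing.field_axiom K').
Variables (n n' : nat).
Hypothesis n_gt1 : (1 < n)%N.
Local Notation R := 'M[K]_n.
Local Notation S := 'M[K']_n'.
Implicit Types (a b c d : R) (x z : 'cV[K]_n) (y w v : 'rV[K]_n).
Variable f : R -> S.
Hypothesis fD : forall a b, f (a + b) = f a + f b.
Hypothesis f1 : f 1 = 1.
Hypothesis f_rank1 : forall a, rank1 a <-> rank1 (f a).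
Hypothesis f_unit : forall a, invertible a <-> invertible (f a).
Hypothesis f_inj : injective f.

Let f0 : f 0 = 0. Proof. exact: additive0 fD. Qed.
Let fN a : f (- a) = - f a. Proof. exact: additiveN fD a. Qed.
Let fB a b : f (a - b) = f a - f b. Proof. by rewrite fD fN. Qed.

Lemma preserver_outer a : outer a <-> outer (f a).
Proof.
split=> oa.
  have [->|a0] := pselect (a = 0); first by rewrite f0; exists 0, 0; rewrite mul0mx.
  exact/rank1_outer/f_rank1/outer_rank1.
have [->|a0] := pselect (a = 0); first by exists 0, 0; rewrite mul0mx.
apply/rank1_outer/f_rank1/outer_rank1 => //.
by rewrite -f0 => /f_inj.
Qed.

Lemma preserver_ideal a b : rank1 a -> in_right_ideal a b \/ in_left_ideal a b ->
  in_right_ideal (f a) (f b) \/ in_left_ideal (f a) (f b).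
Proof.
move=> ra /(in_ideal_sub_outer fieldK _ ra)[ob oab].
apply/(in_ideal_sub_outer fieldK' _ ((f_rank1 a).1 ra)).
by rewrite -fB; split; apply/preserver_outer.
Qed.

Lemma in_right_idealB (T : pzRingType) (r s t : T) :
  in_right_ideal r s -> in_right_ideal r t -> in_right_ideal r (s - t).
Proof. by move=> [u ->] [v ->]; exists (u - v); rewrite mulrBr. Qed.

Lemma in_left_idealB (T : pzRingType) (r s t : T) :
  in_left_ideal r s -> in_left_ideal r t -> in_left_ideal r (s - t).
Proof. by move=> [u ->] [v ->]; exists (u - v); rewrite mulrBl. Qed.

Definition right_to_right a := forall r, in_right_ideal (f a) (f (a * r)).
Definition right_to_left a := forall r, in_left_ideal (f a) (f (a * r)).
Definition left_to_right a := forall r, in_right_ideal (f a) (f (r * a)).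
Definition left_to_left a := forall r, in_left_ideal (f a) (f (r * a)).

Lemma right_dichotomy a : rank1 a -> right_to_right a \/ right_to_left a.
Proof.
move=> ra; apply: (@additive_union R S (fun r => f (a * r))) => [r s|||r].
- by rewrite mulrDr fD.
- by move=> s t; apply: in_right_idealB.
- by move=> s t; apply: in_left_idealB.
by apply: preserver_ideal ra _; left; exists r.
Qed.

Lemma left_dichotomy a : rank1 a -> left_to_right a \/ left_to_left a.
Proof.
move=> ra; apply: (@additive_union R S (fun r => f (r * a))) => [r s|||r].
- by rewrite mulrDl fD.
- by move=> s t; apply: in_right_idealB.
- by move=> s t; apply: in_left_idealB.
by apply: preserver_ideal ra _; right; exists r.
Qed.

(** If f sent both ideals of a = xy into the same one-sided ideal, the image of xw - zy would be an
    outer product. For suitable w and z this matrix has rank two. *)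
Lemma ideal_exclusion a : rank1 a ->
  ~ (right_to_right a /\ left_to_right a) /\ ~ (right_to_left a /\ left_to_left a).
Proof.
move=> ra; case: (ra) => x [y [x0 y0 aE]].
have [w wy] := row_independent fieldK n_gt1 y; have [z zx] := col_independent fieldK n_gt1 x.
have w0 : w <> 0 by move=> e; apply: (wy 0); rewrite mul0mx.
have no : ~ outer (f (x *m w - z *m y)).
  move=> /preserver_outer[s [t /(outer_sub fieldK x0 w0)]].
  by case=> -[l]; [apply: zx|move=> /(row_scale_sym fieldK y0)[l' /wy]].
have [r rE] : in_right_ideal a (x *m w) by rewrite aE; apply: outer_in_right_ideal.
have [r' r'E] : in_left_ideal a (z *m y) by rewrite aE; apply: outer_in_left_ideal.
rewrite fB rE r'E in no; case: ((f_rank1 a).1 ra) => s [t [_ _ faE]].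
split=> -[/(_ r) h1 /(_ r') h2]; apply: no.
  have := in_right_idealB h1 h2; rewrite {1}faE => /in_right_ideal_outer[u ->].
  by exists s, u.
have := in_left_idealB h1 h2; rewrite {1}faE => /in_left_ideal_outer[u ->].
by exists u, t.
Qed.

Lemma right_to_right_transfer a b : rank1 a -> rank1 b -> in_right_ideal a b ->
  right_to_right a -> right_to_right b.
Proof.
move=> ra rb [r0 bE] h r; have [s fbE] := h r0; have [t e] := h (r0 * r).
rewrite -bE in fbE.
have [s' faE] : in_right_ideal (f b) (f a).
  by apply: (in_right_ideal_sym fieldK'); [exact/f_rank1..|exists s].
by exists (s' * t); rewrite mulrA -faE -e bE mulrA.
Qed.

Lemma left_to_left_transfer a b : rank1 a -> rank1 b -> in_left_ideal a b ->
  left_to_left a -> left_to_left b.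
Proof.
move=> ra rb [r0 bE] h r; have [s fbE] := h r0; have [t e] := h (r * r0).
rewrite -bE in fbE.
have [s' faE] : in_left_ideal (f b) (f a).
  by apply: (in_left_ideal_sym fieldK'); [exact/f_rank1..|exists s].
by exists (t * s'); rewrite -mulrA -faE -e bE mulrA.
Qed.

Lemma right_left_equiv a : rank1 a -> (right_to_right a <-> left_to_left a).
Proof.
move=> ra; have [ex1 ex2] := ideal_exclusion ra; split=> h.
  by case: (left_dichotomy ra) => // h'; case: ex1.
by case: (right_dichotomy ra) => // h'; case: ex2.
Qed.

(** From xy one passes to xw inside the right ideal, then to zw inside the left ideal;
    [right_left_equiv] switches the side in between. *)
Lemma right_to_right_all a b : rank1 a -> rank1 b -> right_to_right a -> right_to_right b.
Proof.
move=> ra rb ha; case: (ra) (rb) => x [y [x0 y0 aE]] [z [w [z0 w0 bE]]].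
have rc : rank1 (x *m w : R) by exists x, w.
have hc : right_to_right (x *m w).
  by apply: right_to_right_transfer ha => //; rewrite aE; apply: outer_in_right_ideal.
apply/right_left_equiv => //; move/(right_left_equiv rc): hc.
by apply: left_to_left_transfer => //; rewrite bE; apply: outer_in_left_ideal.
Qed.

(** The equation yx = 1 says that 1 - xy is singular, and f preserves singularity. *)
Lemma preserver_idempotent x y : y *m x = 1%:M ->
  forall (s : 'cV_n') (t : 'rV_n'), f (x *m y) = s *m t -> t *m s = 1%:M.
Proof.
move=> yx s t fE; apply: contrapT => /(invertible_outer fieldK') i.
have /f_unit/(invertible_outer fieldK) : invertible (f (1 - x *m y)) by rewrite fB f1 fE.
by apply.
Qed.

Lemma unit_outer_rank1 x y : y *m x = 1%:M -> rank1 (x *m y : R).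
Proof.
move=> yx; exists x, y; split=> // e; apply: (@mx11_neq0 K); rewrite -yx e.
  by rewrite mulmx0.
by rewrite mul0mx.
Qed.

Lemma preserver_f_idem x y : y *m x = 1%:M -> f (x *m y) * f (x *m y) = f (x *m y).
Proof.
move=> yx; have /f_rank1[s [t [_ _ fE]]] := unit_outer_rank1 yx.
have ts := preserver_idempotent yx fE.
by rewrite fE mx_mulE mulmxA -(mulmxA s) ts mulmx1.
Qed.

Lemma preserver_mult : (forall a, rank1 a -> right_to_right a) ->
  forall a b, f (a * b) = f a * f b.
Proof.
move=> H; apply: (additive_multiplicative fieldK n_gt1 fD).
- exact: preserver_f_idem.
- move=> x y r; have [e|ne] := pselect (x *m y = 0).
    by exists 0; rewrite e mul0r f0 mulr0.
  by apply: H; apply: outer_rank1 ne; exists x, y.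
move=> x z v vx vz.
have r1 := unit_outer_rank1 vx.
have /(right_left_equiv r1) h := H _ r1.
have zE : z *m v = (z *m v) * (x *m v).
  by rewrite mx_mulE mulmxA -(mulmxA z) vx mulmx1.
have [s sE] := h (z *m v); rewrite -zE in sE.
have [s1 [t1 [_ _ fE]]] := (f_rank1 _).1 r1.
have t1s1 := preserver_idempotent vx fE.
(* Besides xv, also (x + z)v is an idempotent. Comparing the normalisations of both images gives t1
   s s1 = 0, which is the required orthogonality. *)
have vxz : v *m (x + z) = 1%:M by rewrite mulmxDr vx vz addr0.
have fs : f ((x + z) *m v) = (s1 + s *m s1) *m t1.
  by rewrite [(x + z) *m v]mulmxDl fD sE fE mx_mulE mulmxDl mulmxA.
have := preserver_idempotent vxz fs; rewrite mulmxDr t1s1 => /(canRL (addKr _)); rewrite addNr => e.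
rewrite sE fE !mx_mulE [s *m _]mulmxA -(mulmxA s1) (mulmxA t1) e.
by rewrite mul0mx mulmx0.
Qed.

Lemma preserver_antimult : (forall a, rank1 a -> ~ right_to_right a) ->
  forall a b, f (a * b) = f b * f a.
Proof.
(* An antihomomorphism into S is a homomorphism into the opposite ring [S^c]. *)
move=> H; apply: (@additive_multiplicative _ fieldK _ n_gt1 S^c f fD).
- exact: preserver_f_idem.
- move=> x y r; have [e|ne] := pselect (x *m y = 0).
    by exists 0; rewrite e mul0r f0 mulr0.
  have rxy : rank1 (x *m y : R) by apply: outer_rank1 ne; exists x, y.
  by have [/(H _ rxy)//|] := right_dichotomy rxy; apply.
move=> x z v vx vz.
have r1 := unit_outer_rank1 vx.
have h : left_to_right (x *m v : R).
  by case: (left_dichotomy r1) => // /(right_left_equiv r1) /(H _ r1).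
have zE : z *m v = (z *m v) * (x *m v).
  by rewrite mx_mulE mulmxA -(mulmxA z) vx mulmx1.
have [s sE] := h (z *m v); rewrite -zE in sE.
have [s1 [t1 [_ _ fE]]] := (f_rank1 _).1 r1.
have t1s1 := preserver_idempotent vx fE.
have vxz : v *m (x + z) = 1%:M by rewrite mulmxDr vx vz addr0.
have fs : f ((x + z) *m v) = s1 *m (t1 + t1 *m s).
  by rewrite [(x + z) *m v]mulmxDl fD sE fE mx_mulE mulmxDr mulmxA.
have := preserver_idempotent vxz fs; rewrite mulmxDl t1s1 => /(canRL (addKr _)); rewrite addNr => e.
suff : f (z *m v) * f (x *m v) = 0 by [].
rewrite sE fE !mx_mulE mulmxA -(mulmxA s1 t1 s) -(mulmxA s1 _ s1) e.
by rewrite mulmx0 mul0mx.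
Qed.

Lemma preserver_iso_or_antiiso : bijective f -> ring_iso f \/ ring_antiiso f.
Proof.
move=> f_bij; have zf : zmod_morphism f by exact: fB.
have [[a [ra ha]]|no] := pselect (exists a, rank1 a /\ right_to_right a).
  left; split=> //; split=> //; apply: preserver_mult => b rb.
  exact: right_to_right_all ra rb ha.
right; split=> //; apply: preserver_antimult => a ra ha; apply: no.
by exists a.
Qed.

End RankOnePreserver.

(** * Distant isomorphisms over matrix rings *)

Section GeneralCharts.
Variable R : pzRingType.

Definition swap2 : GL2 R := MkGL2 (invertible2_swap R).

Lemma rep_swap2 p (a b : R) : rep p a b -> rep (GL2_map swap2 p) b a.
Proof.
move=> rp; have := rep_GL2_map (erefl (swap2 : 'M_2)) rp.
by rewrite !mulr1 !mulr0 addr0 add0r.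
Qed.

Lemma swap2_aff (a : R) : GL2_map swap2 (aff a) = coaff a.
Proof. exact: rep_inj (rep_swap2 (rep_aff a)) (rep_coaff a). Qed.

Lemma swap2_coaff (a : R) : GL2_map swap2 (coaff a) = aff a.
Proof. exact: rep_inj (rep_swap2 (rep_coaff a)) (rep_aff a). Qed.

Lemma aff_unit (u v : R) : u * v = 1 -> v * u = 1 -> aff u = coaff v.
Proof.
move=> uv vu; have iv : invertible v by exists u.
apply: rep_inj (rep_coaff v); have := rep_unit (rep_aff u) iv.
by rewrite vu mulr1.
Qed.

Lemma aff1 : aff (1 : R) = coaff 1.
Proof. by apply: aff_unit; rewrite mulr1. Qed.

Lemma distant_inf_aff (a : R) : distant (inf R) (aff a).
Proof. by apply/distant_sym/distant_infP; exists a. Qed.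

Lemma distant_aff_aff (a b : R) : distant (aff a) (aff b) <-> invertible (a - b).
Proof. by rewrite (distant_aff _ (rep_aff a)) mul1r. Qed.

Lemma distant_triple (p q r : proj_line R) : distant p q -> distant p r -> distant q r ->
  exists g : GL2 R, [/\ GL2_map g (inf R) = p, GL2_map g (aff 0) = q & GL2_map g (aff 1) = r].
Proof.
move=> /distant_rep[a [b [c [d [rp rq i]]]]].
have [h [gh hg]] := GL2_inv (MkGL2 i).
have iE : (MkGL2 i : 'M[R]_2) = mx2 a b c d by [].
have hp : GL2_map (MkGL2 i) (inf R) = p.
  by apply: (rep_inj (rep_GL2_map iE (rep_inf R))); rewrite !mul1r !mul0r !addr0.
have hq : GL2_map (MkGL2 i) (aff 0) = q.
  by apply: (rep_inj (rep_GL2_map iE (rep_aff 0))); rewrite !mul0r !mul1r !add0r.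
have [s sE] := bij_surj (GL2_map_bij (MkGL2 i)) r.
rewrite -hp -hq -sE !distant_GL2 => /distant_sym/distant_infP[e ->] /distant_sym.
rewrite distant_aff_aff subr0 => ie.
(* The matrix with rows representing p and q already places two points; diag(e,1) fixes R(1,0) and
   R(0,1) and moves R(1,1) to R(e,1). *)
have id : invertible2 (mx2 e 0 0 1 : 'M[R]_2).
  by apply/invertible2_diag; split=> //; apply: invertible1.
exists (MkGL2 (GL2_mul_subproof (MkGL2 id) (MkGL2 i))); rewrite !GL2_mapM.
have idE : (MkGL2 id : 'M[R]_2) = mx2 e 0 0 1 by [].
have dE (a' : R) : GL2_map (MkGL2 id) (aff a') = aff (a' * e).
  apply: (rep_inj (rep_GL2_map idE (rep_aff a'))).
  by rewrite !mulr0 mulr1 add0r addr0; apply: rep_aff.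
rewrite !dE mul0r mul1r; split=> //; congr GL2_map.
apply: (rep_inj (rep_GL2_map idE (rep_inf R))).
rewrite mul1r !mul0r mulr0 !addr0; have := rep_unit (rep_inf R) ie.
by rewrite mulr1 mulr0.
Qed.

End GeneralCharts.

Lemma ring_iso_or_antiiso_1 (R S : pzRingType) (f : R -> S) :
  ring_iso f \/ ring_antiiso f -> [/\ bijective f, zmod_morphism f, f 1 = 1 &
   forall u v, u * v = 1 -> v * u = 1 -> f u * f v = 1 /\ f v * f u = 1].
Proof.
case=> [[fb fz [f1 fM]]|[fb fz f1 fM]]; split=> // u v uv vu.
  by rewrite -!fM uv vu.
by rewrite -!fM uv vu.
Qed.

Section MatrixTheorem.
Variables (K K' : unitRingType).
Hypotheses (fieldK : GRing.field_axiom K) (fieldK' : GRing.field_axiom K').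
Variables (n n' : nat).
Hypothesis n_gt1 : (1 < n)%N.
Local Notation R := 'M[K]_n.
Local Notation S := 'M[K']_n'.

Lemma normalized_chart (phi : proj_line R -> proj_line S) : distant_iso phi ->
  phi (inf R) = inf S -> phi (aff 0) = aff 0 -> phi (aff 1) = aff 1 ->
  exists f : R -> S, (ring_iso f \/ ring_antiiso f) /\ forall a, phi (aff a) = aff (f a).
Proof.
move=> phi_iso phi_inf phi0 phi1; have [f fE] := chart_map phi_iso phi_inf.
have f0 : f 0 = 0 by apply: aff_inj; rewrite -fE.
have f1 : f 1 = 1 by apply: aff_inj; rewrite -fE.
have f_bij := chart_bij phi_iso phi_inf fE.
exists f; split=> //; apply: (preserver_iso_or_antiiso fieldK fieldK' n_gt1) => //.
- exact: chart_additive phi_iso phi_inf fE f0.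
- move=> a; have := adjacent_iso phi_iso (aff a) (aff 0).
  by rewrite !fE (adjacent_aff_aff fieldK) (adjacent_aff_aff fieldK') f0 !subr0.
- by move=> a; have := chart_invertible phi_iso fE a 0; rewrite f0 !subr0.
exact: bij_inj.
Qed.

Lemma normalized_charts (phi : proj_line R -> proj_line S) : distant_iso phi ->
  phi (inf R) = inf S -> phi (aff 0) = aff 0 -> phi (aff 1) = aff 1 ->
  exists f : R -> S, [/\ ring_iso f \/ ring_antiiso f, forall a, phi (aff a) = aff (f a)
    & forall a, phi (coaff a) = coaff (f a)].
Proof.
move=> phi_iso phi_inf phi0 phi1; have [f [fiso fE]] := normalized_chart phi_iso phi_inf phi0 phi1.
exists f; split=> //.
pose psi := GL2_map (swap2 S) \o phi \o GL2_map (swap2 R).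
have psi_iso : distant_iso psi.
  apply: distant_iso_comp; first exact: GL2_map_distant_iso.
  by apply: distant_iso_comp => //; exact: GL2_map_distant_iso.
have psiE a : psi (aff a) = GL2_map (swap2 S) (phi (coaff a)).
  by rewrite /psi /= swap2_aff.
have [|||g [giso gE]] := normalized_chart psi_iso.
- by rewrite /psi /= swap2_coaff phi0 swap2_aff.
- by rewrite psiE phi_inf swap2_coaff.
- by rewrite psiE -aff1 phi1 swap2_aff -aff1.
have phig a : phi (coaff a) = coaff (g a).
  apply: (bij_inj (GL2_map_bij (swap2 S))).
  by rewrite -psiE gE swap2_coaff.
have [_ fz f1 fV] := ring_iso_or_antiiso_1 fiso.
have [_ gz g1 gV] := ring_iso_or_antiiso_1 giso.
have D (h : R -> S) : zmod_morphism h -> forall a b, h (a + b) = h a + h b.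
  move=> hz a b; have h0 : h 0 = 0 by rewrite -(subrr 0) hz subrr.
  by rewrite -[b in LHS]opprK hz -(sub0r b) hz h0 sub0r opprK.
have fg : f =1 g.
  (* Unit points lie in both charts, as R(v,1) = R(1,u) for v inverse to u. Since f respects
     inverses, the two descriptions of the image coincide there. *)
  apply: (additive_eq_on_units fieldK n_gt1 (D f fz) (D g gz)) => u [v [uv vu]].
  have [e1 e2] := fV _ _ vu uv; apply: coaff_inj; rewrite -phig.
  by rewrite -(aff_unit vu uv) fE; symmetry; apply: aff_unit.
by move=> a; rewrite phig fg.
Qed.

Lemma shift_jordan (T : pzRingType) (a b : T) :
  GL2_map (MkGL2 (invertible2_shear (- b))) (jordan_point a b) = coaff (- a).
Proof.
have sE : (MkGL2 (invertible2_shear (- b)) : 'M[T]_2) = mx2 1 0 (- b) 1 by [].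
have := rep_GL2_map sE (jordan_rep a b).
rewrite !mulr1 mulr0 add0r mulrN addrAC subrr sub0r => rj.
have im : invertible (-1 : T) by apply/invertibleN/invertible1.
apply: (rep_inj (rep_unit rj im)).
by rewrite !mulN1r opprK; apply: rep_coaff.
Qed.

(* Translating the chart by b moves R(ab-1,a) to R(1,-a), where the normalised map
   is already known. *)
Lemma matrix_distant_iso (phi : proj_line R -> proj_line S) : distant_iso phi ->
  exists (g : GL2 S) (f : R -> S), (ring_iso f \/ ring_antiiso f) /\
    forall a b, phi (jordan_point a b) = GL2_map g (jordan_point (f a) (f b)).
Proof.
move=> phi_iso.
have dist a b : distant (aff a) (aff b) -> distant (phi (aff a)) (phi (aff b)).
  by move/(proj2 phi_iso).
have [g [ginf g0 g1]] : exists g : GL2 S, [/\ GL2_map g (inf S) = phi (inf R),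
    GL2_map g (aff 0) = phi (aff 0) & GL2_map g (aff 1) = phi (aff 1)].
  apply: distant_triple.
  - exact/(proj2 phi_iso)/distant_inf_aff.
  - exact/(proj2 phi_iso)/distant_inf_aff.
  - by apply/dist/distant_aff_aff; rewrite sub0r; apply/invertibleN/invertible1.
have [h [gh hg]] := GL2_inv g.
have ghK := GL2_map_cancel gh; have hgK := GL2_map_cancel hg.
pose psi := GL2_map h \o phi.
have psi_iso : distant_iso psi by apply: distant_iso_comp => //; exact: GL2_map_distant_iso.
have psi_inf : psi (inf R) = inf S by rewrite /psi /= -ginf ghK.
have psi0 : psi (aff 0) = aff 0 by rewrite /psi /= -g0 ghK.
have psi1 : psi (aff 1) = aff 1 by rewrite /psi /= -g1 ghK.
have [f [fiso fE cofE]] := normalized_charts psi_iso psi_inf psi0 psi1.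
have [_ fz f1 _] := ring_iso_or_antiiso_1 fiso.
exists g, f; split=> // a b; rewrite -[LHS]hgK; congr GL2_map; rewrite -/(psi _).
(* Conjugation by the translations leaves the affine chart map unchanged, as f is additive. So the
   second chart map of [psib] is again f. *)
pose psib := GL2_map (shift (f b)) \o psi \o GL2_map (shift (- b)).
have psib_iso : distant_iso psib.
  apply: distant_iso_comp; first exact: GL2_map_distant_iso.
  by apply: distant_iso_comp => //; exact: GL2_map_distant_iso.
have f0 : f 0 = 0 by rewrite -(subrr 0) fz subrr.
have fN c : f (- c) = - f c by rewrite -sub0r fz f0 sub0r.
have psibE c : psib (aff c) = aff (f c).
  by rewrite /psib /= shift_aff opprK fE shift_aff -[b in c + b]opprK fz fN opprK addrK.
have [|||fb [_ fbE cofbE]] := normalized_charts psib_iso.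
- by rewrite /psib /= shift_inf psi_inf shift_inf.
- by rewrite psibE f0.
- by rewrite psibE f1.
have fbf c : fb c = f c by apply: aff_inj; rewrite -fbE psibE.
apply: (bij_inj (GL2_map_bij (shift (f b)))).
rewrite [RHS]shift_jordan -fN -[f (- a)]fbf -cofbE /psib /=; congr (GL2_map _ (psi _)).
apply: (bij_inj (GL2_map_bij (shift b))); rewrite [LHS]shift_jordan.
rewrite -[LHS](@GL2_map_cancel _ (shift (- b)) (shift b)) //=.
by rewrite mx2_shearP opprK !mul0r !mul1r addr0 subrr mx2_1.
Qed.

End MatrixTheorem.

(** * Endomorphism rings as matrix rings *)

Import VectorInternalTheory.

Section Endomorphisms.
Variables (K : unitRingType) (U : vectType K).

(** Coordinate rows are multiplied by the matrix from the right, which agrees with composition from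
    left to right; so this is a homomorphism and not an antihomomorphism. *)
Definition end_mx (f : endring U) : 'M[K]_(dim U) := f2mx f.

Lemma end_mx_bij : bijective end_mx.
Proof. by exists (fun A => Hom A : endring U) => [[]|]. Qed.

Lemma end_mx_row (f : endring U) i :
  row i (end_mx f) = v2r ((f : 'End(U)) (r2v (delta_mx ord0 i))).
Proof. by rewrite unlock /= r2vK r2vK rowE. Qed.

Lemma end_mx_zmod_morphism : zmod_morphism end_mx.
Proof.
move=> f g; apply/row_matrixP => i; rewrite raddfB /= !end_mx_row.
by rewrite add_lfunE opp_lfunE raddfB.
Qed.

Lemma end_mx_monoid_morphism : monoid_morphism end_mx.
Proof.
split=> [|f g]; apply/row_matrixP => i; first by rewrite end_mx_row id_lfunE r2vK rowE mulmx1.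
rewrite row_mul !end_mx_row comp_lfunE unlock /= !r2vK.
by rewrite -mulmxA.
Qed.

HB.instance Definition _ := GRing.isZmodMorphism.Build (endring U) 'M[K]_(dim U) end_mx
  end_mx_zmod_morphism.
HB.instance Definition _ := GRing.isMonoidMorphism.Build (endring U) 'M[K]_(dim U) end_mx
  end_mx_monoid_morphism.

End Endomorphisms.

(** * Semilocal rings *)

Lemma separating_transfer (R S : pzRingType) (f : proj_line R -> proj_line S) :
  distant_iso f -> separating S -> separating R.
Proof.
move=> f_iso sepS p q r /(distant_iso_neq f_iso) pq /(distant_iso_neq f_iso) pr.
have [s [sq sr sp]] := sepS _ _ _ pq pr; case: f_iso => fb fd.
have [t tE] := bij_surj fb s; subst s.
by exists t; split; rewrite fd.
Qed.

Section EndomorphismLine.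
Variables (K : unitRingType) (U : vectType K).
Hypothesis fieldK : GRing.field_axiom K.
Local Notation theta := (@end_mx K U : {rmorphism endring U -> 'M[K]_(dim U)}).

Lemma end_mx_line_iso : distant_iso (proj_map theta).
Proof.
apply: proj_map_distant_iso; [exact/bij_surj/end_mx_bij|exact: bij_local (end_mx_bij U)|].
exact/bij_inj/end_mx_bij.
Qed.

Lemma separating_end : separating (endring U).
Proof. exact: separating_transfer end_mx_line_iso (separating_mx fieldK (n := dim U)). Qed.

Lemma end_nontrivial : (0 < dim U)%N -> (1 : endring U) <> 0.
Proof.
move=> d0 /(congr1 theta); rewrite rmorph1 rmorph0.
move=> /matrixP/(_ (Ordinal d0) (Ordinal d0)); rewrite !mxE eqxx => /eqP.
by rewrite oner_eq0.
Qed.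

End EndomorphismLine.

Lemma end_distant_iso (K K' : unitRingType) (fieldK : GRing.field_axiom K)
    (fieldK' : GRing.field_axiom K') (U : vectType K) (U' : vectType K')
    (phi : proj_line (endring U) -> proj_line (endring U')) :
  (1 < dim U)%N -> distant_iso phi ->
  exists (g : GL2 (endring U')) (f : endring U -> endring U'),
    (ring_iso f \/ ring_antiiso f) /\
    forall a b, phi (jordan_point a b) = GL2_map g (jordan_point (f a) (f b)).
Proof.
move=> d1 phi_iso.
pose th : {rmorphism endring U -> 'M[K]_(dim U)} := @end_mx K U.
pose th' : {rmorphism endring U' -> 'M[K']_(dim U')} := @end_mx K' U'.
have [P thP] : exists P, cancel (proj_map th) P /\ cancel P (proj_map th).
  by have [[P h1 h2] _] := end_mx_line_iso U; exists P.
have [h [f [fiso fE]]] := matrix_distant_iso fieldK fieldK' d1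
  (distant_iso_comp (distant_iso_comp (distant_iso_inv thP.1 thP.2 (end_mx_line_iso U)) phi_iso)
    (end_mx_line_iso U')).
have th_bij : bijective th := end_mx_bij U.
have [g' th'K g'K] : bijective th' := end_mx_bij U'.
have g'_inj : injective g' := can_inj g'K.
have g'D : zmod_morphism g' by move=> a b; apply: (can_inj th'K); rewrite rmorphB !g'K.
have g'1 : g' 1 = 1 by apply: (can_inj th'K); rewrite rmorph1 g'K.
have g'M a b : g' (a * b) = g' a * g' b by apply: (can_inj th'K); rewrite rmorphM !g'K.
have g'b : bijective g' by exists th'.
have hE : map_mx th' (map_mx g' h) = h by apply/matrixP => i j; rewrite !mxE g'K.
have ig : invertible2 (map_mx g' h).
  apply/(invertible2_local (f := th')).
  - exact/bij_surj/end_mx_bij.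
  - exact: bij_local (end_mx_bij U').
  by rewrite hE; apply: GL2_valP.
exists (MkGL2 ig), (g' \o f \o th); split.
  case: fiso => [[fb fz [f1 fM]]|[fb fz f1 fM]]; [left|right]; split=> //.
  - by apply: bij_comp => //; apply: bij_comp.
  - by move=> a b; rewrite /= rmorphB fz g'D.
  - by split=> [|a b]; rewrite /= ?rmorph1 ?rmorphM ?f1 ?fM ?g'1 ?g'M.
  - by apply: bij_comp => //; apply: bij_comp.
  - by move=> a b; rewrite /= rmorphB fz g'D.
  - by rewrite /= rmorph1 f1 g'1.
  - by move=> a b; rewrite /= rmorphM fM g'M.
move=> a b; apply: (bij_inj (proj1 (end_mx_line_iso U'))).
have := fE (th a) (th b); rewrite /= -(proj_map_jordan th) thP.1 => ->.
by rewrite (proj_map_GL2 (h := h)) // proj_map_jordan /= !g'K.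
Qed.

Section BarPoint.
Variables (R B : pzRingType) (iota : {rmorphism quot_rad R -> B}).
Hypothesis iota_bij : bijective iota.

Lemma bar_point_distant p q : distant (bar_point iota p) (bar_point iota q) <-> distant p q.
Proof.
rewrite /bar_point distant_proj_map ?distant_proj_map //.
- exact: to_quot_rad_surj.
- exact: to_quot_rad_local.
- exact: bij_surj.
exact: bij_local.
Qed.

Lemma bar_point_surj x : exists p, bar_point iota p = x.
Proof.
have [|//|y <-] := @proj_map_surj _ _ iota _ _ x; first exact: bij_surj.
  exact: bij_local.
have [||p <-] := @proj_map_surj _ _ (@to_quot_rad R) _ _ y; last by exists p.
  exact: to_quot_rad_surj.
exact: to_quot_rad_local.
Qed.

End BarPoint.

(** If p and q differed at i, separation would give a point distant from p everywhere but not from q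
    at i. *)
Lemma parallel_prod_eq (m : nat) (S : 'I_m -> pzRingType) (p q : proj_line (prod_ring S)) :
  (forall i, (1 : S i) <> 0) -> (forall i, separating (S i)) -> parallel p q -> p = q.
Proof.
move=> nt sepS pq; apply: component_inj => i; apply: contrapT => ne.
have [k|s hs] := @component_choice _ S (fun k z => distant z (component k p) /\
    (k = i -> ~ distant z (component k q))).
  have [e|ki] := pselect (k = i).
    by subst k; have [s [sp _ sq]] := sepS _ _ _ _ (nesym ne) (nesym ne); exists s.
  by have [s [sp _]] := common_distant nt sepS (component k p) (component k p); exists s.
have /distant_prod/(_ i) : distant s q.
  by apply: pq; apply/distant_prod => k; case: (hs k).
by have [_ /(_ erefl)] := hs i.
Qed.

(** Reindexes a dependent family along a bijection. Injectivity and the uniqueness of equality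
    proofs make the transported value independent of the preimage. *)
Lemma family_along (I J : choiceType) (tau : I -> J) (F : J -> Type) (x : forall i, F (tau i)) :
  injective tau -> (forall j, exists i, tau i = j) ->
  exists y : forall j, F j, forall i, y (tau i) = x i.
Proof.
move=> tau_inj tau_surj.
have H j : exists y : F j, forall i (e : tau i = j), ecast k (F k) e (x i) = y.
  have [i e] := tau_surj j; subst j; exists (x i) => i' e.
  by have e' := tau_inj _ _ e; subst i'; rewrite eq_axiomK.
exists (fun j => projT1 (cid (H j))) => i.
by have := projT2 (cid (H (tau i))) i (erefl _).
Qed.

Lemma ring_iso_or_antiiso_jordan (R S : pzRingType) (f : R -> S) :
  ring_iso f \/ ring_antiiso f -> jordan_iso f.
Proof.
case=> [[fb fz [f1 fM]]|[fb fz f1 fM]]; split=> //; split=> // a b;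
  by rewrite !fM // mulrA.
Qed.

Section Induced.
Variables (m m' : nat) (S : 'I_m -> pzRingType) (S' : 'I_m' -> pzRingType).
Hypothesis nontrivial : forall i, (1 : S i) <> 0.
Hypothesis nontrivial' : forall i, (1 : S' i) <> 0.
Hypothesis sepS : forall i, separating (S i).
Hypothesis sepS' : forall i, separating (S' i).
Variables (R R' : pzRingType).
Variables (iota : {rmorphism quot_rad R -> prod_ring S})
  (iota' : {rmorphism quot_rad R' -> prod_ring S'}).
Hypotheses (iota_bij : bijective iota) (iota'_bij : bijective iota').
Variable phi : proj_line R -> proj_line R'.

Lemma distant_iso_parallel : distant_iso phi -> parallel_iso phi.
Proof.
move=> [phi_bij phi_d]; split=> // p q; split=> h r.
  by have [s <-] := bij_surj phi_bij r; rewrite -!phi_d; apply: h.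
by rewrite !phi_d; apply: h.
Qed.

Lemma bar_point_eq (T : pzRingType) (mm : nat) (Q : 'I_mm -> pzRingType)
    (j : {rmorphism quot_rad T -> prod_ring Q}) : bijective j ->
  (forall i, (1 : Q i) <> 0) -> (forall i, separating (Q i)) ->
  forall p q, bar_point j p = bar_point j q <-> parallel p q.
Proof.
move=> jb nt sepQ p q; split=> [e r|pq].
  by rewrite -!(bar_point_distant jb) e.
apply: parallel_prod_eq => // r.
have [t <-] := bar_point_surj jb r.
by rewrite !(bar_point_distant jb); apply: pq.
Qed.

Lemma induced_distant_iso : distant_iso phi ->
  exists2 phibar, induced_bijection iota iota' phi phibar & distant_iso phibar.
Proof.
move=> phi_iso; have [phi_bij phi_d] := phi_iso.
have [_ phi_par] := distant_iso_parallel phi_iso.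
have [P PE] := choice (bar_point_surj iota_bij).
pose phibar x := bar_point iota' (phi (P x)).
have barE p : phibar (bar_point iota p) = bar_point iota' (phi p).
  apply/(bar_point_eq iota'_bij nontrivial' sepS'); rewrite -phi_par.
  by rewrite -(bar_point_eq iota_bij nontrivial sepS) PE.
have bar_bij : bijective phibar.
  apply: bij_of_inj_surj => [x y|y].
    rewrite -(PE x) -(PE y) !barE => /(bar_point_eq iota'_bij nontrivial' sepS').
    by rewrite -phi_par => /(bar_point_eq iota_bij nontrivial sepS).
  have [q <-] := bar_point_surj iota'_bij y; have [p <-] := bij_surj phi_bij q.
  by exists (bar_point iota p).
exists phibar; split=> // x y.
rewrite -(PE x) -(PE y) !barE (bar_point_distant iota_bij) (bar_point_distant iota'_bij).
exact: phi_d.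
Qed.

Section ProductForm.
Variables (phibar : proj_line (prod_ring S) -> proj_line (prod_ring S')).
Variables (Em : m = m') (s : 'S_m)
  (phik : forall k : 'I_m, proj_line (S k) -> proj_line (S' (cast_ord Em (s k)))).
Hypothesis phibar_form : product_form phibar phik.

Lemma index_map_surj j : exists k, cast_ord Em (s k) = j.
Proof. by exists ((s^-1)%g (cast_ord (esym Em) j)); rewrite permKV cast_ordKV. Qed.

Lemma index_map_inj : injective (fun k => cast_ord Em (s k)).
Proof. by move=> k l /cast_ord_inj/perm_inj. Qed.

Lemma product_form_distant_iso : bijective phi ->
  induced_bijection iota iota' phi phibar -> distant_iso phi.
Proof.
move=> phi_bij [_ barE]; case: phibar_form => phik_iso phibarE; split=> // p q.
rewrite -(bar_point_distant iota_bij) -(bar_point_distant iota'_bij) -!barE.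
rewrite !distant_prod; split=> H.
  move=> j; have [k <-] := index_map_surj j.
  by rewrite !phibarE -(proj2 (phik_iso k)).
by move=> k; rewrite (proj2 (phik_iso k)) -!phibarE.
Qed.

(** The map [alphat] is taken to be [phibar] followed by the inverse of [gamma]; the content is that
    it is induced by [alpha], which is checked in each component. *)
Lemma product_form_jordan :
  (forall k, exists (g : GL2 (S' (cast_ord Em (s k)))) (f : S k -> S' (cast_ord Em (s k))),
    (ring_iso f \/ ring_antiiso f) /\
    forall a b, phik (jordan_point a b) = GL2_map g (jordan_point (f a) (f b))) ->
  exists (alpha : prod_ring S -> prod_ring S')
     (alphak : forall k : 'I_m, S k -> S' (cast_ord Em (s k)))
     (alphat : proj_line (prod_ring S) -> proj_line (prod_ring S'))
     (gamma : GL2 (prod_ring S')),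
   [/\ jordan_iso alpha,
       forall k, ring_iso (alphak k) \/ ring_antiiso (alphak k),
       forall x k, prod_coord (cast_ord Em (s k)) (alpha x) = alphak k (prod_coord k x),
       jordan_induced alpha alphat &
       forall q, phibar q = GL2_map gamma (alphat q)].
Proof.
move=> H; pose gk k := projT1 (cid (H k)); pose Hg k := projT2 (cid (H k)).
pose alphak k := projT1 (cid (Hg k)).
have alphakE k : (ring_iso (alphak k) \/ ring_antiiso (alphak k)) /\
    forall a b, phik (jordan_point a b) =
      GL2_map (gk k) (jordan_point (alphak k a) (alphak k b)).
  exact: projT2 (cid (Hg k)).
have [g gE] := family_along (F := fun j => GL2 (S' j)) gk index_map_inj index_map_surj.
have [M ME] := @mx2_prod_choice _ S' (fun j M => M = g j) (fun j => ex_intro _ _ erefl).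
have iM : invertible2 M by apply/invertible2_prod => j; rewrite ME; apply: GL2_valP.
pose gamma := MkGL2 iM; have [h [gh hg]] := GL2_inv gamma.
have /choice[alpha alphaE] : forall x : prod_ring S, exists y : prod_ring S',
    forall k, prod_coord (cast_ord Em (s k)) y = alphak k (prod_coord k x).
  move=> x; have [y yE] := family_along (F := fun j => S' j)
    (fun k => alphak k (prod_coord k x)) index_map_inj index_map_surj.
  by exists (prod_of y) => k; rewrite prod_coordE yE.
have ext (y z : prod_ring S') : (forall k, prod_coord (cast_ord Em (s k)) y =
    prod_coord (cast_ord Em (s k)) z) -> y = z.
  by move=> yz; apply: prod_ringP => j; have [k <-] := index_map_surj j.
have jk k : jordan_iso (alphak k).
  by apply: ring_iso_or_antiiso_jordan; case: (alphakE k).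
exists alpha, alphak, (GL2_map h \o phibar), gamma; split=> //.
- split; last first.
    apply: bij_of_inj_surj => [x y e|y].
      apply: prod_ringP => k; apply: (bij_inj (proj2 (jk k))).
      by rewrite -!alphaE e.
    have [k|x hx] := @prod_choice _ S
        (fun k z => alphak k z = prod_coord (cast_ord Em (s k)) y).
      by have [z] := bij_surj (proj2 (jk k)) (prod_coord (cast_ord Em (s k)) y); exists z.
    by exists x; apply: ext => k; rewrite alphaE.
  split=> [x y||x y]; apply: ext => k; have [[fz f1 fJ] _] := jk k.
  - by rewrite alphaE !rmorphB /= !alphaE fz.
  - by rewrite alphaE !rmorph1.
  - by rewrite alphaE !rmorphM /= !alphaE fJ.
- by move=> k; case: (alphakE k).
- move=> a b; apply: (bij_inj (GL2_map_bij gamma)); rewrite /= (GL2_map_cancel hg).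
  apply: component_inj => j; have [k <-] := index_map_surj j.
  case: phibar_form => _ ->; rewrite /component proj_map_jordan (proj2 (alphakE k)).
  rewrite (proj_map_GL2 (h := gk k)); last by rewrite -gE; apply: ME.
  by rewrite proj_map_jordan /= !alphaE.
by move=> q; rewrite /= (GL2_map_cancel hg).
Qed.

End ProductForm.
End Induced.

Theorem corollary6p8 (R R' : nzRingType)
    (semilocR : semilocal R) (semilocR' : semilocal R')
    (m m' : nat) (m_gt0 : (0 < m)%N) (m'_gt0 : (0 < m')%N)
    (K : 'I_m -> unitRingType) (K' : 'I_m' -> unitRingType)
    (fieldK : forall i, GRing.field_axiom (K i))
    (fieldK' : forall j, GRing.field_axiom (K' j))
    (U : forall i, vectType (K i)) (U' : forall j, vectType (K' j))
    (dimU_gt0 : forall i, (0 < dim (U i))%N)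
    (dimU'_gt0 : forall j, (0 < dim (U' j))%N)
    (iota : {rmorphism quot_rad R -> prod_ring (fun i => endring (U i))})
    (iota' : {rmorphism quot_rad R' -> prod_ring (fun j => endring (U' j))})
    (iota_bij : bijective iota) (iota'_bij : bijective iota')
    (phi : proj_line R -> proj_line R') (phi_bij : bijective phi) :
  (distant_iso phi <->
     parallel_iso phi /\
     exists2 phibar, induced_bijection iota iota' phi phibar &
       exists (Em : m = m') (s : 'S_m)
         (phik : forall k : 'I_m, proj_line (endring (U k)) ->
                   proj_line (endring (U' (cast_ord Em (s k))))),
         product_form phibar phik)
  /\
  (distant_iso phi -> (forall i, (1 < dim (U i))%N) ->
   forall phibar, induced_bijection iota iota' phi phibar ->
   forall (Em : m = m') (s : 'S_m)
     (phik : forall k : 'I_m, proj_line (endring (U k)) ->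
               proj_line (endring (U' (cast_ord Em (s k))))),
   product_form phibar phik ->
   exists (alpha : prod_ring (fun i => endring (U i)) ->
                   prod_ring (fun j => endring (U' j)))
     (alphak : forall k : 'I_m,
        endring (U k) -> endring (U' (cast_ord Em (s k))))
     (alphat : proj_line (prod_ring (fun i => endring (U i))) ->
               proj_line (prod_ring (fun j => endring (U' j))))
     (gamma : GL2 (prod_ring (fun j => endring (U' j)))),
   [/\ jordan_iso alpha,
       forall k, ring_iso (alphak k) \/ ring_antiiso (alphak k),
       forall x k, prod_coord (cast_ord Em (s k)) (alpha x)
                   = alphak k (prod_coord k x),
       jordan_induced alpha alphat &
       forall q, phibar q = GL2_map gamma (alphat q)]).

Proof.
have nt i := end_nontrivial (dimU_gt0 i); have nt' j := end_nontrivial (dimU'_gt0 j).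
have sepU i := separating_end (U := U i) (fieldK i).
have sepU' j := separating_end (U := U' j) (fieldK' j).
split; [split|].
- move=> phi_iso; split; first exact: distant_iso_parallel.
  have [phibar indu bar_iso] := induced_distant_iso nt nt' sepU sepU' iota_bij iota'_bij phi_iso.
  by exists phibar => //; apply: distant_iso_product_form.
- move=> [_ [phibar indu [Em [s [phik form]]]]].
  exact: (product_form_distant_iso iota_bij iota'_bij form phi_bij indu).
move=> _ dimU phibar _ Em s phik form.
apply: (product_form_jordan form) => k; case: form => phik_iso _.
exact: end_distant_iso.
Qed.
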